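(* Let $n\geq 1$ and let $L:\mathbb{R}^n\to\mathbb{R}$ be a polynomial with $\deg(L)\geq 2$. Let $\Omega\subset\mathbb{R}^n$ be a non-trivial polyhedral set, and assume that for every face $\mathcal{F}$ of $\Omega$ that is not a vertex, the restriction of $L$ to $\mathcal{F}$ (viewed as a polynomial in affine coordinates $p\mapsto L(x_0+Zp)$ of the affine hull of $\mathcal{F}$) has degree at least $2$. Let $x^\ast\in\Omega$ be a critical point of $L+\iota_\Omega$, i.e. $0\in\nabla L(x^\ast)+\mathcal{N}_\Omega(x^\ast)$. Then there exist constants $\delta>0$ and $c>0$ such that for all $x\in\mathcal{B}(x^\ast,\delta)\cap\Omega$ and all $v\in\mathcal{N}_\Omega(x)$, $$\|\nabla L(x)+v\|_2\;\geq\; c\,|L(x)-L(x^\ast)|^{\theta(\deg(L),n)},\qquad\text{where }\ \theta(d,n):=1-\frac{1}{d(3d-3)^{n-1}}.$$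
   Context: $\iota_\Omega$ denotes the indicator function of $\Omega$ ($0$ on $\Omega$, $+\infty$ outside). For a convex set $\Omega$ and $\bar x\in\Omega$, the normal cone is $\mathcal{N}_\Omega(\bar x)=\{v:\ v^\top(x-\bar x)\le 0\ \forall x\in\Omega\}$. $\mathcal{B}(x,r)$ is the open Euclidean ball of center $x$ and radius $r$. *)

(* Defs.v *)
(* classical real numbers.
   Points of R^n are represented as functions  nat -> R  of which only the
   coordinates 0..n-1 are ever used (all notions below only look at them). *)
From Stdlib Require Import Reals List.
Open Scope R_scope.

Fixpoint vsum (n : nat) (f : nat -> R) : R :=
  match n with O => 0 | S k => vsum k f + f k end.
Fixpoint vprod (n : nat) (f : nat -> R) : R :=
  match n with O => 1 | S k => vprod k f * f k end.
Fixpoint nsum (n : nat) (f : nat -> nat) : nat :=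
  match n with O => O | S k => (nsum k f + f k)%nat end.

Definition vdot (n : nat) (x y : nat -> R) : R := vsum n (fun i => x i * y i).
Definition vnorm (n : nat) (x : nat -> R) : R := sqrt (vdot n x x).
Definition vadd (x y : nat -> R) : nat -> R := fun i => x i + y i.
Definition vsub (x y : nat -> R) : nat -> R := fun i => x i - y i.

Definition mono_eval (n : nat) (m : R * (nat -> nat)) (x : nat -> R) : R :=
  fst m * vprod n (fun i => x i ^ (snd m i)).
Definition mono_deg (n : nat) (m : R * (nat -> nat)) : nat := nsum n (snd m).

Definition poly_le (n d : nat) (f : (nat -> R) -> R) : Prop :=
  exists ms : list (R * (nat -> nat)),
    (forall m, In m ms -> (mono_deg n m <= d)%nat) /\
    forall x, f x = fold_right Rplus 0 (map (fun m => mono_eval n m x) ms).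

Definition is_poly (n : nat) (f : (nat -> R) -> R) : Prop := exists d, poly_le n d f.

Definition poly_deg (n : nat) (f : (nat -> R) -> R) (d : nat) : Prop :=
  poly_le n d f /\ forall d', poly_le n d' f -> (d <= d')%nat.

Definition is_gradient (n : nat) (f : (nat -> R) -> R)
  (g : (nat -> R) -> nat -> R) : Prop :=
  forall x i, (i < n)%nat ->
    derivable_pt_lim (fun t => f (fun j => if Nat.eqb j i then t else x j))
                     (x i) (g x i).

Definition polyhedral (n : nat) (Om : (nat -> R) -> Prop) : Prop :=
  exists (m : nat) (A : nat -> nat -> R) (b : nat -> R),
    forall x, Om x <-> (forall j, (j < m)%nat -> vdot n (A j) x <= b j).

Definition normal_cone (n : nat) (Om : (nat -> R) -> Prop) (xb v : nat -> R) : Prop :=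
  forall x, Om x -> vdot n v (vsub x xb) <= 0.

(* (nonempty) faces of a polyhedral set: intersections with supporting
   hyperplanes (w = 0, beta = 0 gives Omega itself) *)
Definition is_face (n : nat) (Om F : (nat -> R) -> Prop) : Prop :=
  (exists y, F y) /\
  exists (w : nat -> R) (beta : R),
    (forall y, Om y -> vdot n w y <= beta) /\
    (forall y, F y <-> (Om y /\ vdot n w y = beta)).

Definition is_vertex (n : nat) (F : (nat -> R) -> Prop) : Prop :=
  exists z, forall y, F y <-> (forall i, (i < n)%nat -> y i = z i).

Definition aff_hull (n : nat) (S : (nat -> R) -> Prop) (y : nat -> R) : Prop :=
  exists l : list ((nat -> R) * R),
    (forall p, In p l -> S (fst p)) /\
    fold_right Rplus 0 (map snd l) = 1 /\
    forall i, (i < n)%nat -> y i = fold_right Rplus 0 (map (fun p => snd p * fst p i) l).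

Definition aff_map (n k : nat) (x0 : nat -> R) (Z : nat -> nat -> R)
  (p : nat -> R) : nat -> R :=
  fun i => x0 i + vsum k (fun j => Z i j * p j).

Definition aff_coords (n : nat) (F : (nat -> R) -> Prop) (k : nat)
  (x0 : nat -> R) (Z : nat -> nat -> R) : Prop :=
  (forall p, aff_hull n F (aff_map n k x0 Z p)) /\
  (forall y, aff_hull n F y ->
     exists p, forall i, (i < n)%nat -> y i = aff_map n k x0 Z p i) /\
  (forall p q, (forall i, (i < n)%nat -> aff_map n k x0 Z p i = aff_map n k x0 Z q i) ->
     forall j, (j < k)%nat -> p j = q j).

Definition restr_deg_ge2 (n : nat) (L : (nat -> R) -> R) (F : (nat -> R) -> Prop) : Prop :=
  forall k x0 Z, aff_coords n F k x0 Z ->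
    ~ poly_le k 1 (fun p => L (aff_map n k x0 Z p)).

Definition rpow (a t : R) : R := if Rlt_dec 0 a then Rpower a t else 0.

Definition theta (d n : nat) : R :=
  1 - / (INR d * INR (3 * d - 3) ^ (n - 1)).

(* Main.v *)
(* Near [xs] the minimal face of [x] contains [xs], and normal vectors vanish on its
   direction, so it suffices to prove |grad f| >= c |f|^(1 - 1/N), N = d (3d-3)^(n-1), near 0
   for a polynomial [f] of degree at most [d] with [f 0 = 0].

   Put h = |grad f|^2.  On the box B = [-1,1]^n let [x(t)] minimize t^2 h + (f - t)^2, with
   value [V t].  Along the face of [x(t)] the gradients of [f] and [h] are parallel, which gives
   n equations: one of degree [d] (the value of [f]) and others of degree at most 3d-4.
   After the perturbation of these by eps x_i^(3d-3) the N monomials with small exponents span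
   everything, so each coordinate of [x(t)] is a root of a nonzero polynomial of degree at
   most [N] over the polynomials in f(x(t)).  (To keep it nonzero in the limit, a linear
   perturbation of the objective is added and removed at the end.)  Hence:
   - a coordinate of [x(t)] is within O(t^(1/N)) of finitely many values;
   - [V] is continuous and algebraic, so V t <= C V t0 for t0/2 <= t <= t0.

   If |grad f| is at most e t0^(1-1/N) at a point of level [t0], then |grad f| = O(e t0^(1-1/N))
   at [x(t)] for all [t] in [t0/2, t0].  These points lie on boundedly many algebraic arcs whose
   projections have length O(t0^(1/N)), so their values of [f] cover a set of size only O(e t0),
   a contradiction when [e] is small. *)
Require Import Defs.
From Stdlib Require Import Reals List.
From mathcomp Require all_boot all_order all_algebra.
From mathcomp Require boolp classical_sets reals Rstruct.
From mathcomp Require ring lra zify.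
Open Scope R_scope.

(* The module keeps the notations of MathComp out of the final statement. *)
Module LojasiewiczPolyhedral.

Import all_boot all_order all_algebra.
Import boolp classical_sets reals Rstruct ring lra zify.
Set Implicit Arguments.
Unset Strict Implicit.
Unset Printing Implicit Defensive.
Import Order.TTheory GRing.Theory Num.Theory.
Local Open Scope ring_scope.

(** * Iterated polynomial rings *)

(** The exponent leaves no room for loss of degree, so the elimination is done by hand. Its relation
    holds for [eps] nonzero, whereas the points of interest solve the system with [eps = 0]. The
    linear perturbation bridges this gap: its coefficients are variables of the relation, and the
    same point solves the perturbed system after a small change of the parameters, so the point
    stays fixed while [eps] tends to 0. Then the coefficients are sent to 0 one by one; here the
    minimizers move, and compactness of the box gives their limit. A relation is always divided by
    the variable about to vanish before this variable is set to 0, which keeps it nonzero.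

    Arcs and lengths are replaced by counting. A fine grid is laid around the finitely many limit
    values of the coordinates; roots meet each grid line boundedly often, so on a suitable interval
    of levels no root crosses a line. There every coordinate is labelled by a root at the left end,
    and among more minimizers than label vectors two share all labels: they are close although their
    values of [f] are apart, against the Taylor formula. *)

Fixpoint tower (R : idomainType) (k : nat) : idomainType :=
  if k is k'.+1 then {poly tower R k'} else R.

(** The outermost variable of [tower R k] is number [k - 1]: the parameter of largest index is the
    one that a lemma on univariate polynomials can treat. *)
Fixpoint tev (R : idomainType) (k : nat) (v : nat -> R) :
    {rmorphism tower R k -> R} :=
  match k return {rmorphism tower R k -> R} with
  | 0 => (@idfun R : {rmorphism R -> R})
  | k'.+1 => (horner_eval (v k') \o map_poly (tev k' v) : {rmorphism {poly tower R k'} -> R})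
  end.

Fixpoint tconst (R : idomainType) (k : nat) (r : R) : tower R k :=
  match k return tower R k with
  | 0 => r
  | k'.+1 => (tconst k' r)%:P
  end.

Fixpoint tvar (R : idomainType) (k i : nat) : tower R k :=
  match k return tower R k with
  | 0 => 0
  | k'.+1 => if i == k' then 'X else (tvar R k' i)%:P
  end.

Lemma tevS (R : idomainType) k (v : nat -> R) (p : {poly tower R k}) :
  tev k.+1 v p = (map_poly (tev k v) p).[v k].
Proof. by []. Qed.

Lemma tev_const (R : idomainType) k (v : nat -> R) r : tev k v (tconst k r) = r.
Proof.
elim: k => [|k IH] //.
by rewrite tevS (map_polyC (tev k v)) hornerC; exact: IH.
Qed.

Lemma tev_var (R : idomainType) k (v : nat -> R) i : (i < k)%N ->
  tev k v (tvar R k i) = v i.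
Proof.
elim: k => [|k IH] // ik.
rewrite tevS [tvar _ _ _]/=; have [->|nk] := eqVneq i k.
  by rewrite (map_polyX (tev k v)) hornerX.
by rewrite (map_polyC (tev k v)) hornerC; apply: IH; rewrite ltn_neqAle nk -ltnS.
Qed.

Lemma tev_neq0 (R : idomainType) k (v : nat -> R) (a : tower R k) :
  tev k v a != 0 -> a != 0.
Proof. by apply: contraNneq => ->; rewrite rmorph0. Qed.

Lemma eq_tev (R : idomainType) k (v w : nat -> R) :
  (forall i, (i < k)%N -> v i = w i) -> tev k v =1 tev k w.
Proof.
elim: k => [|k IH] vw p //.
rewrite !tevS vw //; congr (_.[_]).
by apply: eq_map_poly; apply: IH => i ik; apply: vw; apply: ltnW.
Qed.

(** * Elimination by rewriting monomials *)

Definition mono (R : pzSemiRingType) n (x : 'I_n -> R) (m : 'I_n -> nat) : R :=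
  \prod_i x i ^+ m i.

Definition mdeg n (m : 'I_n -> nat) : nat := (\sum_i m i)%N.

(** [D] bounds the degree in [x] alone; the degree in the [K] parameters is free, since only the
    number of irreducible monomials in [x] enters the exponent. *)
Definition pfun (R : idomainType) n K (D : nat)
    (g : (nat -> R) -> ('I_n -> R) -> R) : Prop :=
  exists2 ms : seq (tower R K * {ffun 'I_n -> nat}),
    all (fun m : tower R K * {ffun 'I_n -> nat} => (mdeg m.2 <= D)%N) ms &
    forall v x, g v x = \sum_(m <- ms) tev K v m.1 * mono x m.2.

Definition box n (D : 'I_n -> nat) := {dffun forall i : 'I_n, 'I_(D i)}.

(** The factor [u] is a denominator: reduction takes place over the fraction field of the
    parameters, yet coefficients stay polynomial so that parameters can be specialised. The identity
    is asked on the solution set [Pt] only. *)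
Definition reducible (R : idomainType) n K (D : 'I_n -> nat)
    (Pt : (nat -> R) -> ('I_n -> R) -> Prop)
    (g : (nat -> R) -> ('I_n -> R) -> R) : Prop :=
  exists u : tower R K, exists a : box D -> tower R K, u != 0 /\
    forall v x, Pt v x -> tev K v u * g v x =
       \sum_(al : box D) tev K v (a al) * mono x (fun i => al i).

Lemma monoD (R : comPzSemiRingType) n (x : 'I_n -> R) m1 m2 :
  mono x (fun i => m1 i + m2 i)%N = mono x m1 * mono x m2.
Proof. by rewrite -big_split; apply: eq_bigr => i _; rewrite exprD. Qed.

Lemma eq_mono (R : pzSemiRingType) n (x : 'I_n -> R) m1 m2 : m1 =1 m2 -> mono x m1 = mono x m2.
Proof. by move=> e; apply: eq_bigr => i _; rewrite e. Qed.

Lemma mdegD n (m1 m2 : 'I_n -> nat) :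
  mdeg (fun i => m1 i + m2 i)%N = (mdeg m1 + mdeg m2)%N.
Proof. by rewrite /mdeg big_split. Qed.

Lemma mdeg_single n (i : 'I_n) k : mdeg (fun j => if j == i then k else 0)%N = k.
Proof. by rewrite /mdeg -big_mkcond big_pred1_eq. Qed.

Lemma mono_single (R : comPzSemiRingType) n (x : 'I_n -> R) (i : 'I_n) k :
  mono x (fun j => if j == i then k else 0)%N = x i ^+ k.
Proof.
rewrite /mono (bigD1 i) //= eqxx big1 ?mulr1 // => j /negPf ->.
by rewrite expr0.
Qed.

Lemma mdeg_ge n (m : 'I_n -> nat) i : (m i <= mdeg m)%N.
Proof. by rewrite /mdeg (bigD1 i) //= leq_addr. Qed.

Lemma eq_mdeg n (m1 m2 : 'I_n -> nat) : m1 =1 m2 -> mdeg m1 = mdeg m2.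
Proof. by move=> e; apply: eq_bigr. Qed.

Lemma red0 (R : idomainType) n K (D : 'I_n -> nat) Pt :
  @reducible R n K D Pt (fun _ _ => 0).
Proof.
exists 1, (fun _ => 0); split=> [|v x _]; first exact: oner_neq0.
by rewrite mulr0 big1 // => al _; rewrite rmorph0 mul0r.
Qed.

Lemma redD (R : idomainType) n K (D : 'I_n -> nat) Pt g1 g2 :
  @reducible R n K D Pt g1 -> @reducible R n K D Pt g2 ->
  @reducible R n K D Pt (fun v x => g1 v x + g2 v x).
Proof.
move=> [u1 [a1 [n1 h1]]] [u2 [a2 [n2 h2]]].
exists (u1 * u2), (fun al => u2 * a1 al + u1 * a2 al); split=> [|v x pt].
  by rewrite mulf_neq0.
rewrite rmorphM mulrDr.
transitivity (tev K v u2 * (tev K v u1 * g1 v x) + tev K v u1 * (tev K v u2 * g2 v x)).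
  by rewrite !mulrA; congr (_ * _ + _); rewrite mulrC.
rewrite h1 // h2 // !mulr_sumr -big_split; apply: eq_bigr => al _ /=.
by rewrite rmorphD !rmorphM mulrDl !mulrA.
Qed.

Lemma redZ (R : idomainType) n K (D : 'I_n -> nat) Pt g (b : tower R K) :
  @reducible R n K D Pt g ->
  @reducible R n K D Pt (fun v x => tev K v b * g v x).
Proof.
move=> [u [a [nu h]]].
exists u, (fun al => b * a al); split=> // v x pt.
rewrite mulrCA h // mulr_sumr; apply: eq_bigr => al _.
by rewrite rmorphM mulrA.
Qed.

Lemma eq_red (R : idomainType) n K (D : 'I_n -> nat) Pt g1 g2 :
  (forall v x, Pt v x -> g1 v x = g2 v x) ->
  @reducible R n K D Pt g1 -> @reducible R n K D Pt g2.
Proof.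
by move=> e [u [a [nu h]]]; exists u, a; split=> // v x pt; rewrite -e // h.
Qed.

Lemma red_sum (R : idomainType) n K (D : 'I_n -> nat) Pt (I : eqType) (s : seq I)
    (b : I -> tower R K) (g : I -> _) :
  (forall m, m \in s -> @reducible R n K D Pt (g m)) ->
  @reducible R n K D Pt (fun v x => \sum_(m <- s) tev K v (b m) * g m v x).
Proof.
elim: s => [|m s IH] h.
  by apply: (@eq_red _ _ _ _ _ (fun _ _ => 0)); [move=> v x _; rewrite big_nil|exact: red0].
apply: (@eq_red _ _ _ _ _
  (fun v x => tev K v (b m) * g m v x + \sum_(m <- s) tev K v (b m) * g m v x)).
  by move=> v x _; rewrite big_cons.
apply: redD; first by apply: redZ; apply: h; rewrite mem_head.
by apply: IH => m' ms; apply: h; rewrite inE ms orbT.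
Qed.

Lemma red_div (R : idomainType) n K (D : 'I_n -> nat) Pt g (b : tower R K) :
  b != 0 ->
  @reducible R n K D Pt (fun v x => tev K v b * g v x) ->
  @reducible R n K D Pt g.
Proof.
move=> nb [u [a [nu h]]]; exists (u * b), a; split=> [|v x pt].
  by rewrite mulf_neq0.
by rewrite rmorphM -mulrA h.
Qed.

(* Each rule rewrites a multiple of [x_i ^ D_i] into monomials that are smaller
   for the order comparing first total degrees and then the exponents of [x_i0]. *)
Definition rewrite_rules (R : idomainType) n K (D : 'I_n -> nat) (i0 : 'I_n)
    (Pt : (nat -> R) -> ('I_n -> R) -> Prop) : Prop :=
  forall i, exists u : tower R K, exists ms : seq (tower R K * {ffun 'I_n -> nat}),
    [/\ u != 0,
        all (fun m : tower R K * {ffun 'I_n -> nat} => (mdeg m.2 < D i)%N ||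
              [&& i == i0, (mdeg m.2 <= D i)%N & (m.2 i0 < D i)%N]) ms &
        forall v x, Pt v x ->
          tev K v u * x i ^+ D i = \sum_(m <- ms) tev K v m.1 * mono x m.2].

(** Outer induction on the total degree, inner induction on the exponent of [i0]: the rule for [i0]
    may keep the total degree but then lowers that exponent, the other rules lower the total degree,
    and multiplying by the remaining monomial preserves both comparisons. *)
Lemma red_mono (R : idomainType) n K (D : 'I_n -> nat) i0 Pt :
  (forall i, 0 < D i)%N ->
  @rewrite_rules R n K D i0 Pt ->
  forall be : {ffun 'I_n -> nat}, reducible K D Pt (fun _ x => mono x be).
Proof.
move=> D0 rules.
have step s : (forall be : {ffun 'I_n -> nat}, (mdeg be < s)%N -> reducible K D Pt (fun _ x => mono x be)) ->
   forall b (be : {ffun 'I_n -> nat}), (mdeg be <= s)%N -> (be i0 < b)%N ->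
     reducible K D Pt (fun _ x => mono x be).
  move=> Hs; elim=> [//|b IHb] be bes beb.
  have [/forallP small|] := boolP [forall i, be i < D i]%N.
    pose al0 : box D := [ffun i => Ordinal (small i)].
    exists 1, (fun al => (al == al0)%:R); split=> [|v x _]; first exact: oner_neq0.
    rewrite rmorph1 mul1r (bigD1 al0) //= eqxx rmorph1 mul1r big1 ?addr0.
      by apply: eq_mono => i; rewrite ffunE.
    by move=> al /negPf ->; rewrite rmorph0 mul0r.
  rewrite negb_forall => /existsP[i]; rewrite -leqNgt => Dbe.
  have [u [ms [nu msle hms]]] := rules i.
  pose be' : 'I_n -> nat := fun j => (if j == i then be i - D i else be j)%N.
  have beE : be =1 (fun j => be' j + (if j == i then D i else 0))%N.
    by move=> j; rewrite /be'; case: eqP => [->|]; rewrite ?addn0 ?subnK.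
  apply: (@red_div _ _ _ _ _ _ u) => //.
  pose q (m : tower R K * {ffun 'I_n -> nat}) := [ffun j => m.2 j + be' j]%N.
  apply: (@eq_red _ _ _ _ _ (fun v x => \sum_(m <- ms) tev K v m.1 * mono x (q m))).
    move=> v x pt.
    rewrite (eq_mono x beE) monoD mono_single mulrCA hms // mulr_sumr.
    apply: eq_bigr => m _; rewrite mulrCA; congr (_ * _).
    by rewrite mulrC -monoD; apply: eq_mono => j; rewrite ffunE.
  apply: (@red_sum _ _ _ _ _ _ ms (fun m => m.1) (fun m _ x => mono x (q m))) => m mms.
  have qE : mdeg (q m) = (mdeg m.2 + mdeg be')%N.
    by rewrite -mdegD; apply: eq_mdeg => j; rewrite ffunE.
  have bE : mdeg be = (mdeg be' + D i)%N.
    by rewrite (eq_mdeg beE) mdegD mdeg_single.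
  have /orP[lt|/and3P[/eqP ei le lt]] := allP msle m mms.
    apply: Hs; rewrite qE; apply: leq_trans bes.
    by rewrite bE addnC ltn_add2l.
  apply: IHb.
    rewrite qE; apply: leq_trans bes.
    by rewrite bE addnC leq_add2l.
  rewrite ltnS in beb; rewrite ffunE; apply: leq_trans beb; rewrite (beE i0) ei eqxx.
  by rewrite addnC ltn_add2l; move: lt; rewrite ei.
move=> be; have [s] := ubnP (mdeg be); elim: s be => [//|s IH] be le.
by apply: (step s _ (be i0).+1).
Qed.

Lemma red_pfun (R : idomainType) n K (D : 'I_n -> nat) i0 Pt Dg g :
  (forall i, 0 < D i)%N -> @rewrite_rules R n K D i0 Pt ->
  @pfun R n K Dg g -> reducible K D Pt g.
Proof.
move=> D0 rules [ms _ gE].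
apply: (@eq_red _ _ _ _ _ (fun v x => \sum_(m <- ms) tev K v m.1 * mono x m.2)).
  by move=> v x _; rewrite gE.
apply: (@red_sum _ _ _ _ _ _ ms (fun m => m.1) (fun m _ x => mono x m.2)) => m _.
exact: red_mono rules _.
Qed.

Lemma pfun_mulmono (R : idomainType) n K D g (m0 : {ffun 'I_n -> nat}) :
  @pfun R n K D g -> @pfun R n K (D + mdeg m0) (fun v x => g v x * mono x m0).
Proof.
move=> [ms msD gE].
exists [seq (m.1, [ffun i => m.2 i + m0 i]%N) | m : tower R K * {ffun 'I_n -> nat} <- ms].
  apply/allP => _ /mapP[m mms ->] /=.
  have -> : mdeg [ffun i => m.2 i + m0 i]%N = (mdeg m.2 + mdeg m0)%N.
    by rewrite -mdegD; apply: eq_mdeg => i; rewrite ffunE.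
  by rewrite leq_add2r (allP msD).
move=> v x; rewrite gE mulr_suml big_map; apply: eq_bigr => m _ /=.
by rewrite -mulrA -monoD; congr (_ * _); apply: eq_mono => i; rewrite ffunE.
Qed.

Lemma eq_pfun (R : idomainType) n K D g1 g2 :
  (forall v x, g1 v x = g2 v x) -> @pfun R n K D g1 -> @pfun R n K D g2.
Proof. by move=> e [ms msD gE]; exists ms => // v x; rewrite -e gE. Qed.

(* The polynomial is the characteristic polynomial of the multiplication by [g]
   on the span of the [\prod_i D i] monomials that no rule rewrites. *)
Lemma perron (R : fieldType) n K (D : 'I_n -> nat) i0 Pt Dg g :
  (forall i, 0 < D i)%N -> @rewrite_rules R n K D i0 Pt -> @pfun R n K Dg g ->
  exists P : {poly tower R K}, [/\ P != 0, (size P <= (\prod_i D i).+1)%N &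
    forall v x, Pt v x -> (map_poly (tev K v) P).[g v x] = 0].
Proof.
move=> D0 rules gP.
have redal (al : box D) : reducible K D Pt (fun v x => g v x * mono x (fun i => al i)).
  pose m0 : {ffun 'I_n -> nat} := [ffun i => al i : nat].
  apply: (@eq_red _ _ _ _ _ (fun v x => g v x * mono x m0)).
    by move=> v x _; congr (_ * _); apply: eq_mono => i; rewrite ffunE.
  exact: (red_pfun D0 rules (pfun_mulmono m0 gP)).
have [u hu] := fin_all_exists redal.
have [a ha] := fin_all_exists hu.
pose U := \prod_al u al.
have U0 : U != 0 by apply/prodf_neq0 => al _; case: (ha al).
(* Each relation is multiplied by the denominators of the others, so that [U * g] acts on the box
   monomials through a matrix with polynomial entries. *)
pose M al be := (\prod_(al' | al' != al) u al') * a al be.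
pose A : 'M[tower R K]_#|box D| := \matrix_(i, j) M (enum_val j) (enum_val i).
have s2 : size (U *: 'X : {poly tower R K}) = 2 by rewrite size_scale // size_polyX.
exists (char_poly A \Po (U *: 'X)); split.
- by rewrite comp_poly_eq0 ?s2 // -size_poly_eq0 size_char_poly.
- apply: leq_trans (leqSpred _) _; rewrite size_comp_poly s2 muln1 size_char_poly /= ltnS.
  by rewrite card_dep_ffun foldrE big_map big_enum /=; apply: leq_prod => i _; rewrite card_ord.
move=> v x pt; rewrite map_comp_poly horner_comp map_polyZ map_polyX hornerZ hornerX.
rewrite map_char_poly; apply/rootP; rewrite -eigenvalue_root_char; apply/eigenvalueP.
exists (\row_j mono x (fun i => (enum_val j : box D) i)).
  apply/rowP => j; rewrite !mxE.
  have [_ /(_ v x pt) e] := ha (enum_val j).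
  transitivity (tev K v (\prod_(al' | al' != enum_val j) u al') *
     (tev K v (u (enum_val j)) * (g v x * mono x (fun i => (enum_val j : box D) i)))).
    rewrite e mulr_sumr (reindex_omap (enum_val : 'I_#|box D| -> box D) (fun al => Some (enum_rank al))) /=; last first.
      by move=> al _; rewrite enum_rankK.
    apply: eq_big => [i|i _]; first by rewrite enum_valK eqxx.
    by rewrite !mxE rmorphM mulrA mulrC.
  rewrite [U](bigD1 (enum_val j)) // (rmorphM (tev K v)) !mulrA; congr (_ * _ * _); exact: mulrC.
(* The eigenvector is nonzero because its entry at the constant monomial is 1. *)
apply/eqP => /rowP /(_ (enum_rank ([ffun i => Ordinal (D0 i)] : box D))).
rewrite !mxE enum_rankK => /eqP; apply/negP; rewrite (eq_mono x (m2 := fun=> 0%N)) => [|i].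
  by rewrite /mono big1 ?oner_neq0.
by rewrite ffunE.
Qed.

(** The inner variable is divided out of all coefficients as long as possible; every division lowers
    the size of the leading coefficient, so this stops. *)
Lemma scaleX_factor (B : idomainType) (P : {poly {poly B}}) : P != 0 ->
  exists k, exists P' : {poly {poly B}},
    [/\ P = 'X^k *: P', map_poly (horner_eval 0) P' != 0 & size P' = size P].
Proof.
have [s] := ubnP (size (lead_coef P)); elim: s P => [//|s IH] P sP P0.
have [e|ne] := eqVneq (map_poly (horner_eval 0) P) 0; last first.
  by exists 0%N, P; split=> //; rewrite expr0 scale1r.
pose P1 : {poly {poly B}} := \poly_(i < size P) drop_poly 1 P`_i.
have PE : P = 'X *: P1.
  apply/polyP => i; rewrite coefZ coef_poly.
  case: ltnP => [_|le]; last by rewrite mulr0 nth_default.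
  rewrite -{1}(poly_take_drop 1 P`_i) expr1 [_ * 'X]mulrC.
  have /polyP /(_ i) := e; rewrite coef_map coef0 /= /horner_eval => h.
  suff -> : take_poly 1 P`_i = 0 by rewrite add0r.
  apply/polyP => -[|j]; rewrite coef_take_poly coef0 //.
  by rewrite -horner_coef0.
have P10 : P1 != 0 by apply: contraNneq P0 => e1; rewrite PE e1 scaler0.
have X0 : ('X : {poly B}) != 0 by rewrite polyX_eq0.
have sP1 : size P1 = size P by rewrite [in RHS]PE size_scale.
have [|k [P' [E1 E2 E3]]] := IH P1 _ P10.
  rewrite -ltnS; apply: leq_trans sP; rewrite ltnS [in X in (_ < X)%N]PE lead_coefZ mulrC size_mulX //.
  by rewrite lead_coef_eq0.
exists k.+1, P'; split=> //; last by rewrite E3.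
by rewrite PE E1 scalerA exprS.
Qed.

(* Dividing out the inner variable before setting it to [0] keeps the polynomial nonzero. *)
Lemma elim_var (R : fieldType) k (P : {poly tower R k.+1}) : P != 0 ->
  exists Q : {poly tower R k.+1},
    [/\ map_poly (horner_eval 0) (Q : {poly {poly tower R k}}) != 0,
        (size (map_poly (horner_eval 0%R) (Q : {poly {poly tower R k}})) <= size P)%N,
        forall v y, v k != 0 -> (map_poly (tev k.+1 v) P).[y] = 0 -> (map_poly (tev k.+1 v) Q).[y] = 0 &
        forall v y, v k = 0 -> (map_poly (tev k.+1 v) Q).[y] =
          (map_poly (tev k v) (map_poly (horner_eval 0) (Q : {poly {poly tower R k}}))).[y]].
Proof.
move=> P0; have [m [Q [E1 E2 E3]]] := scaleX_factor P0.
exists Q; split=> //.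
- by rewrite -E3; exact: size_poly.
- move=> v y vk; rewrite E1 map_polyZ hornerZ => /eqP; rewrite mulf_eq0 => /orP[|/eqP //].
  by rewrite rmorphXn /= map_polyX /horner_eval hornerX expf_eq0 (negPf vk) andbF.
move=> v y vk; rewrite -map_poly_comp; congr (_.[_]); apply: eq_map_poly => p.
rewrite tevS vk /= /horner_eval; rewrite !horner_coef0 coef_map //.
Qed.

(** * Polynomial functions and their Taylor expansions *)

Lemma pfunW (R : idomainType) n K D D' g :
  (D <= D')%N -> @pfun R n K D g -> @pfun R n K D' g.
Proof.
move=> DD [ms msD gE]; exists ms => //; apply: sub_all msD => m /=.
by move=> /leq_trans; apply.
Qed.

Lemma pfun_const (R : idomainType) n K (a : tower R K) :
  @pfun R n K 0 (fun v _ => tev K v a).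
Proof.
exists [:: (a, [ffun=> 0%N])].
  by rewrite /= andbT /mdeg big1 // => i _; rewrite ffunE.
by move=> v x; rewrite big_seq1 /mono big1 ?mulr1 // => i _; rewrite ffunE.
Qed.

Lemma pfun_coord (R : idomainType) n K (i : 'I_n) : @pfun R n K 1 (fun _ x => x i).
Proof.
pose e : {ffun 'I_n -> nat} := [ffun j => if j == i then 1%N else 0%N].
have eE : e =1 (fun j => if j == i then 1 else 0)%N by move=> j; rewrite ffunE.
exists [:: (1, e)]; first by rewrite /= andbT (eq_mdeg eE) mdeg_single.
by move=> v x; rewrite big_seq1 rmorph1 mul1r (eq_mono _ eE) mono_single.
Qed.

Lemma pfunD (R : idomainType) n K D g1 g2 : @pfun R n K D g1 -> @pfun R n K D g2 ->
  @pfun R n K D (fun v x => g1 v x + g2 v x).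
Proof.
move=> [m1 d1 e1] [m2 d2 e2]; exists (m1 ++ m2); first by rewrite all_cat d1.
by move=> v x; rewrite big_cat e1 e2.
Qed.

Lemma pfunM (R : idomainType) n K D1 D2 g1 g2 :
  @pfun R n K D1 g1 -> @pfun R n K D2 g2 ->
  @pfun R n K (D1 + D2) (fun v x => g1 v x * g2 v x).
Proof.
move=> [ms1 d1 e1] [ms2 d2 e2].
pose mm (p q : tower R K * {ffun 'I_n -> nat}) := (p.1 * q.1, [ffun i => p.2 i + q.2 i]%N : {ffun 'I_n -> nat}).
exists [seq mm p q | p <- ms1, q <- ms2].
  apply/allP => _ /allpairsP[[p q] [/= pm qm ->]] /=.
  rewrite (eq_mdeg (m2 := fun i => p.2 i + q.2 i)%N) => [|i]; last by rewrite ffunE.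
  by rewrite mdegD leq_add // ?(allP d1) ?(allP d2).
move=> v x; rewrite e1 e2 big_allpairs_dep mulr_suml; apply: eq_bigr => p _.
rewrite mulr_sumr; apply: eq_bigr => q _.
have -> : mono x (mm p q).2 = mono x p.2 * mono x q.2.
  by rewrite -monoD; apply: eq_mono => i; rewrite ffunE.
by rewrite (rmorphM (tev K v)) mulrACA.
Qed.

Lemma pfunZ (R : idomainType) n K D g (a : tower R K) : @pfun R n K D g ->
  @pfun R n K D (fun v x => tev K v a * g v x).
Proof. by move=> gP; have := pfunM (pfun_const _ a) gP; rewrite add0n. Qed.

Lemma pfunN (R : idomainType) n K D g : @pfun R n K D g ->
  @pfun R n K D (fun v x => - g v x).
Proof.
move=> /(pfunZ (-1)); apply: eq_pfun => v x.
by rewrite rmorphN rmorph1 mulN1r.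
Qed.

Lemma pfunB (R : idomainType) n K D g1 g2 : @pfun R n K D g1 -> @pfun R n K D g2 ->
  @pfun R n K D (fun v x => g1 v x - g2 v x).
Proof. by move=> h1 /pfunN; apply: pfunD. Qed.

Lemma pfun_sum (R : idomainType) n K D (I : Type) (s : seq I) g :
  (forall i, @pfun R n K D (g i)) -> @pfun R n K D (fun v x => \sum_(i <- s) g i v x).
Proof.
move=> h; elim: s => [|i s IH].
  apply: (eq_pfun (g1 := fun v _ => tev K v 0)).
    by move=> v x; rewrite big_nil rmorph0.
  by apply: pfunW (pfun_const _ _).
by apply: eq_pfun (pfunD (h i) IH) => v x; rewrite big_cons.
Qed.

Definition pol (R : idomainType) n (D : nat) (f : ('I_n -> R) -> R) : Prop :=
  @pfun R n 0 D (fun _ x => f x).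

Lemma pol_pfun (R : idomainType) n K D f : @pol R n D f -> @pfun R n K D (fun _ x => f x).
Proof.
move=> [ms msD fE].
exists [seq (tconst K m.1, m.2) | m : tower R 0 * {ffun 'I_n -> nat} <- ms].
  by apply/allP => _ /mapP[m mms ->] /=; apply: (allP msD).
move=> v x; rewrite (fE v) big_map; apply: eq_bigr => m _ /=.
by rewrite tev_const.
Qed.

Lemma eq_pol (R : idomainType) n D f1 f2 : f1 =1 f2 -> @pol R n D f1 -> @pol R n D f2.
Proof. by move=> e; apply: eq_pfun => v x. Qed.

Lemma pol_const (R : idomainType) n (a : R) : @pol R n 0 (fun _ => a).
Proof. exact: (@pfun_const R n 0 a). Qed.

Lemma polZ (R : idomainType) n D (a : R) f : @pol R n D f -> @pol R n D (fun x => a * f x).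
Proof. exact: (@pfunZ R n 0 D _ a). Qed.

(** * Bounds and Taylor expansions on the unit box *)

Definition inB (R : numDomainType) n (x : 'I_n -> R) : Prop := forall i, `|x i| <= 1.

Definition near_by (R : numDomainType) n (e : R) (x y : 'I_n -> R) : Prop :=
  forall i, `|y i - x i| <= e.

Lemma pol_bounded (R : realFieldType) n D f : @pol R n D f ->
  exists2 M, 0 <= M & forall x, inB x -> `|f x| <= M.
Proof.
move=> [ms _ fE]; exists (\sum_(m <- ms) `|m.1|); first exact: sumr_ge0.
move=> x xB; rewrite (fE (fun=> 0)); apply: le_trans (ler_norm_sum _ _ _) _.
apply: ler_sum => m _; rewrite normrM ler_piMr //.
rewrite normr_prod; apply: prodr_ile1 => i _.
by rewrite normrX exprn_ge0 //= exprn_ile1 ?normr_ge0.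
Qed.

(** This stands for differentiability: a quadratic remainder, uniform on the box, is what the final
    estimate consumes. The bound 2 on [e] is the sup-norm diameter of the box. *)
Definition taylor (R : realFieldType) n (f : ('I_n -> R) -> R) (g : 'I_n -> ('I_n -> R) -> R) :=
  exists2 M, 0 <= M & forall x y e, inB x -> inB y -> 0 <= e <= 2 -> near_by e x y ->
    `|f y - f x - \sum_i g i x * (y i - x i)| <= M * e ^+ 2.

(** Degree [D - 1], with [D = 0] apart: truncated subtraction would forget that constants have zero
    gradient, and the product rule would then lose a degree. *)
Definition grad_deg (R : idomainType) n D (g : 'I_n -> ('I_n -> R) -> R) :=
  forall i, if D is D'.+1 then pol D' (g i) else forall x, g i x = 0.

Lemma grad_degW (R : idomainType) n D D' g : (D <= D')%N ->
  @grad_deg R n D g -> @grad_deg R n D' g.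
Proof.
case: D D' => [|D] [|D'] // DD gD i; last by apply: pfunW (gD i).
apply: (eq_pol (f1 := fun _ => 0)); first by move=> x; rewrite gD.
by apply: pfunW (pol_const _ _).
Qed.

Lemma sum_near (R : realFieldType) n (M e : R) (x y g : 'I_n -> R) :
  (forall i, `|g i| <= M) -> near_by e x y ->
  `|\sum_i g i * (y i - x i)| <= n%:R * M * e.
Proof.
move=> gM xy; apply: le_trans (ler_norm_sum _ _ _) _.
apply: (@le_trans _ _ (\sum_(i < n) M * e)).
  by apply: ler_sum => i _; rewrite normrM ler_pM.
by rewrite sumr_const card_ord -[_ *+ n]mulr_natl mulrA.
Qed.

Lemma taylor_mul_coord (R : realFieldType) n D (f : ('I_n -> R) -> R) g i0 :
  pol D f -> grad_deg D g -> taylor f g ->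
  taylor (fun x => x i0 * f x) (fun i x => x i0 * g i x + (i == i0)%:R * f x).
Proof.
move=> fp gD [M M0 hM].
have [M1 M10 hM1] := pol_bounded fp.
have gb : forall i, exists m, forall x, inB x -> `|g i x| <= m.
  move=> i; have : exists D', pol D' (g i).
    have := gD i; case: (D) => [gi|D' gi]; last by exists D'.
    by exists 0%N; apply: (eq_pol (f1 := fun _ => 0)); [move=> x; rewrite gi|exact: pol_const].
  by move=> [D' /pol_bounded [m _ hm]]; exists m.
have [m hm] := fin_all_exists gb.
pose M2 := \sum_i `|m i|.
have M20 : 0 <= M2 by exact: sumr_ge0.
have hM2 i x : inB x -> `|g i x| <= M2.
  move=> xB; apply: le_trans (hm i x xB) _; apply: le_trans (ler_norm _) _.
  by rewrite /M2 (bigD1 i) //= lerDl sumr_ge0.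
exists (M + n%:R * M2 + M).
  by rewrite !addr_ge0 // mulr_ge0.
move=> x y e xB yB e2 xy.
have e0 : 0 <= e by case/andP: e2.
set S := \sum_i g i x * (y i - x i).
have hS : `|S| <= n%:R * M2 * e by apply: sum_near => // i; apply: hM2.
have -> : y i0 * f y - x i0 * f x - \sum_i (x i0 * g i x + (i == i0)%:R * f x) * (y i - x i)
   = x i0 * (f y - f x - S) + (y i0 - x i0) * (f y - f x - S) + (y i0 - x i0) * S.
  have -> : \sum_i (x i0 * g i x + (i == i0)%:R * f x) * (y i - x i)
     = x i0 * S + (y i0 - x i0) * f x.
    rewrite /S mulr_sumr.
    rewrite (eq_bigr (fun i => x i0 * (g i x * (y i - x i)) + (if i == i0 then f x * (y i - x i) else 0))); last first.
      by move=> i _; case: eqP => _; rewrite ?mul1r ?mul0r; ring.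
    by rewrite big_split /= -big_mkcond big_pred1_eq; ring.
  by ring.
have hT := hM x y e xB yB e2 xy; rewrite -/S in hT.
set T := f y - f x - S in hT *.
have h1 : `|x i0 * T + (y i0 - x i0) * T| <= M * e ^+ 2.
  have -> : x i0 * T + (y i0 - x i0) * T = y i0 * T by ring.
  by rewrite normrM; apply: le_trans hT; rewrite ler_piMl.
have h2 : `|(y i0 - x i0) * S| <= n%:R * M2 * e ^+ 2.
  rewrite normrM; apply: (@le_trans _ _ (e * (n%:R * M2 * e))).
    by apply: ler_pM.
  by rewrite le_eqVlt; apply/orP; left; apply/eqP; ring.
apply: le_trans (ler_normD _ _) _; apply: le_trans (lerD h1 h2) _.
by rewrite !mulrDl -subr_ge0; have : 0 <= M * e ^+ 2 by [rewrite mulr_ge0 // exprn_ge0]; lra.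
Qed.

Lemma mono_grad (R : realFieldType) n (m : {ffun 'I_n -> nat}) :
  exists2 g : 'I_n -> ('I_n -> R) -> R, grad_deg (mdeg m) g & taylor (fun x => mono x m) g.
Proof.
move e : (mdeg m) => D; elim: D m e => [|D IH] m e.
  exists (fun _ _ => 0) => //; exists 0 => // x y d _ _ _ _.
  have m0 i : m i = 0%N by apply/eqP; rewrite -leqn0 -e mdeg_ge.
  by rewrite /mono !big1 => [|i _|i _|i _]; rewrite ?m0 ?expr0 ?mul0r ?subrr ?subr0 ?normr0.
have [i mi] : exists i, (0 < m i)%N.
  apply/existsP; apply: contraPT e; rewrite negb_exists => /forallP h.
  by rewrite /mdeg big1 // => i _; apply/eqP; rewrite -leqn0 leqNgt.
pose m' : {ffun 'I_n -> nat} := [ffun j => m j - (if j == i then 1 else 0)]%N.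
have mE : m =1 (fun j => (if j == i then 1 else 0) + m' j)%N.
  by move=> j; rewrite ffunE; case: eqP => [->|]; rewrite ?subnKC // subn0.
have [|g gD gT] := IH m'.
  by apply/eqP; rewrite -eqSS -e (eq_mdeg mE) mdegD mdeg_single.
have mp : pol D (fun x : 'I_n -> R => mono x m').
  exists [:: (1, m')]; last by move=> v x; rewrite big_seq1 mul1r.
  by rewrite /= andbT -ltnS -e (eq_mdeg mE) mdegD mdeg_single.
have [M M0 hM] := taylor_mul_coord i mp gD gT.
exists (fun j x => x i * g j x + (j == i)%:R * mono x m').
  move=> j /=; apply: pfunD; last exact: polZ.
  have := gD j; case: (D) => [gj|D' gj].
    apply: (eq_pfun (g1 := fun _ _ => 0)); first by move=> v x; rewrite gj mulr0.
    exact: pol_const.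
  exact: (pfunM (pfun_coord R 0 i) gj).
exists M => // x y d xB yB d2 xy.
have := hM x y d xB yB d2 xy.
by rewrite !(eq_mono _ mE) !monoD !mono_single !expr1.
Qed.

Lemma pol_grad (R : realFieldType) n D (f : ('I_n -> R) -> R) : pol D f ->
  exists2 g : 'I_n -> ('I_n -> R) -> R, grad_deg D g & taylor f g.
Proof.
move=> [ms msD /(_ (fun=> 0)) fE].
suff [g gD [M M0 hM]] : exists2 g : 'I_n -> ('I_n -> R) -> R, grad_deg D g &
    taylor (fun x => \sum_(m <- ms) m.1 * mono x m.2) g.
  by exists g => //; exists M => // x y e xB yB e2 xy; rewrite !fE; apply: hM.
elim: ms msD {fE} => [_|m ms IH /= /andP[mD msD]].
  exists (fun _ _ => 0); first by case: (D) => // D' i; apply: pfunW (pol_const _ _).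
  by exists 0 => // x y e _ _ _ _; rewrite !big_nil subrr sub0r normrN big1 ?normr0 ?mul0r // => i _; rewrite mul0r.
have [g gD [M M0 hM]] := IH msD.
have [g1 g1D [M1 M10 hM1]] := mono_grad R m.2.
exists (fun i x => m.1 * g1 i x + g i x).
  move=> i; have := grad_degW mD g1D i; have := gD i; case: (D) => [h h1 x|D' h h1].
    by rewrite h h1 mulr0 addr0.
  by apply: pfunD h; apply: polZ.
exists (`|m.1| * M1 + M); first by rewrite addr_ge0 // mulr_ge0.
move=> x y e xB yB e2 xy; rewrite !big_cons.
have h := hM _ _ _ xB yB e2 xy; have h1 := hM1 _ _ _ xB yB e2 xy.
rewrite (eq_bigr (fun i => m.1 * (g1 i x * (y i - x i)) + g i x * (y i - x i))); last first.
  by move=> i _; ring.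
rewrite big_split -mulr_sumr /=.
set S := \sum_i g i x * _ in h *; set S1 := \sum_i g1 i x * _ in h1 *.
set a := \sum_(m <- ms) _ in h *; set b := \sum_(m <- ms) _ in h *.
have -> : m.1 * mono y m.2 + a - (m.1 * mono x m.2 + b) - (m.1 * S1 + S)
   = m.1 * (mono y m.2 - mono x m.2 - S1) + (a - b - S) by ring.
apply: le_trans (ler_normD _ _) _; rewrite mulrDl lerD // normrM -mulrA.
by rewrite ler_wpM2l.
Qed.

(** * Compactness of the box *)

Definition tends (R : numDomainType) (u : nat -> R) (l : R) : Prop :=
  forall e, 0 < e -> exists M, forall m, (M <= m)%N -> `|u m - l| < e.

Lemma eq_tends (R : numDomainType) (u w : nat -> R) l :
  u =1 w -> tends u l -> tends w l.
Proof. by move=> e ul d /ul [M h]; exists M => m /h; rewrite e. Qed.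

Lemma tends_cst (R : numDomainType) (a : R) : tends (fun _ => a) a.
Proof. by move=> e e0; exists 0%N => m _; rewrite subrr normr0. Qed.

Lemma tends_D (R : realFieldType) (u w : nat -> R) a b :
  tends u a -> tends w b -> tends (fun m => u m + w m) (a + b).
Proof.
move=> ua wb e e0; have e20 : 0 < e / 2 by rewrite divr_gt0.
have [M hM] := ua _ e20; have [M' hM'] := wb _ e20.
exists (maxn M M') => m; rewrite geq_max => /andP[/hM h /hM' h'].
rewrite opprD addrACA; apply: le_lt_trans (ler_normD _ _) _.
by rewrite (splitr e) ltrD.
Qed.

Lemma tends_M (R : realFieldType) (u w : nat -> R) a b :
  tends u a -> tends w b -> tends (fun m => u m * w m) (a * b).
Proof.
move=> ua wb e e0.
pose c := `|a| + `|b| + 1.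
have c0 : 0 < c by rewrite ltr_wpDl // addr_ge0.
pose d := Num.min 1 (e / (2 * c)).
have d0 : 0 < d by rewrite lt_min ltr01 divr_gt0 // mulr_gt0.
have [M hM] := ua _ d0; have [M' hM'] := wb _ d0.
exists (maxn M M') => m; rewrite geq_max => /andP[/hM h /hM' h'].
have -> : u m * w m - a * b = (u m - a) * (w m - b) + (a * (w m - b) + (u m - a) * b) by ring.
apply: (@le_lt_trans _ _ (d * c)).
  apply: le_trans (ler_normD _ _) _.
  have -> : d * c = d * 1 + (`|a| * d + d * `|b|) by rewrite /c; ring.
  apply: lerD; first by rewrite normrM ler_pM ?(ltW h) // (le_trans (ltW h')) // ge_min lexx.
  apply: le_trans (ler_normD _ _) _; rewrite !normrM.
  by apply: lerD; [apply: ler_wpM2l => //; exact: ltW|apply: ler_wpM2r => //; exact: ltW].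
apply: (@le_lt_trans _ _ (e / (2 * c) * c)).
  by rewrite ler_pM2r // ge_min lexx orbT.
have -> : e / (2 * c) * c = e / 2 by field; rewrite gt_eqF.
by lra.
Qed.

Lemma tends_X (R : realFieldType) (u : nat -> R) a k :
  tends u a -> tends (fun m => u m ^+ k) (a ^+ k).
Proof.
move=> ua; elim: k => [|k IH]; first exact: tends_cst.
by rewrite exprS; apply: eq_tends (tends_M ua IH) => m; rewrite exprS.
Qed.

Lemma tends_sum (R : realFieldType) (I : Type) (s : seq I) (u : I -> nat -> R) a :
  (forall i, tends (u i) (a i)) ->
  tends (fun m => \sum_(i <- s) u i m) (\sum_(i <- s) a i).
Proof.
move=> h; elim: s => [|i s IH].
  by rewrite big_nil; apply: eq_tends (@tends_cst R 0) => m; rewrite big_nil.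
rewrite big_cons; apply: eq_tends (tends_D (h i) IH) => m; by rewrite big_cons.
Qed.

Lemma tends_prod (R : realFieldType) (I : Type) (s : seq I) (u : I -> nat -> R) a :
  (forall i, tends (u i) (a i)) ->
  tends (fun m => \prod_(i <- s) u i m) (\prod_(i <- s) a i).
Proof.
move=> h; elim: s => [|i s IH].
  by rewrite big_nil; apply: eq_tends (@tends_cst R 1) => m; rewrite big_nil.
rewrite big_cons; apply: eq_tends (tends_M (h i) IH) => m; by rewrite big_cons.
Qed.

Lemma tends_le (R : realFieldType) (u w : nat -> R) a b :
  tends u a -> tends w b -> (forall m, u m <= w m) -> a <= b.
Proof.
move=> ua wb uw; rewrite leNgt; apply/negP => ba.
have d0 : 0 < (a - b) / 2 by rewrite divr_gt0 // subr_gt0.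
have [M hM] := ua _ d0; have [M' hM'] := wb _ d0.
have := hM _ (leq_maxl M M'); have := hM' _ (leq_maxr M M').
have := uw (maxn M M'); rewrite !ltr_norml => h /andP[_ h1] /andP[h2 _].
by move: h h1 h2; lra.
Qed.

Lemma tends_unique (R : realFieldType) (u : nat -> R) a b : tends u a -> tends u b -> a = b.
Proof.
by move=> ua ub; apply/eqP; rewrite eq_le (tends_le ua ub) // (tends_le ub ua).
Qed.

(** A selection with [k <= s k] need not be increasing, but it already preserves limits. *)
Lemma tends_sub (R : numDomainType) (u : nat -> R) l (s : nat -> nat) :
  (forall k, (k <= s k)%N) -> tends u l -> tends (fun k => u (s k)) l.
Proof. by move=> sk ul e /ul [M h]; exists M => m Mm; apply/h/(leq_trans Mm). Qed.

Lemma tends_harmonic (R : realType) : tends (fun k => k.+1%:R^-1 : R) 0.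
Proof.
move=> e e0; exists (Num.bound e^-1) => m Mm.
have e1 : 0 < e^-1 by rewrite invr_gt0.
rewrite subr0 ger0_norm ?invr_ge0 // invf_plt ?posrE //.
apply: lt_le_trans (archi_boundP (ltW e1)) _.
by rewrite ler_nat leqW.
Qed.

Lemma tends_tev (R : realFieldType) k (v : nat -> nat -> R) (w : nat -> R) (p : tower R k) :
  (forall i, (i < k)%N -> tends (fun m => v m i) (w i)) ->
  tends (fun m => tev k (v m) p) (tev k w p).
Proof.
elim: k p => [|k IH] p h; first exact: tends_cst.
have E u : tev k.+1 u p = \sum_(i < size (p : {poly _})) tev k u (p : {poly _})`_i * u k ^+ i.
  rewrite tevS (@horner_coef_wide _ (size (p : {poly _}))); last exact: size_poly.
  by apply: eq_bigr => i _; rewrite coef_map.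
rewrite E; apply: eq_tends (fun m => esym (E (v m))) _.
apply: tends_sum => i; apply: tends_M; last by apply: tends_X; apply: h.
by apply: IH => j jk; apply: h; apply: ltnW.
Qed.

(** The limit is the upper limit of [u]: eventually all terms are below [L + d], and infinitely many
    exceed [L - d]. *)
Lemma bolzano_weierstrass (R : realType) (u : nat -> R) :
  (forall m, `|u m| <= 1) ->
  exists2 s : nat -> nat, (forall k, (k <= s k)%N) & exists l, tends (fun k => u (s k)) l.
Proof.
move=> ub.
pose S : set R := [set y | forall M, exists2 m, (M <= m)%N & y <= u m]%classic.
have S0 : S (-1) by move=> M; exists M => //; have := ub M; rewrite ler_norml => /andP[].
have Sub : ubound S 1.
  move=> y /(_ 0%N) [m _ /le_trans]; apply; have := ub m; rewrite ler_norml => /andP[] //.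
have hS : has_sup S by split; [exists (-1)|exists 1].
set L := sup S.
have inf_often k : exists m, (k <= m)%N /\ `|u m - L| < k.+1%:R^-1.
  have : 0 < k.+1%:R^-1 :> R by rewrite invr_gt0.
  move: (k.+1%:R^-1) => d e0.
  have [M hM] : exists M, forall m, (M <= m)%N -> u m < L + d.
    apply: contrapT => h.
    have : S (L + d).
      move=> M; apply: contrapT => h1; apply: h; exists M => m Mm.
      by rewrite ltNge; apply/negP => h2; apply: h1; exists m.
    by move=> /(ub_le_sup hS.2); rewrite -/L gerDl leNgt e0.
  have [y Sy yL] := sup_adherent e0 hS.
  have [m Mm ym] := Sy (maxn k M); rewrite geq_max in Mm; case/andP: Mm => km Mm.
  exists m; split => //; rewrite ltr_norml; apply/andP; split.
    by move: yL ym; rewrite -/L; lra.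
  by have := hM m Mm; lra.
have [s hs] := choice inf_often.
exists s => [k|]; first by case: (hs k).
exists L => e /(@tends_harmonic R) [M hM]; exists M => m /hM.
rewrite subr0 ger0_norm ?invr_ge0 //; apply: lt_trans.
by case: (hs m).
Qed.

Lemma tends_abs_le (R : realFieldType) (u : nat -> R) l M :
  tends u l -> (forall m, `|u m| <= M) -> `|l| <= M.
Proof.
move=> ul um; rewrite ler_norml; apply/andP; split.
  by apply: (tends_le (@tends_cst R (- M)) ul) => m; have := um m; rewrite ler_norml => /andP[].
by apply: (tends_le ul (@tends_cst R M)) => m; have := um m; rewrite ler_norml => /andP[].
Qed.

Lemma box_compact (R : realType) n (u : nat -> 'I_n -> R) :
  (forall m, inB (u m)) ->
  exists2 s : nat -> nat, (forall k, (k <= s k)%N) &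
    exists2 l, inB l & forall i, tends (fun k => u (s k) i) (l i).
Proof.
move=> uB.
suff [s sk h] : exists2 s : nat -> nat, (forall k, (k <= s k)%N) &
    forall i, i \in enum 'I_n -> exists l, tends (fun k => u (s k) i) l.
  exists s => //.
  have /fin_all_exists [l hl] : forall i, exists l, tends (fun k => u (s k) i) l.
    by move=> i; apply: h; rewrite mem_enum.
  by exists l => // i; apply: (tends_abs_le (hl i)) => m; apply: uB.
elim: (enum 'I_n) => [|i s0 [s sk h]]; first by exists id.
have [|t tk [l hl]] := @bolzano_weierstrass R (fun k => u (s k) i); first by move=> m; apply: uB.
exists (s \o t) => [k|j]; first exact: leq_trans (tk k) (sk (t k)).
rewrite inE => /orP[/eqP->|/h [l' hl']]; first by exists l.
by exists l'; apply: (@tends_sub _ (fun k => u (s k) j)).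
Qed.

(** * Lipschitz functions on the box *)

Definition lipB (R : realFieldType) n (f : ('I_n -> R) -> R) : Prop :=
  exists2 M, 0 <= M & forall x y e, inB x -> inB y -> 0 <= e -> near_by e x y ->
    `|f y - f x| <= M * e.

Lemma lipB_const (R : realFieldType) n (a : R) : lipB (fun _ : 'I_n -> R => a).
Proof. by exists 0 => // x y e *; rewrite subrr normr0 mul0r. Qed.

Lemma lipB_coord (R : realFieldType) n (i : 'I_n) : lipB (fun x : 'I_n -> R => x i).
Proof. by exists 1 => // x y e _ _ _ /(_ i); rewrite mul1r. Qed.

Lemma lipB_D (R : realFieldType) n (f g : ('I_n -> R) -> R) : lipB f -> lipB g -> lipB (fun x => f x + g x).
Proof.
move=> [M M0 hM] [M' M'0 hM']; exists (M + M'); first exact: addr_ge0.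
move=> x y e xB yB e0 xy; rewrite opprD addrACA mulrDl.
apply: le_trans (ler_normD _ _) _; apply: lerD; [exact: hM|exact: hM'].
Qed.

Lemma lipB_Z (R : realFieldType) n a (f : ('I_n -> R) -> R) : lipB f -> lipB (fun x => a * f x).
Proof.
move=> [M M0 hM]; exists (`|a| * M); first exact: mulr_ge0.
move=> x y e xB yB e0 xy; rewrite -mulrBr normrM -mulrA ler_wpM2l //; exact: hM.
Qed.

Lemma eq_lipB (R : realFieldType) n (f g : ('I_n -> R) -> R) : f =1 g -> lipB f -> lipB g.
Proof. by move=> e [M M0 hM]; exists M => // x y d; rewrite -!e; apply: hM. Qed.

Lemma near2 (R : realFieldType) n (x y : 'I_n -> R) : inB x -> inB y -> near_by 2 x y.
Proof.
move=> xB yB i; apply: le_trans (ler_normB _ _) _.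
have -> : 2 = 1 + 1 :> R by ring.
by apply: lerD.
Qed.

Lemma pol_lipB (R : realFieldType) n D (f : ('I_n -> R) -> R) : pol D f -> lipB f.
Proof.
move=> fp; have [g gD [M M0 hM]] := pol_grad fp.
have gb : forall i, exists m, forall x, inB x -> `|g i x| <= m.
  move=> i; have := gD i; case: (D) => [gi|D' /pol_bounded[m _ hm]]; last by exists m.
  by exists 0 => x _; rewrite gi normr0.
have [m hm] := fin_all_exists gb.
pose M2 := \sum_i `|m i|.
have M20 : 0 <= M2 by exact: sumr_ge0.
have hM2 i x : inB x -> `|g i x| <= M2.
  move=> xB; apply: le_trans (hm i x xB) _; apply: le_trans (ler_norm _) _.
  by rewrite /M2 (bigD1 i) //= lerDl sumr_ge0.
have small x y e : inB x -> inB y -> 0 <= e <= 2 -> near_by e x y ->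
    `|f y - f x| <= (2 * M + n%:R * M2) * e.
  move=> xB yB e2 xy; have h := hM _ _ _ xB yB e2 xy.
  set S := \sum_i _ in h.
  have hS : `|S| <= n%:R * M2 * e by apply: sum_near => // i; apply: hM2.
  have -> : f y - f x = f y - f x - S + S by ring.
  apply: le_trans (ler_normD _ _) _; rewrite mulrDl; apply: lerD => //.
  apply: le_trans h _; case/andP: e2 => e0 e2.
  have -> : 2 * M * e = M * (2 * e) by ring.
  by rewrite ler_wpM2l // expr2 ler_wpM2r.
exists (2 * M + n%:R * M2); first by rewrite addr_ge0 ?mulr_ge0.
move=> x y e xB yB e0 xy; have [e2|e2] := leP e 2; first by apply: small; rewrite ?e0.
apply: le_trans (small x y 2 xB yB _ (near2 xB yB)) _; first by rewrite lexx ler0n.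
by rewrite ler_wpM2l ?(ltW e2) // addr_ge0 ?mulr_ge0.
Qed.

Lemma near_all (R : realFieldType) n (u : nat -> 'I_n -> R) l :
  (forall i, tends (fun k => u k i) (l i)) ->
  forall e, 0 < e -> exists M, forall m, (M <= m)%N -> near_by e l (u m).
Proof.
move=> ul e e0.
have /fin_all_exists [Ms hMs] : forall i, exists M, forall m, (M <= m)%N -> `|u m i - l i| < e.
  by move=> i; apply: ul.
exists (\max_i Ms i) => m Mm i; apply/ltW/hMs; apply: leq_trans Mm.
exact: leq_bigmax.
Qed.

Lemma lipB_tends (R : realFieldType) n (f : ('I_n -> R) -> R) u l :
  lipB f -> (forall m, inB (u m)) -> inB l ->
  (forall i, tends (fun k => u k i) (l i)) -> tends (fun k => f (u k)) (f l).
Proof.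
move=> [M M0 hM] uB lB ul e e0.
have M10 : 0 < M + 1 by rewrite ltr_wpDl.
have d0 : 0 < e / (M + 1) by rewrite divr_gt0.
have [K hK] := near_all ul d0; exists K => m /hK hm.
apply: le_lt_trans (hM _ _ _ lB (uB m) (ltW d0) hm) _.
rewrite mulrA ltr_pdivrMr // mulrDr mulr1 [e * M]mulrC ltrDl //.
Qed.

Lemma min_attained (R : realType) n (f : ('I_n -> R) -> R) : lipB f ->
  exists2 x, inB x & forall y, inB y -> f x <= f y.
Proof.
move=> fl; have [M M0 hM] := fl.
have B0 : inB (fun _ : 'I_n => 0 : R) by move=> i; rewrite normr0.
pose S : set R := [set r | exists2 x, inB x & f x = r]%classic.
have hS : has_inf S.
  split; first by exists (f (fun _ => 0)), (fun _ => 0).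
  exists (f (fun _ => 0) - M * 2) => _ [x xB <-].
  have := hM _ _ 2 B0 xB (ler0n _ _) (near2 B0 xB); rewrite ler_norml => /andP[+ _].
  by lra.
have near k : exists x, inB x /\ f x < inf S + k.+1%:R^-1.
  have e0 : 0 < k.+1%:R^-1 :> R by rewrite invr_gt0.
  by have [_ [x xB <-] h] := inf_adherent e0 hS; exists x.
have [u hu] := choice near.
have [s sk [l lB ul]] := box_compact (fun m => (hu m).1).
exists l => // y yB; apply: (@le_trans _ _ (inf S)).
  have t1 := lipB_tends fl (fun m => (hu (s m)).1) lB ul.
  have t2 : tends (fun k => inf S + (s k).+1%:R^-1) (inf S + 0).
    apply: tends_D; first exact: tends_cst.
    exact: (@tends_sub _ (fun k => k.+1%:R^-1 : R) _ s sk (@tends_harmonic R)).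
  by rewrite -[inf S]addr0; apply: (tends_le t1 t2) => m; apply: ltW; case: (hu (s m)).
by apply: (ge_inf hS.2); exists y.
Qed.

(** * Minimizers of perturbed problems *)

(** Parameter 0 holds the value of [f] or the level [t]; parameter [i + 1] holds the coefficient of
    the [i]-th linear perturbation. *)
Definition vcons (R : Type) (s : R) (c : nat -> R) : nat -> R :=
  fun m => if m is i.+1 then c i else s.

Definition vset (R : Type) (k : nat) (v : nat -> R) (y : R) : nat -> R :=
  fun i => if i == k then y else v i.

Lemma tev_vset (R : idomainType) k (v : nat -> R) y (P : {poly tower R k}) :
  tev k.+1 (vset k v y) P = (map_poly (tev k v) P).[y].
Proof.
rewrite tevS {2}/vset eqxx; congr (_.[_]); apply: eq_map_poly; apply: eq_tev.
by move=> i ik; rewrite /vset ltn_eqF.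
Qed.

Definition minimizer (R : numDomainType) n (f : ('I_n -> R) -> R) (x : 'I_n -> R) : Prop :=
  inB x /\ forall z, inB z -> f x <= f z.

Definition linear_pert (R : pzRingType) n k (c : nat -> R) (ell : nat -> ('I_n -> R) -> R)
    (f : ('I_n -> R) -> R) : ('I_n -> R) -> R :=
  fun x => f x + \sum_(i < k) c i * ell i x.

Lemma lipB_pert (R : realFieldType) n k (c : nat -> R) ell (O : ('I_n -> R) -> R) :
  lipB O -> (forall i, lipB (ell i)) -> lipB (linear_pert k c ell O).
Proof.
move=> Ol elll; apply: lipB_D => //; elim: k => [|k IH].
  by apply: eq_lipB (lipB_const n 0) => x; rewrite big_ord0.
by apply: eq_lipB (lipB_D IH (lipB_Z (c k) (elll k))) => x; rewrite big_ord_recr.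
Qed.

(* The perturbation parameters are sent to [0] one at a time, the last one first. *)
Lemma selection (R : realType) n (Fc J : finType) k (P : Fc -> J -> {poly tower R k.+1}) :
  (forall F j, P F j != 0) ->
  exists2 Q : Fc -> J -> {poly {poly R}},
    forall F j, Q F j != 0 /\ (size (Q F j) <= size (P F j))%N &
  forall (O s : ('I_n -> R) -> R) (y : J -> ('I_n -> R) -> R) (ell : nat -> ('I_n -> R) -> R),
    lipB O -> lipB s -> (forall j, lipB (y j)) -> (forall i, lipB (ell i)) ->
    (forall c : nat -> R, exists2 x, minimizer (linear_pert k c ell O) x &
        forall j, exists F, (map_poly (tev k.+1 (vcons (s x) c)) (P F j)).[y j x] = 0) ->
    exists2 x, minimizer O x &
        forall j, exists F, (map_poly (horner_eval (s x)) (Q F j)).[y j x] = 0.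
Proof.
elim: k P => [|k IH] P P0.
  exists P => [F j|O s y ell Ol sl yl elll /(_ (fun _ => 0)) [x [xB xmin] hx]].
    by split=> //; exact: P0.
  exists x.
    split=> // z zB; have := xmin z zB.
    by rewrite /linear_pert !big_ord0 !addr0.
  move=> j; have [F hF] := hx j; exists F.
  rewrite -[RHS]hF; congr (_.[_]); apply: eq_map_poly => p.
  by rewrite tevS /= map_poly_id.
have /fin_all_exists [P' hP'] := fun F => fin_all_exists (fun j => elim_var (P0 F j)).
have [|Q hQ1 hQ2] := IH (fun F j => map_poly (horner_eval 0) (P' F j : {poly {poly tower R k.+1}})).
  by move=> F j; case: (hP' F j).
exists Q => [F j|O s y ell Ol sl yl elll H].
  have [h1 h2] := hQ1 F j; split=> //; apply: leq_trans h2 _.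
  by case: (hP' F j).
apply: (hQ2 O s y ell) => // c.
pose cm (m : nat) : nat -> R := vset k c m.+1%:R^-1.
have [u hu] := choice (fun m => ex2_ind (fun x p q => ex_intro (fun x => _ /\ _) x (conj p q)) (H (cm m))).
have [t tk [l lB ul]] := box_compact (fun m => (hu m).1.1).
have utB m : inB (u (t m)) := (hu (t m)).1.1.
have harm : tends (fun m => (t m).+1%:R^-1 : R) 0.
  exact: (@tends_sub _ (fun k => k.+1%:R^-1 : R) _ t tk (@tends_harmonic R)).
have cmE m i : (i < k)%N -> cm m i = c i by move=> ik; rewrite /cm /vset ltn_eqF.
have pertE m x : linear_pert k.+1 (cm m) ell O x = linear_pert k c ell O x + m.+1%:R^-1 * ell k x.
  rewrite /linear_pert big_ord_recr /= addrA /cm {2}/vset eqxx; congr (_ + _ + _).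
  by apply: eq_bigr => i _; rewrite -/(cm m i) cmE.
have pertl : lipB (linear_pert k c ell O) by exact: lipB_pert.
exists l.
  split=> // z zB.
  rewrite -[linear_pert _ _ _ _ l]addr0 -[X in X <= _](congr1 (+%R _) (mul0r (ell k l))).
  rewrite -[linear_pert _ _ _ _ z]addr0 -[X in _ <= X](congr1 (+%R _) (mul0r (ell k z))).
  apply: tends_le.
  - apply: tends_D; first exact: (lipB_tends pertl utB lB ul).
    apply: tends_M harm (lipB_tends (elll k) utB lB ul).
  - apply: tends_D; first exact: tends_cst.
    apply: tends_M harm (tends_cst (ell k z)).
  move=> m /=; rewrite -!pertE; exact: (hu (t m)).1.2.
move=> j.
pose val m F := tev k.+3 (vset k.+2 (vcons (s (u (t m))) (cm (t m))) (y j (u (t m)))) (P' F j).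
pose lim F := tev k.+3 (vset k.+2 (vcons (s l) (vset k c 0)) (y j l)) (P' F j).
(* The face whose relation holds may change with [m]. The product over all faces vanishes for every
   [m], so it passes to the limit and some factor vanishes there. *)
have tl : tends (fun m => \prod_F val m F) (\prod_F lim F).
  apply: tends_prod => F; apply: tends_tev => i _; rewrite /vset.
  case: eqP => _; first exact: lipB_tends.
  case: i => [|i] /=; first exact: lipB_tends.
  by rewrite /cm /vset; case: eqP => _ //; exact: tends_cst.
have : \prod_F lim F = 0.
  apply: (tends_unique tl); apply: eq_tends (tends_cst 0) => m; apply/esym/eqP.
  have [F hF] := (hu (t m)).2 j; apply/prodf_eq0; exists F => //; rewrite /val tev_vset.
  have [_ _ h3 _] := hP' F j; apply/eqP/h3 => //.
  by rewrite /= /cm /vset eqxx invr_eq0 pnatr_eq0.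
move/eqP/prodf_eq0 => [F _ /eqP]; rewrite /lim tev_vset => hF; exists F.
have [_ _ _ h4] := hP' F j.
rewrite -[RHS]hF h4; last by rewrite /= /vset eqxx.
congr (_.[_]); apply: eq_map_poly; apply: eq_tev => -[|i] //= ik.
by rewrite /vset ltn_eqF.
Qed.

Lemma ivt_lipschitz (R : realType) (V : R -> R) (K a b y : R) : 0 <= K ->
  (forall t t', a <= t <= b -> a <= t' <= b -> `|V t - V t'| <= K * `|t - t'|) ->
  a <= b -> V a <= y <= V b -> exists2 t, a <= t <= b & V t = y.
Proof.
move=> K0 lipV ab /andP[Va Vb].
pose S : set R := [set t | a <= t <= b /\ V t <= y]%classic.
have Sa : S a by split; rewrite ?lexx.
have hS : has_sup S by split; [exists a|exists b => t [/andP[]]].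
have sab : a <= sup S <= b.
  apply/andP; split; first exact: (ub_le_sup hS.2).
  by apply: ge_sup => [|t [/andP[]]]; first by exists a.
have K10 : 0 < K + 1 by rewrite ltr_wpDl.
exists (sup S) => //; apply/eqP; rewrite eq_le; apply/andP; split; rewrite leNgt; apply/negP => h.
  have d0 : 0 < (V (sup S) - y) / (K + 1) by rewrite divr_gt0 // subr_gt0.
  have [t [tab Vt] st] := sup_adherent d0 hS.
  have ts : t <= sup S by apply: (ub_le_sup hS.2).
  have := lipV (sup S) t sab tab; rewrite [`|sup S - t|]ger0_norm ?subr_ge0 //.
  move=> /(le_trans (ler_norm _)) h1.
  have : V (sup S) - y <= K * (sup S - t) by lra.
  have h2 : (sup S - t) * (K + 1) < V (sup S) - y by rewrite -ltr_pdivlMr //; lra.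
  by have := subr_ge0 t (sup S); rewrite ts => h3; nra.
have sb : sup S < b.
  rewrite lt_neqAle; case/andP: sab => _ ->; rewrite andbT; apply: contraTneq h => ->.
  by rewrite -leNgt.
have d0 : 0 < (y - V (sup S)) / (K + 1) by rewrite divr_gt0 // subr_gt0.
pose d := Num.min (b - sup S) ((y - V (sup S)) / (K + 1)).
have dp : 0 < d by rewrite lt_min subr_gt0 sb.
have dE : d * (K + 1) <= y - V (sup S) by rewrite -ler_pdivlMr // ge_min lexx orbT.
have tab : a <= sup S + d <= b.
  case/andP: sab => h1 h2; apply/andP; split; first lra.
  have : d <= b - sup S by rewrite ge_min lexx.
  by lra.
have := lipV (sup S + d) (sup S) tab sab.
rewrite [sup S + d - sup S]addrC addKr [`|d|]gtr0_norm // => /(le_trans (ler_norm _)) h1.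
have : S (sup S + d) by split=> //; nra.
by move=> /(ub_le_sup hS.2); rewrite gerDl leNgt dp.
Qed.

(** * Algebraic relations at critical points on a face *)

(** Once the power of the last variable is divided out, the relation is continuous and survives the
    limit in which this variable tends to 0 through nonzero values, even if the other parameters
    move along. *)
Lemma elim_var_limit (R : realFieldType) k (P : {poly tower R k.+1}) : P != 0 ->
  exists2 Q : {poly tower R k}, Q != 0 /\ (size Q <= size P)%N &
  forall (v : nat -> nat -> R) w (z : nat -> R) y,
    (forall m, v m k != 0) -> tends (fun m => v m k) 0 ->
    (forall i, (i < k)%N -> tends (fun m => v m i) (w i)) -> tends z y ->
    (forall m, (map_poly (tev k.+1 (v m)) P).[z m] = 0) ->
    (map_poly (tev k w) Q).[y] = 0.
Proof.
move=> P0; have [P' [h1 h2 h3 h4]] := elim_var P0.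
exists (map_poly (horner_eval 0) (P' : {poly {poly tower R k}})) => //.
move=> v w z y vk vk0 vw zy hP.
have e : map_poly (tev k w) (map_poly (horner_eval 0) (P' : {poly {poly tower R k}})) =
    map_poly (tev k (vset k w 0)) (map_poly (horner_eval 0) (P' : {poly {poly tower R k}})).
  apply: eq_map_poly; apply: eq_tev => i ik; by rewrite /vset ltn_eqF.
rewrite e -h4; last by rewrite /vset eqxx.
rewrite -tev_vset.
apply: (@tends_unique R (fun m => tev k.+2 (vset k.+1 (v m) (z m)) P')).
  apply: tends_tev => i; rewrite ltnS leq_eqVlt /vset; case: eqP => [_ _|_ /=] //.
  by rewrite ltnS leq_eqVlt; case: eqP => [->|_] //=; apply: vw.
by apply: eq_tends (tends_cst 0) => m; rewrite tev_vset h3.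
Qed.

Definition ext (R : nmodType) n (x : 'I_n -> R) (j : nat) : R :=
  if insub j is Some i then x i else 0.

Lemma extE (R : nmodType) n (x : 'I_n -> R) (i : 'I_n) : ext x i = x i.
Proof. by rewrite /ext valK. Qed.

Definition face n := {ffun 'I_n -> option bool}.

Definition on_face (R : pzRingType) n (F : face n) (x : 'I_n -> R) : Prop :=
  forall i b, F i = Some b -> x i = (-1) ^+ b.

Lemma rule_pfun (R : idomainType) n K (D : nat) (Pt : (nat -> R) -> ('I_n -> R) -> Prop)
    (i i0 : 'I_n) (b : bool) (u : tower R K) D' g : (D' < D)%N -> u != 0 -> @pfun R n K D' g ->
  (forall v x, Pt v x -> tev K v u * x i ^+ D = g v x) ->
  exists u : tower R K, exists ms : seq (tower R K * {ffun 'I_n -> nat}),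
    [/\ u != 0,
        all (fun m : tower R K * {ffun 'I_n -> nat} => (mdeg m.2 < D)%N ||
              [&& b, (mdeg m.2 <= D)%N & (m.2 i0 < D)%N]) ms &
        forall v x, Pt v x ->
          tev K v u * x i ^+ D = \sum_(m <- ms) tev K v m.1 * mono x m.2].
Proof.
move=> DD u0 [ms msD gE] h; exists u, ms; split=> //.
  by apply: sub_all msD => m /= mD; rewrite (leq_ltn_trans mD DD).
by move=> v x pt; rewrite h // gE.
Qed.

(** Adding [eps * x i ^+ De.+1] gives each free equation a pure leading power, so all monomials
    reduce. Parameters are [v 0], then the [n] linear coefficients, then [eps] at index [n + 1]; as
    [e] and [g] see [v 0] only, the coefficients can be adjusted freely. *)
Lemma relation_free (R : realType) n (i0 : 'I_n) (F : face n) De Dg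
    (e : 'I_n -> (nat -> R) -> ('I_n -> R) -> R) (g : (nat -> R) -> ('I_n -> R) -> R) :
  (forall i, @pfun R n n.+2 De (e i)) -> @pfun R n n.+2 Dg g ->
  (forall i v w x, v 0 = w 0 -> e i v x = e i w x) ->
  (forall v w x, v 0 = w 0 -> g v x = g w x) ->
  exists2 P : {poly tower R n.+1}, P != 0 & forall v x, on_face F x ->
    (forall i : 'I_n, F i = None -> e i v x + v i.+1 = 0) ->
    (map_poly (tev n.+1 v) P).[g v x] = 0.
Proof.
move=> ep gp e0 g0.
pose D i := if F i is None then De.+1 else 1%N.
pose Pt (v : nat -> R) (x : 'I_n -> R) := on_face F x /\
  forall i : 'I_n, F i = None -> e i v x + v i.+1 + v n.+1 * x i ^+ De.+1 = 0.
have D0 i : (0 < D i)%N by rewrite /D; case: (F i).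
have rules : @rewrite_rules R n n.+2 D i0 Pt.
  move=> i; rewrite /D; case FE : (F i) => [b|].
    apply: (@rule_pfun _ _ _ _ _ _ _ _ 1 0 (fun v x => tev n.+2 v (tconst n.+2 ((-1) ^+ b)))) => //.
    - exact: oner_neq0.
    - exact: pfun_const.
    by move=> v x [xF _]; rewrite tev_const (xF _ _ FE) rmorph1 mul1r expr1.
  apply: (@rule_pfun _ _ _ _ _ _ _ _ (tvar R n.+2 n.+1) De (fun v x => - (e i v x + tev n.+2 v (tvar R n.+2 i.+1)))) => //.
  - by apply: (@tev_neq0 _ _ (fun=> 1)); rewrite tev_var // oner_neq0.
  - by apply: pfunN; apply: pfunD => //; apply: pfunW (pfun_const _ _).
  move=> v x [_ /(_ i FE) /eqP]; rewrite tev_var // tev_var; last by rewrite !ltnS ltnW.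
  by rewrite addr_eq0 => /eqP ->; rewrite opprK.
have [P [P0 _ hP]] := perron D0 rules gp.
have [Q [Q0 _] hQ] := elim_var_limit P0.
exists Q => // v x xF xE.
(* The point [x] stays fixed and the linear coefficients absorb the new term, so [x] solves the
   system for each [eps = 1 / (m + 1)]. *)
pose vm m : nat -> R := vset n.+1 (vcons (v 0) (fun i => v i.+1 - m.+1%:R^-1 * ext x i ^+ De.+1)) m.+1%:R^-1.
have vm0 m : vm m 0 = v 0 by [].
apply: (hQ vm v (fun m => g (vm m) x)).
- by move=> m; rewrite /vm /vset eqxx invr_eq0 pnatr_eq0.
- by apply: eq_tends (@tends_harmonic R) => m; rewrite /vm /vset eqxx.
- move=> i ik; rewrite /vm /vset ltn_eqF //=; case: i ik => [|i] ik /=; first exact: tends_cst.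
  rewrite -[v i.+1 in X in tends _ X]addr0 -(mulr0 (- ext x i ^+ De.+1)).
  apply: tends_D; first exact: tends_cst.
  apply: eq_tends (tends_M (tends_cst _) (@tends_harmonic R)) => m; ring.
- by apply: eq_tends (tends_cst _) => m; apply: g0.
move=> m; apply: hP; split=> // i FE.
have -> : vm m n.+1 = m.+1%:R^-1 by rewrite /vm /vset eqxx.
have -> : vm m i.+1 = v i.+1 - m.+1%:R^-1 * ext x i ^+ De.+1 by rewrite /vm /vset eqSS ltn_eqF.
rewrite (e0 i _ v) //.
by rewrite extE -[RHS](xE i FE); ring.
Qed.

Lemma pol_line (R : idomainType) n D (f : ('I_n -> R) -> R) x y : pol D f ->
  exists p : {poly R}, forall th, f (fun i => x i + th * (y i - x i)) = p.[th].
Proof.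
move=> [ms _ /(_ (fun=> 0)) fE].
exists (\sum_(m <- ms) m.1 *: \prod_i (x i *: 1 + (y i - x i) *: 'X) ^+ m.2 i) => th.
rewrite fE horner_sum; apply: eq_bigr => m _; rewrite hornerZ /mono horner_prod; congr (_ * _).
by apply: eq_bigr => i _; rewrite !hornerE; congr (_ ^+ _); ring.
Qed.

Lemma nonroot_harmonic (R : realType) (p : {poly R}) M : p != 0 ->
  exists2 k, (M <= k)%N & p.[k.+1%:R^-1] != 0.
Proof.
move=> p0; apply: contrapT => h.
have := @max_poly_roots _ p [seq (M + k).+1%:R^-1 | k <- iota 0 (size p)] p0.
rewrite size_map size_iota ltnn => H; suff : false by [].
apply: H.
  apply/allP => _ /mapP[k _ ->]; apply/rootP; apply: contrapT => /eqP hk.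
  by apply: h; exists (M + k)%N => //; exact: leq_addr.
rewrite map_inj_uniq ?iota_uniq // => a b /invr_inj /eqP.
by rewrite eqr_nat eqSS eqn_add2l => /eqP.
Qed.

Lemma inB_segment (R : realFieldType) n (x y : 'I_n -> R) th : inB x -> inB y -> 0 <= th <= 1 ->
  inB (fun i => x i + th * (y i - x i)).
Proof.
move=> xB yB /andP[t0 t1] i.
have -> : x i + th * (y i - x i) = (1 - th) * x i + th * y i by ring.
apply: le_trans (ler_normD _ _) _; rewrite !normrM [`|1 - th|]ger0_norm ?subr_ge0 // [`|th|]ger0_norm //.
have := xB i; have := yB i; nra.
Qed.

Lemma on_face_segment (R : comPzRingType) n (F : face n) (x y : 'I_n -> R) th :
  on_face F x -> on_face F y -> on_face F (fun i => x i + th * (y i - x i)).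
Proof. by move=> xF yF i b Fi; rewrite (xF _ _ Fi) (yF _ _ Fi) subrr mulr0 addr0. Qed.

(** The segment is cut into [m + 1] steps. Fixed coordinates do not move and free partial
    derivatives vanish, so each step changes [f] by [O(1 / m ^ 2)] and all together by
    [O(1 / m)]. *)
Lemma face_constant (R : realType) n (F : face n) f (g : 'I_n -> ('I_n -> R) -> R) :
  taylor f g ->
  (forall i x, F i = None -> on_face F x -> inB x -> g i x = 0) ->
  forall x y, on_face F x -> inB x -> on_face F y -> inB y -> f x = f y.
Proof.
move=> [M M0 hM] g0 x y xF xB yF yB.
pose z (m k : nat) (i : 'I_n) := x i + (k%:R / m.+1%:R) * (y i - x i).
have zB m k : (k <= m.+1)%N -> inB (z m k).
  move=> km; apply: inB_segment => //; rewrite divr_ge0 //= ler_pdivrMr // mul1r ler_nat //.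
have zF m k : on_face F (z m k) by apply: on_face_segment.
have step m k : (k < m.+1)%N -> `|f (z m k.+1) - f (z m k)| <= M * (2 / m.+1%:R) ^+ 2.
  move=> km.
  have e0 : 0 <= 2 / m.+1%:R :> R by rewrite divr_ge0.
  have e2 : 2 / m.+1%:R <= 2 :> R by rewrite ler_pdivrMr // ler_peMr // ler1n.
  have := hM (z m k) (z m k.+1) (2 / m.+1%:R) (zB _ _ (ltnW km)) (zB _ _ km).
  rewrite e0 e2 big1 ?subr0; first apply=> // i.
    rewrite /z; have -> : x i + k.+1%:R / m.+1%:R * (y i - x i) - (x i + k%:R / m.+1%:R * (y i - x i))
      = (y i - x i) / m.+1%:R by rewrite -natr1; ring.
    rewrite normrM [`|m.+1%:R^-1|]ger0_norm ?invr_ge0 // ler_pM ?invr_ge0 //.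
    exact: near2.
  move=> i _; case FE : (F i) => [b|]; last by rewrite g0 // ?mul0r //; apply: zB; apply: ltnW.
  by rewrite (zF m k _ _ FE) (zF m k.+1 _ _ FE) subrr mulr0.
have tot m k : (k <= m.+1)%N -> `|f (z m k) - f x| <= k%:R * (M * (2 / m.+1%:R) ^+ 2).
  elim: k => [_|k IH km].
    by rewrite mul0r /z; under [X in f X]funext do rewrite !mul0r addr0; rewrite subrr normr0.
  rewrite -natr1 mulrDl mul1r.
  have -> : f (z m k.+1) - f x = (f (z m k) - f x) + (f (z m k.+1) - f (z m k)) by ring.
  by apply: le_trans (ler_normD _ _) _; apply: lerD; [apply/IH/ltnW|exact: step].
have fin m : `|f y - f x| <= 4 * M * m.+1%:R^-1.
  have := tot m m.+1 (leqnn _).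
  have -> : z m m.+1 = y.
    by apply: funext => i; rewrite /z divff ?pnatr_eq0 // mul1r addrC subrK.
  move=> /le_trans; apply; rewrite le_eqVlt; apply/orP; left; apply/eqP.
  by field; rewrite addrC natr1 pnatr_eq0.
apply/esym/eqP; rewrite -subr_eq0 -normr_le0.
apply: (tends_le (tends_cst _) _ fin).
have -> : 0 = 4 * M * 0 :> R by rewrite mulr0.
exact: tends_M (tends_cst _) (@tends_harmonic R).
Qed.

(** Perturbing by a power of the same degree [d] as [f] keeps the factor [d] of the exponent.
    Monomials of degree [d] in [f] are then not smaller in total degree, but apart from the pure
    power of [x i0], which joins the left side, they have a lower exponent at [i0]: hence the second
    key of the order. The coefficient [v k + a] is a nonzero polynomial for every [a]. *)
Lemma monic_rule (R : idomainType) n d (f : ('I_n -> R) -> R) (i0 : 'I_n) K k :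
  (0 < d)%N -> (k < K)%N -> pol d f ->
  forall Pt : (nat -> R) -> ('I_n -> R) -> Prop,
  (forall v x, Pt v x -> f x + v k * x i0 ^+ d = v 0) ->
  exists u : tower R K, exists ms : seq (tower R K * {ffun 'I_n -> nat}),
    [/\ u != 0,
        all (fun m : tower R K * {ffun 'I_n -> nat} => (mdeg m.2 < d)%N ||
              (mdeg m.2 <= d)%N && (m.2 i0 < d)%N) ms &
        forall v x, Pt v x ->
          tev K v u * x i0 ^+ d = \sum_(m <- ms) tev K v m.1 * mono x m.2].
Proof.
move=> d0 kK [ms msd /(_ (fun=> 0)) fE] Pt hPt.
pose hi (m : tower R 0 * {ffun 'I_n -> nat}) := (d <= m.2 i0)%N.
pose a : R := \sum_(m <- ms | hi m) m.1.
pose u := tvar R K k + tconst K a.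
have uE v : tev K v u = v k + a by rewrite rmorphD tev_var ?tev_const.
exists u, ((tvar R K 0, [ffun=> 0%N]) ::
  [seq (tconst K (- m.1), m.2) | m : tower R 0 * {ffun 'I_n -> nat} <- ms & ~~ hi m]).
have z0 : mdeg ([ffun=> 0%N] : {ffun 'I_n -> nat}) = 0%N.
  by rewrite /mdeg big1 // => i _; rewrite ffunE.
split.
- by apply: (@tev_neq0 _ _ (fun=> 1 - a)); rewrite uE subrK oner_neq0.
- rewrite /= z0 d0 /=; apply/allP => _ /mapP[m + ->] /=.
  rewrite mem_filter /hi -ltnNge => /andP[-> mms].
  by rewrite (allP msd m mms) orbT.
move=> v x /hPt /eqP; rewrite -subr_eq0 uE big_cons /= tev_var; last by apply: leq_trans kK.
rewrite /mono big1 ?mulr1; last by move=> i _; rewrite ffunE.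
rewrite big_map big_filter -/(mono x _) => h.
have hiE : \sum_(m <- ms | hi m) m.1 * mono x m.2 = a * x i0 ^+ d.
  rewrite /a mulr_suml big_seq_cond [RHS]big_seq_cond.
  apply: eq_bigr => m /andP[mms hm]; congr (_ * _).
  have md := allP msd m mms; rewrite /= in md.
  have e : forall i, m.2 i = (if i == i0 then d else 0)%N.
    have mi : m.2 i0 = d.
      by apply/eqP; rewrite eqn_leq; apply/andP; split=> //; exact: leq_trans (mdeg_ge _ _) md.
    move=> i; case: eqP => [->//|/eqP ne].
    move: md; rewrite /mdeg (bigD1 i0) //= (bigD1 i) //= mi.
    by lia.
  by rewrite (eq_mono x e) mono_single.
have fE' : f x = a * x i0 ^+ d + \sum_(m <- ms | ~~ hi m) m.1 * mono x m.2.
  by rewrite fE (bigID hi) /= hiE.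
have -> : \sum_(m <- ms | ~~ hi m) tev K v (tconst K (- m.1)) * mono x m.2 =
    - \sum_(m <- ms | ~~ hi m) m.1 * mono x m.2.
  by rewrite -sumrN; apply: eq_bigr => m _; rewrite tev_const mulNr.
apply/eqP; rewrite -subr_eq0; move: h; rewrite fE'; set S := \sum_(m <- ms | _) _ => /eqP h.
by apply/eqP; rewrite -[RHS]h; ring.
Qed.

Lemma prod_degrees n (i0 : 'I_n) (F : face n) d D :
  (0 < d)%N -> (0 < D)%N ->
  (\prod_(i < n) (if F i is None then (if i == i0 then d else D) else 1) <= d * D ^ n.-1)%N.
Proof.
move=> d0 D0; rewrite (bigD1 i0) //=; apply: leq_mul.
  by case: (F i0) => //; rewrite eqxx.
have <- : #|[pred i : 'I_n | i != i0]| = n.-1 by rewrite cardC1 card_ord.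
rewrite -prod_nat_const; apply: leq_prod => i /negPf ->.
by case: (F i).
Qed.

(** The multiplier [mu] is eliminated by the two-by-two minors against a pivot [i0]; with the value
    equation this gives one rule per free coordinate. The perturbation can be absorbed only where
    the pivot derivative [gf i0] is nonzero; other points are limits of such points. *)
Lemma relation_constrained (R : realType) n (F : face n) d (f : ('I_n -> R) -> R)
    (gf gh : 'I_n -> ('I_n -> R) -> R) :
  pol d.+2 f -> (forall i, pol d.+1 (gf i)) -> taylor f gf ->
  (forall i, pol (2 * d).+1 (gh i)) ->
  forall j : 'I_n, exists2 P : {poly tower R n.+1},
    P != 0 /\ (size P <= (d.+2 * (3 * d + 3) ^ n.-1).+1)%N &
    forall v x mu, on_face F x -> inB x -> v 0 = f x ->
      (forall i : 'I_n, F i = None -> gh i x + v i.+1 = mu * gf i x) ->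
      (map_poly (tev n.+1 v) P).[x j] = 0.
Proof.
move=> fp gfp fT ghp j.
have [[i0 [x1 [Fi0 x1F x1B gx1]]]|hno] := pselect (exists i0, exists x1 : 'I_n -> R,
   [/\ F i0 = None, on_face F x1, inB x1 & gf i0 x1 != 0]); last first.
  have g0 i x : F i = None -> on_face F x -> inB x -> gf i x = 0.
    move=> Fi xF xB; apply: contrapT => /eqP h; apply: hno; by exists i, x.
  pose x0 (i : 'I_n) : R := if F i is Some b then (-1) ^+ b else 0.
  have x0F : on_face F x0 by move=> i b; rewrite /x0 => ->.
  have x0B : inB x0.
    by move=> i; rewrite /x0; case: (F i) => [b|]; rewrite ?normr0 // normrX normrN1 expr1n.
  (* All free derivatives vanish on the face, so [f] is constant there and the relation does not
     involve the coordinate at all. *)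
  pose q := tvar R n.+1 0 - tconst n.+1 (f x0).
  have qE v : tev n.+1 v q = v 0 - f x0 by rewrite rmorphB tev_var // tev_const.
  have q0 : q != 0 by apply: (@tev_neq0 _ _ (fun=> f x0 + 1)); rewrite qE addrC addKr oner_neq0.
  exists q%:P; first by rewrite polyC_eq0 size_polyC q0.
  move=> v x mu xF xB v0 _; rewrite map_polyC hornerC [LHS]qE v0.
  by rewrite (face_constant fT g0 xF xB x0F x0B) subrr.
(* The minors have degree [(d + 1) + (2 * d + 1) = 3 * d + 2], one less than [D3]. *)
pose D3 := (3 * d + 3)%N.
pose D i := if F i is None then (if i == i0 then d.+2 else D3) else 1%N.
have D0 i : (0 < D i)%N by rewrite /D /D3 addn3; case: (F i) => //; case: eqP.
pose Pt (v : nat -> R) (x : 'I_n -> R) := [/\ on_face F x, f x + v n.+1 * x i0 ^+ d.+2 = v 0 &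
  forall i : 'I_n, F i = None -> i != i0 -> 
    gf i0 x * (gh i x + v i.+1) - gf i x * (gh i0 x + v i0.+1) + v n.+1 * x i ^+ D3 = 0].
have rules : @rewrite_rules R n n.+2 D i0 Pt.
  move=> i; rewrite /D; case FE : (F i) => [b|].
    apply: (@rule_pfun _ _ _ _ _ _ _ _ 1 0 (fun v x => tev n.+2 v (tconst n.+2 ((-1) ^+ b)))) => //.
    - exact: oner_neq0.
    - exact: pfun_const.
    by move=> v x [xF _ _]; rewrite tev_const (xF _ _ FE) rmorph1 mul1r expr1.
  case: (eqVneq i i0) => [->|ni].
    by apply: (@monic_rule R n d.+2 f i0 n.+2 n.+1) => // v x [].
  have idx (l : 'I_n) : (l.+1 < n.+2)%N by rewrite !ltnS ltnW.
  apply: (@rule_pfun _ _ _ _ _ _ _ _ (tvar R n.+2 n.+1) (d.+1 + (2 * d).+1) (fun v x =>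
     - (gf i0 x * (gh i x + tev n.+2 v (tvar R n.+2 i.+1)) - gf i x * (gh i0 x + tev n.+2 v (tvar R n.+2 i0.+1))))).
  - by rewrite /D3; lia.
  - by apply: (@tev_neq0 _ _ (fun=> 1)); rewrite tev_var // oner_neq0.
  - apply: pfunN; apply: pfunB; apply: pfunM; rewrite ?gfp //.
    + exact: pol_pfun.
    + by apply: pfunD; [exact: pol_pfun|apply: pfunW (pfun_const _ _)].
    + exact: pol_pfun.
    by apply: pfunD; [exact: pol_pfun|apply: pfunW (pfun_const _ _)].
  move=> v x [_ _ /(_ i FE ni) /eqP]; rewrite !tev_var //.
  by rewrite addrC addr_eq0 => /eqP.
have [P [P0 Ps hP]] := perron D0 rules (pfun_coord R n.+2 j).
have [Q [Q0 Qs] hQ] := elim_var_limit P0.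
exists Q.
  split=> //; apply: leq_trans Qs _; apply: leq_trans Ps _; rewrite ltnS.
  by apply: (@prod_degrees n i0 F d.+2 D3); rewrite // /D3 addn3.
have regular v x mu : on_face F x -> gf i0 x != 0 -> v 0 = f x ->
      (forall i : 'I_n, F i = None -> gh i x + v i.+1 = mu * gf i x) ->
      (map_poly (tev n.+1 v) Q).[x j] = 0.
  move=> xF g0 v0 vE.
  (* The quotient by [gf i0 x] cancels the pivot factor of the minor, so that shifting the
     coefficient offsets exactly [eps * x i ^+ D3]; the pivot coefficient itself is left alone. *)
  pose w k : R := if insub k is Some i then (if i == i0 then 0 else x i ^+ D3 / gf i0 x) else 0.
  pose vm m : nat -> R := vset n.+1 (vcons (v 0 + m.+1%:R^-1 * x i0 ^+ d.+2)
     (fun i => v i.+1 - m.+1%:R^-1 * w i)) m.+1%:R^-1.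
  apply: (hQ vm v (fun=> x j)).
  - by move=> m; rewrite /vm /vset eqxx invr_eq0 pnatr_eq0.
  - by apply: eq_tends (@tends_harmonic R) => m; rewrite /vm /vset eqxx.
  - move=> i ik; rewrite /vm /vset ltn_eqF //=.
    have lim (a b : R) : tends (fun m => a + m.+1%:R^-1 * b) a.
      rewrite -[a in X in tends _ X]addr0 -(mul0r b).
      by apply: tends_D (tends_cst _) (tends_M (@tends_harmonic R) (tends_cst _)).
    case: i ik => [|i] ik /=; first exact: lim.
    by apply: eq_tends (lim (v i.+1) (- w i)) => m; rewrite mulrN.
  - exact: tends_cst.
  move=> m; apply: hP.
  have e1 : vm m n.+1 = m.+1%:R^-1 by rewrite /vm /vset eqxx.
  have e2 (i : 'I_n) : vm m i.+1 = v i.+1 - m.+1%:R^-1 * (if i == i0 then 0 else x i ^+ D3 / gf i0 x).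
    by rewrite /vm /vset eqSS ltn_eqF //= /w valK.
  split=> //; first by rewrite e1 -v0.
  move=> i Fi ni; rewrite e1 !e2 eqxx (negPf ni) mulr0 subr0.
  have -> : gh i x + (v i.+1 - m.+1%:R^-1 * (x i ^+ D3 / gf i0 x)) =
     mu * gf i x - m.+1%:R^-1 * (x i ^+ D3 / gf i0 x) by rewrite -(vE i Fi); ring.
  rewrite (vE i0 Fi0); field.
  by rewrite g0 addrC natr1 pnatr_eq0.
move=> v x mu xF xB v0 vE.
(* On the line through [x] and [x1] the pivot derivative is a nonzero polynomial, so it is nonzero
   at points of the segment arbitrarily close to [x]. *)
have [p pE] := pol_line x x1 (gfp i0).
have p0 : p != 0.
  apply: contraNneq gx1 => e; have := pE 1; rewrite e horner0.
  by under [X in gf i0 X]funext do rewrite mul1r addrC subrK; move=> ->.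
have [s hs] := choice (fun M => ex2_ind (fun k a b => ex_intro (fun k => _ /\ _) k (conj a b)) (nonroot_harmonic M p0)).
pose z m (i : 'I_n) := x i + (s m).+1%:R^-1 * (x1 i - x i).
have zF m : on_face F (z m) by exact: on_face_segment.
have zB m : inB (z m).
  by apply: inB_segment => //; rewrite invr_ge0 ler0n /= invf_le1 ?ltr0n // ler1n.
have zx i : tends (fun m => z m i) (x i).
  rewrite -[x i]addr0 -(mul0r (x1 i - x i)).
  apply: tends_D (tends_cst _) (tends_M _ (tends_cst _)).
  exact: (@tends_sub _ (fun k => k.+1%:R^-1 : R) _ s (fun m => (hs m).1) (@tends_harmonic R)).
(* The coefficients are recomputed so that [z m] satisfies the multiplier equations with the same
   [mu]; on fixed coordinates they keep their value. *)
pose c (z : 'I_n -> R) (i : 'I_n) := if F i is None then mu * gf i z - gh i z else v i.+1.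
pose vz m : nat -> R := vcons (f (z m)) (ext (c (z m))).
rewrite -tev_vset.
apply: (@tends_unique R (fun m => tev n.+2 (vset n.+1 (vz m) (z m j)) Q)); last first.
  apply: eq_tends (tends_cst 0) => m; rewrite tev_vset (@regular _ _ mu) //.
    by rewrite /z pE; case: (hs m).
  by move=> i Fi; rewrite /vz /= extE /c Fi addrC subrK.
apply: tends_tev => i; rewrite /vset; case: eqP => [_ _|ni]; first exact: zx.
rewrite ltnS leq_eqVlt => /orP[/eqP //|].
have cont q D' : pol D' q -> tends (fun m => q (z m)) (q x).
  by move=> qp; exact: (lipB_tends (pol_lipB qp)).
case: i ni => [|i] _ /=; first by move=> _; rewrite v0; apply: cont fp.
rewrite ltnS => ik; have -> : i = Ordinal ik by [].
have -> : v (Ordinal ik).+1 = c x (Ordinal ik).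
  by rewrite /c; case Fi : (F _) => //; rewrite -(vE _ Fi) addrAC subrr add0r.
apply: (@eq_tends _ (fun m => c (z m) (Ordinal ik))) => [m|]; first by rewrite extE.
rewrite /c; case: (F _) => [b|]; first exact: tends_cst.
apply: tends_D; first by apply: tends_M; [exact: tends_cst|apply: cont (gfp _)].
apply: (@eq_tends _ (fun m => -1 * gh (Ordinal ik) (z m))) => [m|]; first by rewrite mulN1r.
by rewrite -[X in tends _ X]mulN1r; apply: tends_M; [exact: tends_cst|apply: cont (ghp _)].
Qed.

(** * Critical points of the penalised problem *)

Lemma lipB_bounded (R : realFieldType) n (f : ('I_n -> R) -> R) : lipB f ->
  exists2 M, 0 <= M & forall x, inB x -> `|f x| <= M.
Proof.
move=> [M M0 hM].
have B0 : inB (fun _ : 'I_n => 0 : R) by move=> i; rewrite normr0.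
exists (M * 2 + `|f (fun=> 0)|); first by rewrite addr_ge0 ?mulr_ge0.
move=> x xB; have -> : f x = (f x - f (fun=> 0)) + f (fun=> 0) by ring.
apply: le_trans (ler_normD _ _) _; rewrite lerD2r.
exact: hM B0 xB (ler0n _ _) (near2 B0 xB).
Qed.

Lemma eq_taylor (R : realFieldType) n (f f' : ('I_n -> R) -> R) (g g' : 'I_n -> ('I_n -> R) -> R) :
  f =1 f' -> (forall i x, g i x = g' i x) -> taylor f g -> taylor f' g'.
Proof.
move=> ef eg [M M0 hM]; exists M => // x y e xB yB e2 xy.
by rewrite -!ef (eq_bigr (fun i => g i x * (y i - x i))) => [|i _]; [exact: hM|rewrite eg].
Qed.

Lemma taylor_const (R : realFieldType) n (a : R) : taylor (fun _ : 'I_n -> R => a) (fun _ _ => 0).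
Proof.
by exists 0 => // x y e _ _ _ _; rewrite subrr sub0r normrN big1 ?normr0 ?mul0r // => i _; rewrite mul0r.
Qed.

Lemma taylor_coord (R : realFieldType) n (j : 'I_n) :
  taylor (fun x : 'I_n -> R => x j) (fun i _ => (i == j)%:R).
Proof.
exists 0 => // x y e _ _ _ _.
rewrite (bigD1 j) //= eqxx mul1r big1 ?addr0 ?subrr ?normr0 ?mul0r // => i /negPf ->.
by rewrite mul0r.
Qed.

Lemma taylor_D (R : realFieldType) n (f1 f2 : ('I_n -> R) -> R) g1 g2 :
  taylor f1 g1 -> taylor f2 g2 -> taylor (fun x => f1 x + f2 x) (fun i x => g1 i x + g2 i x).
Proof.
move=> [M1 M10 h1] [M2 M20 h2]; exists (M1 + M2); first exact: addr_ge0.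
move=> x y e xB yB e2 xy; have a := h1 _ _ _ xB yB e2 xy; have b := h2 _ _ _ xB yB e2 xy.
rewrite (eq_bigr (fun i => g1 i x * (y i - x i) + g2 i x * (y i - x i))); last by move=> i _; ring.
rewrite big_split /=; set S1 := \sum_i _ in a *; set S2 := \sum_i _ in b *.
have -> : f1 y + f2 y - (f1 x + f2 x) - (S1 + S2) = (f1 y - f1 x - S1) + (f2 y - f2 x - S2) by ring.
by apply: le_trans (ler_normD _ _) _; rewrite mulrDl lerD.
Qed.

Lemma taylor_M (R : realFieldType) n (f1 f2 : ('I_n -> R) -> R) g1 g2 :
  lipB f1 -> lipB f2 -> taylor f1 g1 -> taylor f2 g2 ->
  taylor (fun x => f1 x * f2 x) (fun i x => f1 x * g2 i x + f2 x * g1 i x).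
Proof.
move=> l1 l2 [K1 K10 h1] [K2 K20 h2].
have [N1 N10 b1] := lipB_bounded l1; have [N2 N20 b2] := lipB_bounded l2.
case: l1 l2 => [L1 L10 l1] [L2 L20 l2].
exists (N1 * K2 + N2 * K1 + L1 * L2); first by rewrite !addr_ge0 ?mulr_ge0.
move=> x y e xB yB e2 xy; have a := h1 _ _ _ xB yB e2 xy; have b := h2 _ _ _ xB yB e2 xy.
have e0 : 0 <= e by case/andP: e2.
rewrite (eq_bigr (fun i => f1 x * (g2 i x * (y i - x i)) + f2 x * (g1 i x * (y i - x i)))); last by move=> i _; ring.
rewrite big_split -!mulr_sumr /=; set S1 := \sum_i _ in a *; set S2 := \sum_i _ in b *.
have -> : f1 y * f2 y - f1 x * f2 x - (f1 x * S2 + f2 x * S1) =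
   f1 x * (f2 y - f2 x - S2) + f2 x * (f1 y - f1 x - S1) + (f1 y - f1 x) * (f2 y - f2 x) by ring.
apply: le_trans (ler_normD _ _) _; rewrite [_ * e ^+ 2]mulrDl; apply: lerD.
  apply: le_trans (ler_normD _ _) _; rewrite mulrDl -!mulrA !normrM; apply: lerD; apply: ler_pM => //; [exact: b1|exact: b2].
rewrite normrM; have -> : L1 * L2 * e ^+ 2 = (L1 * e) * (L2 * e) by ring.
by apply: ler_pM => //; [exact: l1|exact: l2].
Qed.

Lemma taylor_Z (R : realFieldType) n a (f : ('I_n -> R) -> R) g :
  lipB f -> taylor f g -> taylor (fun x => a * f x) (fun i x => a * g i x).
Proof.
move=> fl fT; apply: eq_taylor (taylor_M (lipB_const n a) fl (taylor_const n a) fT) => // i x.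
by rewrite mulr0 addr0.
Qed.

Lemma taylor_sum (R : realFieldType) n (I : Type) (s : seq I) (f : I -> ('I_n -> R) -> R) g :
  (forall j, taylor (f j) (g j)) ->
  taylor (fun x => \sum_(j <- s) f j x) (fun i x => \sum_(j <- s) g j i x).
Proof.
move=> h; elim: s => [|j s IH].
  by apply: eq_taylor (taylor_const n 0) => [x|i x]; rewrite big_nil.
by apply: eq_taylor (taylor_D (h j) IH) => [x|i x]; rewrite big_cons.
Qed.

Lemma stationary (R : realFieldType) n (f : ('I_n -> R) -> R) g x i :
  taylor f g -> minimizer f x -> `|x i| < 1 -> g i x = 0.
Proof.
move=> [M M0 hM] [xB xmin] xi.
pose y th (j : 'I_n) := x j + (if j == i then th else 0).
have d0 : 0 < 1 - `|x i| by rewrite subr_gt0.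
have d1 : 1 - `|x i| <= 1 by rewrite gerBl.
have main th : `|th| <= 1 - `|x i| -> 0 <= g i x * th + M * th ^+ 2.
  move=> thd.
  have yB : inB (y th).
    move=> j; rewrite /y; case: eqP => [->|_]; last by rewrite addr0; exact: xB.
    by apply: le_trans (ler_normD _ _) _; lra.
  have ny : near_by `|th| x (y th).
    by move=> j; rewrite /y addrC addKr; case: eqP; rewrite ?normr0.
  have := hM x (y th) `|th| xB yB _ ny; rewrite normr_ge0 (le_trans thd); last by lra.
  rewrite (bigD1 i) //= big1 ?addr0; last by move=> j /negPf ji; rewrite /y ji addr0 subrr mulr0.
  rewrite /y eqxx [x i + th]addrC addrK => /(_ isT); rewrite real_normK ?num_real //.
  have := xmin _ yB; rewrite ler_norml; move: (f _) (f x) => a b ab /andP[_ h2].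
  by lra.
apply/eqP; apply: contraTT isT => gi.
have gp : 0 < `|g i x| by rewrite normr_gt0.
pose d := Num.min (1 - `|x i|) (`|g i x| / (2 * (M + 1))).
have M1 : 0 < 2 * (M + 1) by lra.
have dp : 0 < d by rewrite lt_min d0 divr_gt0.
have dM : d * (2 * (M + 1)) <= `|g i x| by rewrite -ler_pdivlMr // ge_min lexx orbT.
have ds : d <= 1 - `|x i| by rewrite ge_min lexx.
have h1 := main d; have h2 := main (- d).
rewrite normrN in h2; rewrite [`|d|]gtr0_norm // in h1 h2; have {}h1 := h1 ds; have {}h2 := h2 ds.
have : d * `|g i x| <= M * d ^+ 2.
  have [g0|g0] := leP 0 (g i x); [rewrite ger0_norm //|rewrite ltr0_norm //]; nra.
by move=> h3; nra.
Qed.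

Definition face_of (R : realFieldType) n (x : 'I_n -> R) : face n :=
  [ffun i => if x i == 1 then Some false else if x i == -1 then Some true else None].

Lemma face_ofP (R : realFieldType) n (x : 'I_n -> R) : on_face (face_of x) x.
Proof.
move=> i b; rewrite ffunE; case: eqP => [-> [<-]|_]; first by rewrite expr0.
by case: eqP => [-> [<-]|//]; rewrite expr1.
Qed.

Lemma face_of_free (R : realFieldType) n (x : 'I_n -> R) i :
  inB x -> face_of x i = None -> `|x i| < 1.
Proof.
move=> xB; rewrite ffunE; case: eqP => // n1; case: eqP => // n2 _.
rewrite lt_neqAle xB andbT; apply/negP => /eqP.
by have [h|h] := leP 0 (x i); [rewrite ger0_norm|rewrite ltr0_norm // => /eqP; rewrite eqr_oppLR => /eqP].
Qed.

(** The weight [t ^+ 2] lets one bound of the form [eta ^+ 2 * t ^+ 2] on the minimum control both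
    the gradient, by [eta], and the error in the level, by [eta * t]. *)
Definition penalty (R : pzRingType) n (f h : ('I_n -> R) -> R) (t : R) : ('I_n -> R) -> R :=
  fun x => t ^+ 2 * h x + (f x - t) ^+ 2.

Lemma pol_penalty (R : idomainType) n D D' (f h : ('I_n -> R) -> R) t :
  pol D f -> pol D' h -> pol (D' + (D + D)) (penalty f h t).
Proof.
move=> fp hp; apply: pfunD.
  by apply: pfunW (polZ (t ^+ 2) hp); exact: leq_addr.
have fB : pol D (fun x => f x - t).
  by apply: pfunB => //; apply: pfunW (pol_const n t).
apply: pfunW (eq_pfun _ (pfunM fB fB)); first exact: leq_addl.
by move=> v x; rewrite expr2.
Qed.

(** With [k = t ^+ 2], stationarity divided by [t ^+ 2] reads [gh + c = mu * gf], where [t] is left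
    only inside [mu]; the relation can then depend on the value of [f] and on [c] alone. *)
Definition scaled_coord (R : pzRingType) n (k : R) (i : nat) : ('I_n -> R) -> R :=
  fun x => k * ext x i.

Lemma lipB_scaled (R : realFieldType) n (k : R) i : lipB (@scaled_coord R n k i).
Proof.
apply: lipB_Z; rewrite /ext; case: insub => [j|]; first exact: lipB_coord.
exact: lipB_const.
Qed.

Lemma taylor_perturbed_penalty (R : realFieldType) n D D' (f h : ('I_n -> R) -> R) gf gh t k c :
  pol D f -> pol D' h -> taylor f gf -> taylor h gh ->
  taylor (linear_pert n c (@scaled_coord R n k) (penalty f h t))
    (fun i x => t ^+ 2 * gh i x + 2 * (f x - t) * gf i x + k * c i).
Proof.
move=> fp hp fT hT.
have fl := pol_lipB fp; have hl := pol_lipB hp.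
have ftT := taylor_D fT (taylor_const n (- t)).
have ftl : lipB (fun x => f x + - t) by apply: lipB_D => //; exact: lipB_const.
have pT := taylor_D (taylor_Z (t ^+ 2) hl hT) (taylor_M ftl ftl ftT ftT).
have sT : taylor (fun x : 'I_n -> R => \sum_(j < n) (k * c j) * x j) (fun i _ => k * c i).
  have := @taylor_sum R n _ (index_enum 'I_n) (fun j x => (k * c j) * x j) _
     (fun j => taylor_Z (k * c j) (lipB_coord R j) (taylor_coord R j)).
  apply: eq_taylor => // i x; rewrite (bigD1 i) //= eqxx mulr1 big1 ?addr0 // => j ji.
  by rewrite eq_sym (negPf ji) mulr0.
apply: eq_taylor (taylor_D pT sT) => [x|i x]; last by ring.
rewrite /linear_pert /penalty expr2; congr (_ + _); apply: eq_bigr => j _.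
by rewrite /scaled_coord extE; ring.
Qed.

(* At a critical point of the penalised problem [grad h + c] is a multiple of [grad f]
   along the face of the box that contains it. *)
Lemma talweg (R : realType) n d (f h : ('I_n -> R) -> R) gf gh :
  pol d.+2 f -> (forall i, pol d.+1 (gf i)) -> taylor f gf ->
  pol (2 * d).+2 h -> (forall i, pol (2 * d).+1 (gh i)) -> taylor h gh ->
  exists2 Qs : seq {poly {poly R}},
    forall Q, Q \in Qs -> Q != 0 /\ (size Q <= (d.+2 * (3 * d + 3) ^ n.-1).+1)%N &
  forall t, 0 < t -> exists2 x, minimizer (penalty f h t) x &
    forall j : 'I_n, exists2 Q, Q \in Qs & (map_poly (horner_eval (f x)) Q).[x j] = 0.
Proof.
move=> fp gfp fT hp ghp hT.
have /fin_all_exists [P hP] := fun F => fin_all_exists (fun j => 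
  ex2_ind (fun P a b => ex_intro (fun P => _ /\ _) P (conj a b))
    (@relation_constrained R n F d f gf gh fp gfp fT ghp j)).
have [F j|Q hQ1 hQ2] := @selection R n (face n) 'I_n n P; first by case: (hP F j) => -[].
exists [seq Q p.1 p.2 | p : face n * 'I_n] => [q /mapP[[F j] _ ->]|t t0].
  have [q0 qs] := hQ1 F j; split=> //; apply: leq_trans qs _.
  by case: (hP F j) => -[].
have [|||||x xmin hx] := hQ2 (penalty f h t) f (fun j x => x j) (@scaled_coord R n (t ^+ 2)).
- exact: pol_lipB (pol_penalty t fp hp).
- exact: pol_lipB fp.
- by move=> j; exact: lipB_coord.
- exact: lipB_scaled.
- move=> c.
  have [|x xB xmin] := @min_attained R n (linear_pert n c (@scaled_coord R n (t ^+ 2)) (penalty f h t)).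
    by apply: lipB_pert; [exact: pol_lipB (pol_penalty t fp hp)|exact: lipB_scaled].
  exists x; first by split.
  move=> j; exists (face_of x); case: (hP (face_of x) j) => _.
  apply; [exact: face_ofP|exact: xB|by []|].
  move=> i Fi.
  have := stationary (taylor_perturbed_penalty t (t ^+ 2) c fp hp fT hT) (conj xB xmin) (face_of_free xB Fi).
  have t20 : t ^+ 2 != 0 by rewrite expf_neq0 // gt_eqF.
  move=> /eqP e; instantiate (1 := - (2 * (f x - t)) / t ^+ 2) => /=.
  apply: (mulfI t20); apply/eqP; rewrite -subr_eq0 -(eqP e); apply/eqP; field.
  by rewrite gt_eqF.
exists x => // j; have [F hF] := hx j; exists (Q F j) => //.
by apply/mapP; exists (F, j); rewrite ?mem_enum.
Qed.

(** Here parameter 0 is the level [t]. The relation serves only to control the growth of the minimal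
    value, so no degree bound is asked of it and the stationarity equations can be used directly. *)
Lemma value_relation (R : realType) n (i0 : 'I_n) D D' De (f h : ('I_n -> R) -> R) gf gh :
  pol D f -> (forall i, pol De (gf i)) -> taylor f gf ->
  pol D' h -> (forall i, pol De (gh i)) -> taylor h gh ->
  exists2 S : {poly {poly R}}, S != 0 &
  forall t, exists2 x, minimizer (penalty f h t) x &
    (map_poly (horner_eval t) S).[penalty f h t x] = 0.
Proof.
move=> fp gfp fT hp ghp hT.
pose T K := tvar R K 0.
pose e i (v : nat -> R) (x : 'I_n -> R) := v 0 ^+ 2 * gh i x + 2 * (f x - v 0) * gf i x.
have ep i : @pfun R n n.+2 (De + (D + De)) (e i).
  have T0 (v : nat -> R) : tev n.+2 v (T _) = v 0 by rewrite tev_var.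
  apply: pfunD.
    apply: pfunW (eq_pfun _ (pfunZ (T n.+2 ^+ 2) (pol_pfun _ (ghp i)))); first exact: leq_addr.
    by move=> v x; rewrite rmorphXn T0.
  apply: pfunW (eq_pfun _ (pfunM (pfunZ (tconst n.+2 2) (pfunB (pol_pfun n.+2 fp) (pfunW (leq0n _) (pfun_const n (T n.+2))))) (pol_pfun n.+2 (gfp i)))).
    exact: leq_addl.
  by move=> v x; rewrite T0 tev_const.
pose g (v : nat -> R) (x : 'I_n -> R) := penalty f h (v 0) x.
have gp : exists D0, @pfun R n n.+2 D0 g.
  have T0 (v : nat -> R) : tev n.+2 v (T _) = v 0 by rewrite tev_var.
  have fB := pfunB (pol_pfun n.+2 fp) (pfunW (leq0n _) (pfun_const n (T n.+2))).
  exists (D' + (D + D))%N; apply: pfunD.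
    apply: pfunW (eq_pfun _ (pfunZ (T n.+2 ^+ 2) (pol_pfun _ hp))); first exact: leq_addr.
    by move=> v x; rewrite rmorphXn T0.
  apply: pfunW (eq_pfun _ (pfunM fB fB)); first exact: leq_addl.
  by move=> v x; rewrite T0 expr2.
have [D0 {}gp] := gp.
have /fin_all_exists [P hP] := fun F =>
  ex2_ind (fun P a b => ex_intro (fun P => _ /\ _) P (conj a b))
    (@relation_free R n i0 F _ _ e g ep gp
      (fun i v w x vw => ltac:(by rewrite /e vw)) (fun v w x vw => ltac:(by rewrite /g vw))).
have [F j|Q hQ1 hQ2] := @selection R n (face n) unit n (fun F _ => P F); first by case: (hP F).
exists (\prod_F Q F tt) => [|t].
  by apply/prodf_neq0 => F _; case: (hQ1 F tt).
have [|||||x xmin hx] := hQ2 (penalty f h t) (fun=> t) (fun _ => penalty f h t) (@scaled_coord R n 1).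
- exact: pol_lipB (pol_penalty t fp hp).
- exact: lipB_const.
- by move=> j; exact: pol_lipB (pol_penalty t fp hp).
- exact: lipB_scaled.
- move=> c; have [|x xB xmin] := @min_attained R n (linear_pert n c (@scaled_coord R n 1) (penalty f h t)).
    by apply: lipB_pert; [exact: pol_lipB (pol_penalty t fp hp)|exact: lipB_scaled].
  exists x; first by split.
  move=> j; exists (face_of x); case: (hP (face_of x)) => _ /(_ (vcons t c) x (@face_ofP R n x)).
  apply=> i Fi.
  have := stationary (taylor_perturbed_penalty t 1 c fp hp fT hT) (conj xB xmin) (face_of_free xB Fi).
  by rewrite mul1r.
exists x => //; have [F hF] := hx tt.
rewrite rmorph_prod horner_prod; apply/eqP/prodf_eq0; exists F => //; exact/eqP.
Qed.

(** * Growth of algebraic functions of one variable *)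

Notation ev G t X := ((map_poly (horner_eval t) G).[X]).

Lemma exists_min_pos (R : realFieldType) (I : finType) (e : I -> R) :
  (forall i, 0 < e i) -> exists2 d, 0 < d & forall i, d <= e i.
Proof.
move=> e0; have s0 : 0 <= \sum_i (e i)^-1 by apply: sumr_ge0 => i _; rewrite invr_ge0 ltW.
exists (1 + \sum_i (e i)^-1)^-1; first by rewrite invr_gt0 ltr_pwDl.
move=> i; rewrite invf_ple ?posrE ?ltr_pwDl //.
rewrite (bigD1 i) //= addrCA lerDl addr_ge0 // sumr_ge0 // => j _.
by rewrite invr_ge0 ltW.
Qed.

Lemma poly_lip (R : realFieldType) (p : {poly R}) M : 0 <= M ->
  exists2 C, 0 <= C & forall a b, `|a| <= M -> `|b| <= M -> `|p.[a] - p.[b]| <= C * `|a - b|.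
Proof.
move=> M0; elim/poly_ind: p => [|p c [C C0 hC]].
  by exists 0 => // a b _ _; rewrite !horner0 subrr normr0 mul0r.
exists (C * M + (`|p.[0]| + C * M)); first by rewrite !addr_ge0 ?mulr_ge0.
move=> a b aM bM; rewrite !hornerMXaddC.
have -> : p.[a] * a + c - (p.[b] * b + c) = (p.[a] - p.[b]) * a + p.[b] * (a - b) by ring.
apply: le_trans (ler_normD _ _) _; rewrite !normrM mulrDl; apply: lerD.
  by rewrite mulrAC; apply: ler_pM => //; exact: hC.
rewrite ler_wpM2r //; have -> : p.[b] = p.[0] + (p.[b] - p.[0]) by ring.
apply: le_trans (ler_normD _ _) _; rewrite lerD2l.
apply: le_trans (hC _ _ bM _) _; first by rewrite normr0.
by rewrite subr0 ler_wpM2l.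
Qed.

Lemma evMXaddC (R : comNzRingType) (G : {poly {poly R}}) c t X :
  ev (G * 'X + c%:P) t X = ev G t X * X + c.[t].
Proof. by rewrite rmorphD rmorphM /= map_polyX map_polyC hornerMXaddC. Qed.

Lemma ev_lip (R : realFieldType) (G : {poly {poly R}}) M : 0 <= M ->
  exists2 C, 0 <= C & forall t t' X, `|t| <= 1 -> `|t'| <= 1 -> `|X| <= M ->
    `|ev G t X - ev G t' X| <= C * `|t - t'|.
Proof.
move=> M0; elim/poly_ind: G => [|G c [C C0 hC]].
  by exists 0 => // t t' X _ _ _; rewrite !rmorph0 !horner0 subrr normr0 mul0r.
have [C' C'0 hC'] := poly_lip c ler01.
exists (C * M + C'); first by rewrite addr_ge0 ?mulr_ge0.
move=> t t' X t1 t1' XM; rewrite !evMXaddC.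
have -> : ev G t X * X + c.[t] - (ev G t' X * X + c.[t']) =
  (ev G t X - ev G t' X) * X + (c.[t] - c.[t']) by ring.
apply: le_trans (ler_normD _ _) _; rewrite normrM mulrDl; apply: lerD; last exact: hC'.
by rewrite mulrAC; apply: ler_pM => //; exact: hC.
Qed.

Lemma poly_near0 (R : realFieldType) (p : {poly R}) : p.[0] != 0 ->
  exists2 e, 0 < e <= 1 & forall t, `|t| <= e -> `|p.[0]| / 2 <= `|p.[t]| <= 2 * `|p.[0]|.
Proof.
move=> p0; have [C C0 hC] := poly_lip p ler01.
have n0 : 0 < `|p.[0]| by rewrite normr_gt0.
have C1 : 0 < 2 * (C + 1) by lra.
pose e := Num.min 1 (`|p.[0]| / (2 * (C + 1))).
exists e; first by rewrite lt_min ltr01 divr_gt0 //= ge_min lexx.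
move=> t te; have t1 : `|t| <= 1 by apply: le_trans te _; rewrite ge_min lexx.
have := hC t 0 t1; rewrite normr0 subr0 => /(_ ler01) h.
have : `|t| * (2 * (C + 1)) <= `|p.[0]|.
  by rewrite -ler_pdivlMr //; apply: le_trans te _; rewrite ge_min lexx orbT.
have h0 := normr_ge0 t.
have h1 : `|p.[t]| <= `|p.[t] - p.[0]| + `|p.[0]|.
  by have {1}-> : p.[t] = (p.[t] - p.[0]) + p.[0] by [ring]; exact: ler_normD.
have h2 : `|p.[0]| <= `|p.[t]| + `|p.[t] - p.[0]|.
  by have {1}-> : p.[0] = p.[t] - (p.[t] - p.[0]) by [ring]; exact: ler_normB.
move=> h3; apply/andP; split; nra.
Qed.

(** Write [r] as [t ^ k * q] with [q] nonzero at 0. The factor [2 ^+ k] comes from [t1 <= 2 * t2],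
    the factor 4 from [q] staying within a factor 2 of its value at 0. *)
Lemma poly_doubling (R : realFieldType) (r : {poly R}) : r != 0 ->
  exists c, exists2 e, 1 <= c /\ 0 < e <= 1 & forall t0 t1 t2, 0 < t0 < e ->
    t0 / 2 <= t1 <= t0 -> t0 / 2 <= t2 <= t0 -> r.[t1] != 0 /\ `|r.[t1]| <= c * `|r.[t2]|.
Proof.
move=> r0; have [k [q]] := multiplicity_XsubC r 0; rewrite r0 /= => q0 ->.
rewrite rootE in q0; have [e e0 he] := poly_near0 q0.
exists (2 ^+ k * 4); exists e; first by split=> //; rewrite mulr_ege1 ?ler1n // exprn_ege1 // ler1n.
move=> t0 t1 t2 /andP[t00 t0e] t1i t2i.
have e1 : e <= 1 by case/andP: e0.
have n0 : 0 < `|q.[0]| by rewrite normr_gt0.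
have a1 : 0 < t1 by case/andP: t1i; lra.
have a2 : 0 < t2 by case/andP: t2i; lra.
have /andP[b1 b2] : `|q.[0]| / 2 <= `|q.[t1]| <= 2 * `|q.[0]| by apply: he; rewrite gtr0_norm //; case/andP: t1i; lra.
have /andP[b3 b4] : `|q.[0]| / 2 <= `|q.[t2]| <= 2 * `|q.[0]| by apply: he; rewrite gtr0_norm //; case/andP: t2i; lra.
rewrite !(hornerM, horner_exp, hornerXsubC) !subr0; split.
  have q1 : q.[t1] != 0 by rewrite -normr_gt0; lra.
  by apply: mulf_neq0 => //; apply: expf_neq0; rewrite gt_eqF.
rewrite !normrM !normrX !(gtr0_norm a1) !(gtr0_norm a2).
have -> : 2 ^+ k * 4 * (`|q.[t2]| * t2 ^+ k) = (4 * `|q.[t2]|) * (2 * t2) ^+ k.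
  by rewrite exprMn; ring.
apply: ler_pM => //; first by rewrite exprn_ge0 // ltW.
  by lra.
by rewrite lerXn2r // ?nnegrE; [lra|lra|case/andP: t1i; case/andP: t2i; lra].
Qed.

(** The largest term [b] is cancelled by the others, so the second largest [b'] has at least the
    fraction [1 / #|I|] of its size. *)
Lemma balanced_terms (R : realFieldType) (I : finType) (a : I -> R) (i0 : I) :
  \sum_i a i = 0 -> a i0 != 0 -> exists b, exists b',
    [/\ b != b', a b != 0, a b' != 0, `|a b'| <= `|a b| & `|a b| <= #|I|%:R * `|a b'|].
Proof.
move=> s0 ai0.
have [b _ hb] := @Order.TotalTheory.arg_maxP _ R I i0 predT (fun i => `|a i|) isT.
have ab : a b != 0 by rewrite -normr_gt0; apply: lt_le_trans (hb i0 isT); rewrite normr_gt0.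
have sb : a b = - \sum_(i | i != b) a i by move: s0; rewrite (bigD1 b) //= => /eqP; rewrite addr_eq0 => /eqP.
have [i1 i1b ai1] : exists2 i, i != b & a i != 0.
  apply: contrapT => h; move: ab; rewrite sb big1 ?oppr0 ?eqxx // => i ib.
  by apply: contrapT => /eqP h1; apply: h; exists i.
have [b' b'b hb'] := @Order.TotalTheory.arg_maxP _ R I i1 (fun i => i != b) (fun i => `|a i|) i1b.
exists b, b'; split=> //; first by rewrite eq_sym.
- by rewrite -normr_gt0; apply: lt_le_trans (hb' i1 i1b); rewrite normr_gt0.
- exact: hb.
rewrite sb normrN; apply: le_trans (ler_norm_sum _ _ _) _.
apply: (@le_trans _ _ (\sum_(i | i != b) `|a b'|)); first by apply: ler_sum => i; exact: hb'.
rewrite sumr_const -[_ *+ _]mulr_natl ler_wpM2r // ler_nat; exact: max_card.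
Qed.

(** The balance fixes a power of [y] and the same power of [z] through comparable coefficients, so
    these powers differ by a factor at most [L * c ^+ 2]. Adding 1 avoids the root: every positive
    power of [L * c ^+ 2 + 1] exceeds [L * c ^+ 2]. *)
Lemma balanced_ratio (R : realFieldType) (c L B1 B1' B2 B2' y z : R) (b b' : nat) :
  (b != b')%N -> 0 <= c -> 1 <= L -> 0 < B1 -> 0 < B1' -> 0 < B2 -> 0 < B2' -> 0 < y -> 0 < z ->
  B1 <= c * B2 -> B1' <= c * B2' -> B2 <= c * B1 -> B2' <= c * B1' ->
  B1' * y ^+ b' <= B1 * y ^+ b -> B1 * y ^+ b <= L * (B1' * y ^+ b') ->
  B2' * z ^+ b' <= B2 * z ^+ b -> B2 * z ^+ b <= L * (B2' * z ^+ b') ->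
  y < (L * c ^+ 2 + 1) * z.
Proof.
move=> bb c0 L1 p1 p1' p2 p2' y0 z0 h1 h1' h2 h2' u1 u2 w1 w2.
have [k k0 hk] : exists2 k, (0 < k)%N & y ^+ k <= (L * c ^+ 2) * z ^+ k.
  have yb := exprn_gt0 b y0; have yb' := exprn_gt0 b' y0.
  have zb := exprn_gt0 b z0; have zb' := exprn_gt0 b' z0.
  case: (ltngtP b b') bb => // lt _.
    exists (b' - b)%N; first by rewrite subn_gt0.
    have eb : b' = (b' - b + b)%N by rewrite subnK // ltnW.
    move: (b' - b)%N eb => k eb.
    have yk := exprn_gt0 k y0; have zk := exprn_gt0 k z0.
    rewrite eb !exprD !mulrA !ler_pM2r // in u1 w2.
    rewrite -(ler_pM2l p1'); apply: le_trans u1 _; apply: le_trans h1 _.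
    apply: (@le_trans _ _ (c * (L * B2' * z ^+ k))); first exact: ler_wpM2l.
    have -> : B1' * (L * c ^+ 2 * z ^+ k) = c * (L * (c * B1') * z ^+ k) by ring.
    by rewrite ler_wpM2l // ler_pM2r // ler_pM2l //; lra.
  exists (b - b')%N; first by rewrite subn_gt0.
  have eb : b = (b - b' + b')%N by rewrite subnK // ltnW.
  move: (b - b')%N eb => k eb.
  have yk := exprn_gt0 k y0; have zk := exprn_gt0 k z0.
  rewrite eb !exprD !mulrA !ler_pM2r // in u2 w1.
  rewrite -(ler_pM2l p1); apply: le_trans u2 _.
  apply: (@le_trans _ _ (L * (c * B2'))); first by rewrite ler_wpM2l //; lra.
  apply: (@le_trans _ _ (L * (c * (B2 * z ^+ k)))).
    by rewrite ler_wpM2l ?ler_wpM2l //; lra.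
  have -> : B1 * (L * c ^+ 2 * z ^+ k) = L * (c * ((c * B1) * z ^+ k)) by ring.
  by rewrite ler_wpM2l ?ler_wpM2l ?ler_wpM2r //; [lra|exact: ltW].
rewrite ltNge; apply/negP => hy.
have l0 : 0 <= L * c ^+ 2 by rewrite mulr_ge0 ?exprn_ge0 //; lra.
have : ((L * c ^+ 2 + 1) * z) ^+ k <= y ^+ k.
  by rewrite lerXn2r // nnegrE ?ltW // mulr_gt0 //; lra.
move=> /le_trans /(_ hk); rewrite exprMn ler_pM2r ?exprn_gt0 // leNgt => /negP; apply.
case: k k0 {hk} => // k _; rewrite [X in _ < X]exprS.
apply: (@lt_le_trans _ _ (L * c ^+ 2 + 1)); first by rewrite ltrDl ltr01.
by rewrite ler_peMr ?exprn_ege1 ?lerDr // addr_ge0.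
Qed.

(* If [V] grew by a large factor on [[t, t0]], it would take there too many values at
   large mutual ratios, while each value of [V] balances two monomials of [S]. *)
Lemma algebraic_doubling (R : realType) (S : {poly {poly R}}) (V : R -> R) K :
  S != 0 -> 0 <= K -> (forall t, 0 <= t <= 1 -> 0 <= V t) ->
  (forall t t', 0 <= t <= 1 -> 0 <= t' <= 1 -> `|V t - V t'| <= K * `|t - t'|) ->
  (forall t, 0 < t <= 1 -> ev S t (V t) = 0) ->
  exists2 C, 0 <= C & exists2 e, 0 < e <= 1 & forall t0 t, 0 < t0 < e -> t0 / 2 <= t <= t0 ->
    V t <= C * V t0.
Proof.
move=> S0 K0 V0 Vl VS; set L := size S;
pose r (i : nat) : {poly R} := S`_i.
have L0 : (0 < L)%N by rewrite size_poly_gt0.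
have /fin_all_exists [c /fin_all_exists2 [e h1 h2]] : forall i : 'I_L, exists c : R, exists2 e : R, 1 <= c /\ 0 < e <= 1 &
    (r i) != 0 -> forall t0 t1 t2, 0 < t0 < e ->
    t0 / 2 <= t1 <= t0 -> t0 / 2 <= t2 <= t0 -> (r i).[t1] != 0 /\ `|(r i).[t1]| <= c * `|(r i).[t2]|.
  move=> i; have [e|ne] := eqVneq (r i) 0; first by exists 1, 1; rewrite ?ltr01 ?lexx.
  by have [c [e h1 h2]] := poly_doubling ne; exists c, e.
have [d d0 hd] := exists_min_pos (fun i => (andP (h1 i).2).1).
pose cc := \sum_i c i.
have ccE i : c i <= cc.
  by rewrite /cc (bigD1 i) //= lerDl sumr_ge0 // => j _; apply: le_trans (h1 j).1.
have cc0 : 0 <= cc by rewrite sumr_ge0 // => j _; apply: le_trans (h1 j).1.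
have dbl (i : 'I_L) t0 t1 t2 : (r i) != 0 -> 0 < t0 < d -> t0 / 2 <= t1 <= t0 -> t0 / 2 <= t2 <= t0 ->
    (r i).[t1] != 0 /\ `|(r i).[t1]| <= cc * `|(r i).[t2]|.
  move=> Si /andP[t00 t0d] t1i t2i.
  have [|a b] := h2 i Si t0 t1 t2 _ t1i t2i; first by rewrite t00 (lt_le_trans t0d).
  by split=> //; apply: le_trans b _; rewrite ler_wpM2r.
have Lp : (L.-1 < L)%N by rewrite ltn_predL.
have LR : 1 <= L%:R :> R by rewrite ler1n.
pose la := L%:R * cc ^+ 2 + 1.
have la1 : 1 <= la by rewrite lerDr mulr_ge0 ?exprn_ge0.
have la0 : 0 < la by apply: lt_le_trans la1.
pose E := #|{: 'I_L * 'I_L}|.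
have d1 : d <= 1 by apply: le_trans (hd (Ordinal L0)) _; case/andP: (h1 (Ordinal L0)).2.
exists (la ^+ E.+2); first by rewrite exprn_ge0 // ltW.
exists d; first by rewrite d0.
move=> t0 t t0d ti; rewrite leNgt; apply/negP => big.
case/andP: (t0d) => t00 t0d'; case/andP: (ti) => ti1 ti2.
have t01 : 0 <= t0 <= 1 by clear -t00 t0d' d1; lra.
have tp : 0 < t by clear -t00 ti1; lra.
have tl : t <= 1 by clear -ti2 t0d' d1; lra.
have t11 : 0 <= t <= 1 by rewrite tl ltW.
have Vt0 := V0 _ t01.
have Vt : 0 < V t by apply: le_lt_trans big; rewrite mulr_ge0 // exprn_ge0 // ltW.
(* These [E + 1] targets have mutual ratios at least [la] and lie between [V t0] and [V t], hence
   are values of [V]. There are only [E] pairs of monomials, so two targets balance the same pair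
   and their ratio is less than [la]. *)
pose y (i : 'I_E.+1) := V t / la ^+ i.+1.
have y0 i : 0 < y i by rewrite divr_gt0 // exprn_gt0.
have yi i : V t0 <= y i <= V t.
  rewrite /y; apply/andP; split.
    rewrite ler_pdivlMr ?exprn_gt0 // mulrC; apply: le_trans (ltW big).
    by rewrite ler_wpM2r // ler_weXn2l // ltnS ltnW.
  by rewrite ler_pdivrMr ?exprn_gt0 // ler_peMr ?exprn_ege1 // ltW.
have ex i : exists p : 'I_L * 'I_L, exists2 s, t0 / 2 <= s <= t0 &
    let a (j : 'I_L) := (r j).[s] * y i ^+ j in
    [/\ p.1 != p.2, a p.1 != 0, a p.2 != 0, `|a p.2| <= `|a p.1| & `|a p.1| <= L%:R * `|a p.2|].
  have [|||s /andP[s1 s2] hs] := @ivt_lipschitz R (fun t => - V t) K t t0 (- y i) K0.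
  - move=> u u' /andP[ua ub] /andP[ua' ub']; rewrite -opprD normrN -[- V u']opprK opprK; apply: Vl; clear -ua ub ua' ub' tp t01; lra.
  - exact: ti2.
  - by rewrite !lerN2 andbC; case/andP: (yi i) => -> ->.
  have Vs : V s = y i by apply: oppr_inj.
  have si : t0 / 2 <= s <= t0 by rewrite s2 (le_trans ti1 s1).
  have : ev S s (y i) = 0 by rewrite -Vs VS // (lt_le_trans tp s1) (le_trans s2) //; case/andP: t01.
  rewrite (@horner_coef_wide _ L); last exact: size_poly.
  under eq_bigr do rewrite coef_map /= /horner_eval -/(r _).
  move=> sum0.
  have [|b [b' hb]] := @balanced_terms R 'I_L (fun j => (r j).[s] * y i ^+ j) (Ordinal Lp) sum0.
    rewrite mulf_neq0 ?expf_neq0 ?(gt_eqF (y0 i)) //.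
    have := dbl (Ordinal Lp) t0 s s _ t0d si si.
    by case => //=; rewrite /r -/(lead_coef S) lead_coef_eq0.
  by exists (b, b'), s => //; move: hb; rewrite card_ord.
have [p hp] := fin_all_exists ex.
have : ~~ injectiveb p.
  apply/negP => /injectiveP /leq_card; rewrite card_ord -/E ltnn //.
move=> /injectivePn [i [j ij pij]].
wlog lt : i j ij pij / (i < j)%N.
  move=> W; have := ij; rewrite neq_ltn => /orP[lt|lt]; first exact: (W i j).
  by apply: (W j i) => //; rewrite eq_sym.
have [s1 s1i /= [q1 q2 q3 q4 q5]] := hp i.
have [s2 s2i /= ] := hp j; rewrite -pij => -[_ q2' q3' q4' q5'].
have nz (k : 'I_L) s u : (r k).[s] * u != 0 -> (r k) != 0.
  by apply: contraNneq => ->; rewrite horner0 mul0r.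
have [n1 n1'] := (nz _ _ _ q2, nz _ _ _ q3).
rewrite !normrM !normrX !(gtr0_norm (y0 _)) in q4 q5 q4' q5'.
have pos (k : 'I_L) s u : (r k).[s] * u != 0 -> 0 < `|(r k).[s]|.
  by rewrite normr_gt0; apply: contraNneq => ->; rewrite mul0r.
have := balanced_ratio q1 cc0 LR (pos _ _ _ q2) (pos _ _ _ q3) (pos _ _ _ q2') (pos _ _ _ q3') (y0 i) (y0 j)
  (dbl _ _ _ _ n1 t0d s1i s2i).2 (dbl _ _ _ _ n1' t0d s1i s2i).2
  (dbl _ _ _ _ n1 t0d s2i s1i).2 (dbl _ _ _ _ n1' t0d s2i s1i).2 q4 q5 q4' q5'.
rewrite -/la ltNge => /negP; apply.
rewrite /y mulrA ler_pdivrMr ?exprn_gt0 // mulrAC ler_pdivlMr ?exprn_gt0 //.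
rewrite -mulrA mulrCA ler_pM2l // -exprS ler_weXn2l //.
Qed.

(** * Real roots of a polynomial depending on a parameter *)

Lemma poly_nonzero_near0 (R : realFieldType) (r : {poly R}) : r != 0 ->
  exists2 e, 0 < e <= 1 & forall t, 0 < t < e -> r.[t] != 0.
Proof.
move=> /poly_doubling [c [e [_ e0] h]]; exists e => // t te.
by have [||//] := h t t t te; case/andP: te => t0 _; rewrite lexx andbT ler_pdivrMr // ler_peMr ?ltW // ltr1n.
Qed.

Lemma evM (R : comNzRingType) (P Q : {poly {poly R}}) t X : ev (P * Q) t X = ev P t X * ev Q t X.
Proof. by rewrite rmorphM hornerM. Qed.

Lemma evD (R : comNzRingType) (P Q : {poly {poly R}}) t X : ev (P + Q) t X = ev P t X + ev Q t X.
Proof. by rewrite rmorphD hornerD. Qed.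

Lemma evZ (R : comNzRingType) a (Q : {poly {poly R}}) t X : ev (a *: Q) t X = a.[t] * ev Q t X.
Proof. by rewrite map_polyZ hornerZ. Qed.

Lemma ev1 (R : comNzRingType) t X : ev (1 : {poly {poly R}}) t X = 1.
Proof. by rewrite rmorph1 hornerC. Qed.

Definition regular_below (R : realFieldType) (e : R) (G : {poly {poly R}}) : Prop :=
  forall t X, 0 < t < e -> ev G t X = 0 -> ev G^`() t X != 0.

Lemma deriv_eq0_size (R : realFieldType) (Q : {poly {poly R}}) : Q^`() = 0 -> (size Q <= 1)%N.
Proof.
move=> /polyP h; apply/leq_sizeP => -[//|i] _.
apply/polyP => j; have /polyP /(_ j) := h i.
rewrite coef_deriv !coef0 coefMn => /eqP.
by rewrite mulrn_eq0 /= => /eqP.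
Qed.

(** If [Q] is coprime to its derivative, a Bezout identity over the parameter ring excludes common
    zeros except at zeros of one nonzero polynomial in [t], which are avoided for small positive
    [t]. Otherwise [Q] splits into the gcd and its cofactor, both of smaller degree. *)
Lemma regular_factors (R : realFieldType) (Q : {poly {poly R}}) : Q != 0 ->
  exists2 e, 0 < e <= 1 & exists2 Gs : seq {poly {poly R}},
    forall G, G \in Gs -> [/\ (size G <= size Q)%N, map_poly (horner_eval 0) G != 0 & regular_below e G] &
    forall t X, 0 < t < e -> ev Q t X = 0 -> exists2 G, G \in Gs & ev G t X = 0.
Proof.
have [s] := ubnP (size Q); elim: s Q => [//|s IH] Q sQ Q0.
have [cop|ncop] := boolP (coprimep Q Q^`()).
  have /Bezout_coprimepP[[u v] /eqpP[[c1 c2] /= /andP[c10 c20] e]] := cop.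
  have [e0 e00 he] := poly_nonzero_near0 c20.
  have [k [G [GE G0 sG]]] := scaleX_factor Q0.
  exists e0 => //; exists [:: G] => [_ /[1!inE] /eqP->|t X te].
    split=> //; first by rewrite sG.
    move=> t X te GtX; apply/eqP => G'tX.
    have := congr1 (fun P => ev P t X) e.
    have Q1 : ev Q t X = 0 by rewrite GE evZ GtX mulr0.
    have Q2 : ev Q^`() t X = 0 by rewrite GE derivZ evZ G'tX mulr0.
    rewrite !evZ evD !evM Q1 Q2 ev1 !mulr0 addr0 mulr0 mulr1 => /esym/eqP.
    by rewrite (negPf (he t te)).
  rewrite {1}GE evZ => /eqP; rewrite mulf_eq0 hornerXn expf_eq0.
  case/andP: te => t0 _; rewrite (gt_eqF t0) andbF /= => /eqP h.
  by exists G; rewrite ?mem_head.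
have gQ := dvdp_gcdl Q Q^`(); have gQ' := dvdp_gcdr Q Q^`().
move: ncop; rewrite coprimep_def; set g := gcdp Q Q^`() in gQ gQ' * => sg.
have g0 : g != 0 by rewrite gcdp_eq0 (negPf Q0).
have Q'0 : Q^`() != 0.
  apply: contraNneq sg => e.
  have sQ1 : size Q = 1%N by apply/eqP; rewrite eqn_leq deriv_eq0_size // size_poly_gt0.
  have := dvdp_leq Q0 gQ; rewrite sQ1 => h.
  by rewrite eqn_leq h size_poly_gt0.
have gs : (size g < size Q)%N.
  by apply: leq_ltn_trans (lt_size_deriv Q0); apply: dvdp_leq.
have [[c q] /= c0 e] := Pdiv.Idomain.dvdpP _ _ gQ.
have q0 : q != 0.
  apply: contraNneq Q0 => q0; move: e; rewrite q0 mul0r => /eqP.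
  by rewrite scale_poly_eq0 (negPf c0).
have qs : (size q < size Q)%N.
  have := congr1 (fun P : {poly _} => size P) e; rewrite size_scale // size_mul // => ->.
  have : (1 < size g)%N by rewrite ltn_neqAle eq_sym sg size_poly_gt0.
  by case: (size g) => [//|[//|k]] _; rewrite addnS /= addnS ltnS leq_addr.
have [e1 e10 [G1 h1 w1]] := IH q (leq_trans qs sQ) q0.
have [e2 e20 [G2 h2 w2]] := IH g (leq_trans gs sQ) g0.
exists (Num.min e1 e2).
  case/andP: e10 => e10 e11; case/andP: e20 => e20 _.
  by rewrite lt_min e10 e20 ge_min e11.
exists (G1 ++ G2) => [G|t X].
  rewrite mem_cat => /orP[/h1|/h2] [a b r].
    split=> //; first by apply: leq_trans a _; exact: ltnW.
    by move=> t X /andP[t0]; rewrite lt_min => /andP[te _]; apply: r; rewrite t0.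
  split=> //; first by apply: leq_trans a _; exact: ltnW.
  by move=> t X /andP[t0]; rewrite lt_min => /andP[_ te]; apply: r; rewrite t0.
move=> /andP[t0]; rewrite lt_min => /andP[te1 te2] Qt.
have := congr1 (fun P => ev P t X) e; rewrite evZ evM Qt mulr0 => /esym/eqP.
rewrite mulf_eq0 => /orP[/eqP h|/eqP h].
  by have [|G GG Gt] := w1 t X _ h; [rewrite t0|exists G; rewrite // mem_cat GG].
by have [|G GG Gt] := w2 t X _ h; [rewrite t0|exists G; rewrite // mem_cat GG orbT].
Qed.

Lemma poly_abs_min (R : realType) (p : {poly R}) a b : a <= b ->
  exists2 x, a <= x <= b & forall y, a <= y <= b -> `|p.[x]| <= `|p.[y]|.
Proof.
move=> ab; pose c := (a + b) / 2; pose d := (b - a) / 2.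
pose q := (p ^+ 2) \Po (c%:P + d *: 'X).
have qE u : q.[u] = p.[c + d * u] ^+ 2 by rewrite /q horner_comp !hornerE.
have [C C0 hC] := poly_lip q ler01.
have [|x xB xmin] := @min_attained R 1 (fun x => q.[x ord0]).
  exists C => // x y e xB yB e0 xy; apply: le_trans (hC _ _ (yB _) (xB _)) _.
  by rewrite ler_wpM2l.
have d0 : 0 <= d by rewrite /d; clear -ab; lra.
exists (c + d * x ord0).
  have := xB ord0; rewrite ler_norml => /andP[x1 x2].
  have e : d * 1 = (b - a) / 2 by rewrite mulr1.
  have := ler_wpM2l d0 x1; have := ler_wpM2l d0 x2; rewrite mulrN e /c; clear.
  by move: (d * _) => z h1 h2; lra.
move=> y yab; have [d00|dn] := eqVneq d 0.
  have -> : y = c + d * x ord0 by rewrite d00 mul0r /c; move: d00 yab; rewrite /d; clear; lra.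
  by [].
have dp : 0 < d by rewrite lt_def dn.
have yB : inB (fun _ : 'I_1 => (y - c) / d).
  move=> _; rewrite normrM normfV (gtr0_norm dp) ler_pdivrMr // mul1r ler_norml.
  by move: yab; rewrite /c /d; clear; lra.
have := xmin _ yB; rewrite !qE.
have -> : c + d * ((y - c) / d) = y by field.
by rewrite -[p.[y] ^+ 2]real_normK ?num_real // -[p.[_] ^+ 2]real_normK ?num_real // ler_pXn2r // nnegrE.
Qed.

(** Roots in [[-1, 1]] are split off one at a time, keeping the nearer of the two candidates. A
    cofactor without such roots is bounded below on the interval, and there the default point 0
    works because the powers of [|X|] are at most 1. *)
Lemma near_roots (R : realType) k (q : {poly R}) : q != 0 -> (size q <= k.+1)%N ->
  exists2 C, 0 <= C & exists Xi : seq R, forall X, `|X| <= 1 ->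
    exists2 xi, xi \in Xi & `|X - xi| ^+ k <= C * `|q.[X]|.
Proof.
elim: k q => [|k IH] q q0 sq.
  have [c cE] : exists c, q = c%:P by exists q`_0; exact: size1_polyC.
  have c0 : c != 0 by apply: contraNneq q0 => c0; rewrite cE c0.
  exists (`|c|^-1); first by rewrite invr_ge0.
  exists [:: 0] => X _; exists 0; rewrite ?mem_head // expr0 cE hornerC mulVf // normr_eq0 //.
have [[a /andP[a1 a2] /factor_theorem [q1 qE]]|noroot] :=
   pselect (exists2 a, -1 <= a <= 1 & root q a).
  have q10 : q1 != 0 by apply: contraNneq q0 => e; rewrite qE e mul0r.
  have [|C C0 [Xi hXi]] := IH q1 q10.
    by move: sq; rewrite qE size_mul ?polyXsubC_eq0 // size_XsubC addn2.
  exists C => //; exists (a :: Xi) => X X1; have [xi xiXi h] := hXi X X1.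
  have e : C * `|q.[X]| = (C * `|q1.[X]|) * `|X - a|.
    by rewrite qE hornerM hornerXsubC normrM mulrA.
  have [le|le] := leP (`|X - a|) (`|X - xi|).
    exists a; rewrite ?mem_head // e exprSr ler_wpM2r // (le_trans _ h) //.
    by rewrite lerXn2r ?nnegrE.
  exists xi; rewrite ?inE ?xiXi ?orbT // e exprSr; apply: ler_pM => //; [exact: exprn_ge0|exact: ltW].
have [|x x1 xmin] := @poly_abs_min R q (-1) 1; first by rewrite (le_trans (lerN10 R) ler01).
have qx : 0 < `|q.[x]|.
  by rewrite normr_gt0; apply/negP => h; apply: noroot; exists x.
exists (`|q.[x]|^-1); first by rewrite invr_ge0.
exists [:: 0] => X X1; exists 0; rewrite ?mem_head // subr0.
apply: (@le_trans _ _ 1); first exact: exprn_ile1.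
by rewrite mulrC ler_pdivlMr // mul1r; apply: xmin; rewrite -ler_norml.
Qed.

(** [G] is Lipschitz in [t], so at a root [X] for the parameter [t] the value at parameter 0 is
    [O(t)]. This is where the degree turns into the exponent [1 / k]. *)
Lemma holder_roots (R : realType) k (G : {poly {poly R}}) :
  map_poly (horner_eval 0) G != 0 -> (size G <= k.+1)%N ->
  exists2 C, 0 <= C & exists Xi : seq R, forall t X, 0 <= t <= 1 -> `|X| <= 1 -> ev G t X = 0 ->
    exists2 xi, xi \in Xi & `|X - xi| ^+ k <= C * t.
Proof.
move=> G0 sG.
have [|C C0 [Xi hXi]] := near_roots G0 (k := k); first by apply: leq_trans (size_poly _ _) sG.
have [C' C'0 hC'] := ev_lip G ler01.
exists (C * C'); first exact: mulr_ge0.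
exists Xi => t X /andP[t0 t1] X1 GtX; have [xi xiXi h] := hXi X X1; exists xi => //.
apply: le_trans h _; rewrite -mulrA ler_wpM2l //.
have := hC' 0 t X; rewrite normr0 [`|t|]ger0_norm // GtX subr0 => /(_ ler01 t1 X1).
by rewrite sub0r normrN [`|t|]ger0_norm.
Qed.

Lemma sign_change (R : realFieldType) (p : {poly R}) x d : p.[x] = 0 -> p^`().[x] != 0 -> 0 < d ->
  exists u v, [/\ x - d < u, u < x, x < v, v < x + d & p.[u] * p.[v] < 0].
Proof.
move=> /rootP /factor_theorem [q ->]; rewrite derivM derivXsubC mulr1 hornerD hornerM hornerXsubC subrr mulr0 add0r => q0 d0.
pose r := q \Po ('X + x%:P).
have rE u : r.[u] = q.[u + x] by rewrite /r horner_comp !hornerE.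
have [|C C0 hC] := @poly_lip R r 1; first exact: ler01.
have n0 : 0 < `|q.[x]| by rewrite normr_gt0.
pose e := Num.min (Num.min 1 (d / 2)) (`|q.[x]| / (2 * (C + 1))).
have C1 : 0 < 2 * (C + 1) by clear -C0; lra.
have e0 : 0 < e by rewrite !lt_min ltr01 !divr_gt0.
have e1 : e <= 1 by rewrite !ge_min lexx.
have ed : e < d by apply: (@le_lt_trans _ _ (d / 2)); [rewrite !ge_min lexx orbT|clear -d0; lra].
have eC : e * (2 * (C + 1)) <= `|q.[x]| by rewrite -ler_pdivlMr // ge_min lexx orbT.
exists (x - e), (x + e); split; rewrite ?ltrD2l ?ltrN2 // ?ltrBlDr ?ltrDl //.
have near u : `|u| = e -> `|q.[x + u] - q.[x]| <= `|q.[x]| / 2.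
  move=> ue; have := hC u 0; rewrite !rE add0r normr0 subr0 ue [u + x]addrC => /(_ e1 ler01) h.
  by apply: le_trans h _; clear -eC e0; lra.
have := near e (gtr0_norm e0); have := near (- e); rewrite normrN => /(_ (gtr0_norm e0)).
rewrite !hornerM !hornerXsubC.
have -> : q.[x - e] * (x - e - x) * (q.[x + e] * (x + e - x)) = - (e ^+ 2 * (q.[x - e] * q.[x + e])) by ring.
rewrite oppr_lt0 => h1 h2; apply: mulr_gt0; first by rewrite exprn_gt0.
move: h1 h2 n0; clear; move: q.[x] q.[x - e] q.[x + e] => a b c.
have [ha|ha] := ltP 0 a.
  rewrite [`|a|]gtr0_norm // !ler_norml => /andP[h1 _] /andP[h2 _] _; apply: mulr_gt0; lra.
rewrite [`|a|]ler0_norm // !ler_norml => /andP[_ h1] /andP[_ h2] h; rewrite -mulrNN; apply: mulr_gt0; lra.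
Qed.

Lemma root_between (R : rcfType) (p : {poly R}) u v pu pv : u <= v ->
  `|p.[u] - pu| < `|pu| -> `|p.[v] - pv| < `|pv| -> pu * pv < 0 ->
  exists2 x, u <= x <= v & root p x.
Proof.
move=> uv' nu nv uv.
have [hu|hu] := ltP pu 0.
  have hv : 0 < pv by rewrite -(nmulr_rlt0 _ hu).
  apply: poly_ivt => //; move: nu nv; rewrite (ltr0_norm hu) (gtr0_norm hv) !ltr_norml; clear.
  by move=> /andP[_ h1] /andP[h2 _]; apply/andP; split; lra.
have {}hu : 0 < pu by rewrite lt_def hu andbT; apply: contraTneq uv => ->; rewrite mul0r ltxx.
have hv : pv < 0 by rewrite -(pmulr_rlt0 _ hu).
have [|x xi r] := @poly_ivt _ (- p) u v uv'.
  rewrite !hornerN oppr_le0 oppr_ge0; move: nu nv; rewrite (ltr0_norm hv) (gtr0_norm hu) !ltr_norml; clear.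
  by move=> /andP[h1 _] /andP[_ h2]; apply/andP; split; lra.
by exists x => //; rewrite -rootN.
Qed.

(* The infimum of the times at which the cell contains a root is [a]: at an earlier
   infimum the simple root would sit inside the cell and survive for smaller times. *)
Lemma root_persists (R : realType) (G : {poly {poly R}}) e a t g1 g2 X :
  regular_below e G -> 0 < a <= t -> t < e <= 1 -> g1 <= X <= g2 ->
  (forall s, a <= s <= t -> ev G s g1 != 0) -> (forall s, a <= s <= t -> ev G s g2 != 0) ->
  ev G t X = 0 -> exists2 X', g1 <= X' <= g2 & ev G a X' = 0.
Proof.
move=> reg /andP[a0 a_t] /andP[te e1] Xg ng1 ng2 GtX.
have g12 : g1 <= g2 by case/andP: Xg => /le_trans h /h.
pose M := `|g1| + `|g2|.
have M0 : 0 <= M by rewrite addr_ge0.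
have inM x : g1 <= x <= g2 -> `|x| <= M.
  move=> /andP[x1 x2]; rewrite ler_norml /M.
  have := ler_norm g2; have := ler_norm (- g1); rewrite normrN.
  have := normr_ge0 g1; have := normr_ge0 g2; move: x1 x2; clear; lra.
have [C C0 hC] := ev_lip G M0.
have t01 s : a <= s <= t -> `|s| <= 1.
  by move=> /andP[s1 s2]; rewrite ger0_norm; move: s1 s2 te e1 a0; clear; lra.
pose T : set R := [set s | a <= s <= t /\ exists2 X', g1 <= X' <= g2 & ev G s X' = 0]%classic.
have Tt : T t by split; [rewrite a_t lexx|exists X].
have hT : has_inf T by split; [exists t|exists a => s [/andP[]]].
set s0 := inf T.
have s0t : s0 <= t by apply: (ge_inf hT.2).
have as0 : a <= s0 by apply: lb_le_inf; [exists t|move=> s [/andP[]]].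
have s0i : a <= s0 <= t by rewrite as0.
have C1 : 0 < C + 1 by clear -C0; lra.
have [X0 X0g X0min] := poly_abs_min (map_poly (horner_eval s0) G) g12.
(* The infimum is attained: a positive minimum of [|G|] over the cell at time [s0] would exclude
   roots shortly after [s0]. *)
have GX0 : ev G s0 X0 = 0.
  apply/eqP; rewrite -normr_le0 leNgt; apply/negP => pos.
  have d0 : 0 < `|ev G s0 X0| / (C + 1) by rewrite divr_gt0.
  have [s [si [X' X'g GsX']] ss0] := inf_adherent d0 hT.
  have s0s : s0 <= s by apply: (ge_inf hT.2); split=> //; exists X'.
  have := hC s0 s X' (t01 _ s0i) (t01 _ si) (inM _ X'g).
  rewrite GsX' subr0 [`|s0 - s|]distrC [`|s - s0|]ger0_norm ?subr_ge0 // => /(le_trans (X0min _ X'g)) h.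
  have h2 : (s - s0) * (C + 1) < `|ev G s0 X0|.
    by rewrite -ltr_pdivlMr // ltrBlDl.
  have h3 : 0 <= s - s0 by rewrite subr_ge0.
  by move: h h2 h3; rewrite [(s - s0) * (C + 1)]mulrDr mulr1 [(s - s0) * C]mulrC; clear; move: (C * _) => z; lra.
have [es0|ns0] := eqVneq s0 a; first by exists X0; rewrite // -es0.
have ls0 : a < s0 by rewrite lt_def ns0.
have X01 : g1 < X0.
  rewrite lt_neqAle; case/andP: X0g => -> _; rewrite andbT.
  by apply/eqP => h; have := ng1 _ s0i; rewrite h GX0 eqxx.
have X02 : X0 < g2.
  rewrite lt_neqAle; case/andP: X0g => _ ->; rewrite andbT.
  by apply/eqP => h; have := ng2 _ s0i; rewrite -h GX0 eqxx.
have d0 : 0 < Num.min (X0 - g1) (g2 - X0) by rewrite lt_min !subr_gt0 X01.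
have G'X0 : (map_poly (horner_eval s0) G)^`().[X0] != 0.
  by rewrite deriv_map; apply: reg => //; rewrite (lt_le_trans a0) //= (le_lt_trans s0t).
have [u [v [u1 u2 v1 v2 uv]]] := sign_change GX0 G'X0 d0.
have ug : g1 <= u <= g2.
  have : Num.min (X0 - g1) (g2 - X0) <= X0 - g1 by rewrite ge_min lexx.
  by move: u1 u2 X02; clear; move: (Num.min _ _) => m *; lra.
have vg : g1 <= v <= g2.
  have : Num.min (X0 - g1) (g2 - X0) <= g2 - X0 by rewrite ge_min lexx orbT.
  by move: v1 v2 X01; clear; move: (Num.min _ _) => m *; lra.
set pu := ev G s0 u in uv; set pv := ev G s0 v in uv.
have pu0 : 0 < `|pu| by rewrite normr_gt0; apply: contraTneq uv => ->; rewrite mul0r ltxx.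
have pv0 : 0 < `|pv| by rewrite normr_gt0; apply: contraTneq uv => ->; rewrite mulr0 ltxx.
pose dd := Num.min (s0 - a) (Num.min (`|pu| / (C + 1)) (`|pv| / (C + 1))).
have dd0 : 0 < dd by rewrite !lt_min subr_gt0 ls0 !divr_gt0.
pose s := s0 - dd / 2.
have sa : a <= s.
  have : dd <= s0 - a by rewrite ge_min lexx.
  by move: dd0; rewrite /s; clear; lra.
have ss0 : s < s0 by rewrite /s; clear -dd0; lra.
have si : a <= s <= t by rewrite sa (le_trans (ltW ss0)).
have ds : `|s - s0| < dd by rewrite ltr0_norm /s; clear -dd0; lra.
have near z : g1 <= z <= g2 -> dd <= `|ev G s0 z| / (C + 1) -> `|ev G s z - ev G s0 z| < `|ev G s0 z|.
  move=> zg; rewrite ler_pdivlMr // => h.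
  apply: le_lt_trans (hC s s0 z (t01 _ si) (t01 _ s0i) (inM _ zg)) _.
  apply: lt_le_trans h; rewrite mulrDr mulr1 [dd * C]mulrC.
  by apply: (@le_lt_trans _ _ (C * dd)); [rewrite ler_wpM2l // ltW|rewrite ltrDl].
have nu := near u ug; have nv := near v vg.
have {}nu : `|ev G s u - pu| < `|pu| by apply: nu; rewrite /dd !ge_min lexx !orbT.
have {}nv : `|ev G s v - pv| < `|pv| by apply: nv; rewrite /dd !ge_min lexx !orbT.
have uv' : u <= v by apply: ltW (lt_trans u2 v1).
have [X' /andP[X'u X'v] /rootP GX'] : exists2 X', u <= X' <= v & root (map_poly (horner_eval s) G) X'.
  exact: root_between uv' nu nv uv.
have : T s.
  split=> //; exists X' => //; case/andP: ug => g1u _; case/andP: vg => _ vg2.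
  by rewrite (le_trans g1u X'u) (le_trans X'v vg2).
by move=> /(ge_inf hT.2); rewrite -/s0 leNgt ss0.
Qed.

(** * Counting the crossings of roots with a grid *)

Lemma root_list (R : idomainType) (p : {poly R}) : p != 0 ->
  exists2 rs : seq R, (size rs < size p)%N & forall x, p.[x] = 0 -> x \in rs.
Proof.
have [s] := ubnP (size p); elim: s p => [//|s IH] p sp p0.
have [[a /factor_theorem [q qE]]|noroot] := pselect (exists a, root p a); last first.
  exists [::] => [|x px]; first by rewrite size_poly_gt0.
  by case: noroot; exists x; apply/rootP.
have q0 : q != 0 by apply: contraNneq p0 => e; rewrite qE e mul0r.
have sq : size p = (size q).+1 by rewrite qE size_mul ?polyXsubC_eq0 // size_XsubC addn2.
have [|rs srs hrs] := IH q _ q0; first by move: sp; rewrite sq ltnS.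
exists (a :: rs) => [|x]; first by rewrite sq.
rewrite qE hornerM hornerXsubC inE => /eqP; rewrite mulf_eq0 subr_eq0 => /orP[/eqP/hrs->|->//].
by rewrite orbT.
Qed.

(** The half-open intervals are disjoint, so meeting all [M] of them takes [M] distinct points of
    [Z]. *)
Lemma free_slab (R : realFieldType) (Z : seq R) M (al w : R) : 0 < w -> (size Z < M)%N ->
  exists2 i, (i < M)%N & forall z, z \in Z -> ~~ (al + i%:R * w < z <= al + i.+1%:R * w).
Proof.
move=> w0 sZ; apply: contrapT => h.
have /fin_all_exists [z hz] : forall i : 'I_M, exists z, z \in Z /\ al + i%:R * w < z <= al + i.+1%:R * w.
  move=> i; apply: contrapT => h1; apply: h; exists i => // z zZ.
  by apply/negP => h2; apply: h1; exists z.
have lt_z (i j : 'I_M) : (i < j)%N -> z i < z j.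
  move=> ij; have [_ /andP[_ h1]] := hz i; have [_ /andP[h2 _]] := hz j.
  apply: le_lt_trans h1 _; apply: le_lt_trans h2.
  by rewrite lerD2l ler_pM2r // ler_nat.
have zinj : injective z.
  move=> i j e; apply: val_inj => /=; case: (ltngtP i j) => // /lt_z; by rewrite e ltxx.
have := @uniq_leq_size _ [seq z i | i : 'I_M] Z.
rewrite map_inj_uniq ?enum_uniq // size_map size_enum_ord => /(_ isT) H.
have : (M <= size Z)%N by apply: H => _ /mapP[i _ ->]; case: (hz i).
by rewrite leqNgt sZ.
Qed.

Lemma unit_cell (R : realDomainType) (u : R) M : (0 < M)%N -> 0 <= u <= M%:R ->
  exists2 l, (l < M)%N & l%:R <= u <= l.+1%:R.
Proof.
elim: M => [//|M IH] _ /andP[u0 uM].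
have [le|lt] := leP u M%:R; last by exists M; rewrite // (ltW lt) uM.
case: M IH le uM => [|M] IH le uM; first by exists 0%N; rewrite // u0.
by have [//||l lM hl] := IH; [rewrite u0 le|exists l => //; exact: ltnW].
Qed.

Lemma ev_swap (R : comNzRingType) (G : {poly {poly R}}) t X : ev G t X = (G.[X%:P]).[t].
Proof.
have -> : (G.[X%:P]).[t] = horner_eval t (G.[X%:P]) by [].
by rewrite -horner_map /= /horner_eval hornerC.
Qed.

(** One more than the degree in the inner variable, for nonzero [G]; it bounds the number of times
    at which roots meet a fixed grid line. *)
Definition degt (R : nzRingType) (G : {poly {poly R}}) : nat := (\max_(i < size G) size (G`_i)%R)%N.

Lemma size_swap (R : idomainType) (G : {poly {poly R}}) X : (size (G.[X%:P]) <= degt G)%N.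
Proof.
rewrite horner_coef; apply: leq_trans (size_sum _ _ _) _.
apply/bigmax_leqP => i _; apply: leq_trans (leq_bigmax i).
rewrite -polyC_exp mulrC mul_polyC; exact: size_scale_leq.
Qed.

Lemma regular_poly_neq0 (R : realFieldType) (e : R) (G : {poly {poly R}}) t :
  regular_below e G -> 0 < t < e -> map_poly (horner_eval t) G != 0.
Proof.
move=> reg te; apply/eqP => h.
have : ev G t 0 = 0 by rewrite h horner0.
by move=> /(reg t 0 te); rewrite -deriv_map h deriv0 horner0 eqxx.
Qed.

(* The grid lines around the points of [Xi] are met at boundedly many times per line, so
   some slab of length proportional to [t0 / m] is free of crossings; all the roots found
   in it stay in the cells of the roots at its left end. *)
Lemma crossing_free_slab (R : realType) (e : R) (Gs : seq {poly {poly R}}) (Xi : seq R) :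
  e <= 1 -> (forall G, G \in Gs -> regular_below e G) ->
  exists2 K2 : R, 0 < K2 & exists K3 : nat, forall t0 s m, 0 < t0 < e -> 0 < s -> (0 < m)%N ->
    exists a, exists b, exists2 La : seq R,
      [/\ t0 / 2 <= a, a < b, b <= t0, t0 <= K2 * m%:R * (b - a) & (size La <= K3)%N] &
      forall G t X xi, G \in Gs -> a <= t <= b -> ev G t X = 0 -> xi \in Xi -> `|X - xi| <= s ->
        exists2 la, la \in La & `|X - la| <= s / m%:R.
Proof.
move=> e1 reg.
pose W := (\sum_(G <- Gs) degt G)%N.
pose K1 := (3 * (size Xi * W))%N.
exists (4 * (K1.+1)%:R); first by rewrite mulr_gt0 // ltr0n.
exists (\sum_(G <- Gs) size G)%N => t0 s m /andP[t00 t0e] s0 m0.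
have mR : 0 < m%:R :> R by rewrite ltr0n.
pose r := s / m%:R.
have r0 : 0 < r by rewrite divr_gt0.
(* The [2 * m + 1] lines of spacing [r] cover the distance [s] on both sides of [xi]; the factor 3
   in [K1] comes from [2 * m + 1 <= 3 * m]. *)
pose line (xi : R) (l : nat) := xi + (l%:R - m%:R) * r.
pose lines := [seq line xi l | xi <- Xi, l <- iota 0 (2 * m).+1].
have slines : size lines = (size Xi * (2 * m).+1)%N by rewrite size_allpairs size_iota.
have exroots (L : seq R) (G : {poly {poly R}}) : exists2 Z : seq R, (size Z <= size L * degt G)%N &
    forall g t, g \in L -> G.[g%:P] != 0 -> ev G t g = 0 -> t \in Z.
  elim: L => [|g L [Z sZ hZ]]; first by exists [::].
  have [g0|gn0] := eqVneq G.[g%:P] 0.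
    exists Z => [|g' t]; first by apply: leq_trans sZ _; rewrite leq_mul2r leqnSn orbT.
    by rewrite inE => /orP[/eqP->|]; [rewrite g0 eqxx|exact: hZ].
  have [rs srs hrs] := root_list gn0.
  exists (rs ++ Z) => [|g' t].
    by rewrite size_cat mulSn leq_add // ltnW // (leq_trans srs) // size_swap.
  rewrite inE mem_cat => /orP[/eqP-> _|gL gn h]; first by rewrite ev_swap => /hrs ->.
  by rewrite (hZ _ _ gL gn h) orbT.
have [Z sZ hZ] : exists2 Z : seq R, (size Z <= size lines * W)%N &
    forall G g t, G \in Gs -> g \in lines -> G.[g%:P] != 0 -> ev G t g = 0 -> t \in Z.
  rewrite /W; elim: (Gs) => [|G Gs' [Z sZ hZ]]; first by exists [::].
  have [Z' sZ' hZ'] := exroots lines G.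
  exists (Z' ++ Z) => [|G' g t]; first by rewrite size_cat big_cons mulnDr leq_add.
  rewrite inE mem_cat => /orP[/eqP-> gl gn h|GG gl gn h]; first by rewrite (hZ' _ _ gl gn h).
  by rewrite (hZ _ _ _ GG gl gn h) orbT.
pose M := (K1 * m).+1.
have sZM : (size Z < M)%N.
  rewrite ltnS; apply: leq_trans sZ _; rewrite slines /K1 mulnAC.
  move: (size Xi * W)%N => x; rewrite [(3 * x)%N]mulnC -mulnA leq_mul2l.
  by apply/orP; right; clear -m0; lia.
have [w wE] : exists w, w = t0 / 2 / M%:R by exists (t0 / 2 / M%:R).
have M0 : 0 < M%:R :> R by rewrite ltr0n.
have w0 : 0 < w by rewrite wE !divr_gt0.
have [i iM hi] := free_slab (t0 / 2) w0 sZM.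
(* The free interval is open on the left, so [a] is taken at its midpoint and all of [[a, b]] is
   free of crossings. *)
pose a := t0 / 2 + i%:R * w + w / 2; pose b := t0 / 2 + i.+1%:R * w.
have bE : b = a + w / 2.
  have hh (x y z : R) : x + (y + 1) * z = x + y * z + z / 2 + z / 2 by field.
  by rewrite /b /a -[i.+1%:R]natr1 hh.
have iw : 0 <= i%:R * w by rewrite mulr_ge0 // ltW.
have ta : t0 / 2 <= a by rewrite /a -addrA lerDl addr_ge0 // divr_ge0 // ltW.
have ab : a < b by rewrite bE; clear -w0; lra.
have bt : b <= t0.
  have : i.+1%:R * w <= M%:R * w by rewrite ler_pM2r // ler_nat.
  have -> : M%:R * w = t0 / 2 by rewrite wE mulrC divfK // gt_eqF.
  by rewrite /b; clear; lra.
have a0 : 0 < a by clear -ta t00; lra.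
have ae : 0 < a < e by rewrite a0 (lt_trans ab) // (le_lt_trans bt).
have [La sLa hLa] : exists2 La : seq R, (size La <= \sum_(G <- Gs) size G)%N &
    forall G X, G \in Gs -> ev G a X = 0 -> X \in La.
  elim: (Gs) reg => [|G Gs' IH] reg; first by exists [::].
  have [|La sLa hLa] := IH; first by move=> G' GG; apply: reg; rewrite inE GG orbT.
  have [|rs srs hrs] := @root_list _ (map_poly (horner_eval a) G).
    by apply: (regular_poly_neq0 (e := e)) => //; apply: reg; rewrite mem_head.
  exists (rs ++ La) => [|G' X].
    by rewrite size_cat big_cons leq_add // ltnW // (leq_trans srs) // size_poly.
  rewrite inE mem_cat => /orP[/eqP-> /hrs->//|GG h]; by rewrite (hLa _ _ GG h) orbT.
exists a, b, La.
  split=> //.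
  have -> : b - a = w / 2 by rewrite bE addrC addKr.
  rewrite wE.
  have -> : 4 * K1.+1%:R * m%:R * (t0 / 2 / M%:R / 2) = t0 * (K1.+1%:R * m%:R / M%:R).
    by field; rewrite gt_eqF.
  rewrite ler_peMr ?(ltW t00) // ler_pdivlMr // mul1r -natrM ler_nat /M.
  by clear -m0; nia.
move=> G t X xi GG /andP[at_ tb] GtX xiXi Xxi.
have [l l2m /andP[lu ul]] : exists2 l, (l < 2 * m)%N & l%:R <= (X - xi) / r + m%:R <= l.+1%:R.
  apply: unit_cell; first by rewrite muln_gt0.
  have : `|(X - xi) / r| <= m%:R.
    rewrite normrM normfV (gtr0_norm r0) ler_pdivrMr // /r mulrC divfK // gt_eqF //.
  rewrite ler_norml natrM; clear; move: (_ / r) m%:R => x y; lra.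
have XE : X = xi + ((X - xi) / r + m%:R - m%:R) * r by field; rewrite gt_eqF.
have g1X : line xi l <= X by rewrite [X in _ <= X]XE lerD2l ler_pM2r // lerD2r.
have Xg2 : X <= line xi l.+1 by rewrite [X in X <= _]XE lerD2l ler_pM2r // lerD2r.
have g12 : line xi l.+1 = line xi l + r by rewrite /line -natr1; ring.
have inl k : (k <= 2 * m)%N -> line xi k \in lines.
  by move=> k2m; apply/allpairsP; exists (xi, k); split=> //; rewrite mem_iota add0n ltnS.
have fin X' : line xi l <= X' <= line xi l.+1 -> ev G a X' = 0 -> exists2 la, la \in La & `|X - la| <= s / m%:R.
  move=> /andP[h1 h2] h; exists X'; first exact: hLa GG h.
  move: h1 h2 g1X Xg2; rewrite g12 -/r ler_norml; clear; move: (line _ _) => g *; apply/andP; split; lra.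
have g12le : line xi l <= line xi l.+1 by exact: le_trans g1X Xg2.
(* A line on which [G] vanishes identically in [t] contributes no crossing times, but it is itself a
   root at time [a] on the border of the cell. *)
have [z1|n1] := eqVneq G.[(line xi l)%:P] 0.
  by apply: (fin (line xi l)); rewrite ?lexx ?g12le // ev_swap z1 horner0.
have [z2|n2] := eqVneq G.[(line xi l.+1)%:P] 0.
  by apply: (fin (line xi l.+1)); rewrite ?lexx ?g12le // ev_swap z2 horner0.
have nocross k : (k <= 2 * m)%N -> G.[(line xi k)%:P] != 0 -> forall u, a <= u <= t -> ev G u (line xi k) != 0.
  move=> k2m kn u /andP[au ut]; apply/eqP => h.
  have := hi _ (hZ _ _ _ GG (inl k k2m) kn h); rewrite -/b (le_trans ut tb) andbT.
  by move/negP; apply; apply: lt_le_trans au; rewrite /a ltrDl divr_gt0.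
have [|||X' X'g h] := @root_persists R G e a t (line xi l) (line xi l.+1) X (reg _ GG) _ _ _ 
   (nocross _ (ltnW l2m) n1) (nocross _ l2m n2) GtX.
- by rewrite a0.
- by rewrite e1 andbT (le_lt_trans tb) // (le_lt_trans bt).
- by rewrite g1X.
exact: fin h.
Qed.

(** * The gradient inequality on the whole space *)

Lemma regular_factors_seq (R : realFieldType) k (Qs : seq {poly {poly R}}) :
  (forall Q, Q \in Qs -> Q != 0 /\ (size Q <= k)%N) ->
  exists2 e, 0 < e <= 1 & exists2 Gs : seq {poly {poly R}},
    forall G, G \in Gs -> [/\ (size G <= k)%N, map_poly (horner_eval 0) G != 0 & regular_below e G] &
    forall Q t X, Q \in Qs -> 0 < t < e -> ev Q t X = 0 -> exists2 G, G \in Gs & ev G t X = 0.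
Proof.
elim: Qs => [_|Q Qs IH h].
  by exists 1; [rewrite ltr01 lexx|exists [::]].
have [|e1 /andP[e10 e11] [G1 h1 w1]] := IH; first by move=> Q' QQ; apply: h; rewrite inE QQ orbT.
have [Q0 sQ] := h Q (mem_head _ _).
have [e2 /andP[e20 e21] [G2 h2 w2]] := regular_factors Q0.
exists (Num.min e1 e2); first by rewrite lt_min e10 e20 ge_min e11.
exists (G1 ++ G2) => [G|Q' t X].
  rewrite mem_cat => /orP[/h1|/h2] [a b r].
    by split=> // t X /andP[t0]; rewrite lt_min => /andP[te _]; apply: r; rewrite t0.
  split=> //; first exact: leq_trans a sQ.
  by move=> t X /andP[t0]; rewrite lt_min => /andP[_ te]; apply: r; rewrite t0.
rewrite inE => QQ /andP[t0]; rewrite lt_min => /andP[te1 te2].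
case/orP: QQ => [/eqP->|QQ] Qt.
  by have [|G GG Gt] := w2 t X _ Qt; [rewrite t0|exists G; rewrite // mem_cat GG orbT].
by have [|G GG Gt] := w1 _ t X QQ _ Qt; [rewrite t0|exists G; rewrite // mem_cat GG].
Qed.

Lemma holder_roots_seq (R : realType) k (Gs : seq {poly {poly R}}) :
  (forall G, G \in Gs -> map_poly (horner_eval 0) G != 0 /\ (size G <= k.+1)%N) ->
  exists2 C, 0 <= C & exists Xi : seq R, forall G t X, G \in Gs -> 0 <= t <= 1 -> `|X| <= 1 ->
    ev G t X = 0 -> exists2 xi, xi \in Xi & `|X - xi| ^+ k <= C * t.
Proof.
elim: Gs => [_|G Gs IH h]; first by exists 0 => //; exists [::].
have [|C1 C10 [X1 h1]] := IH; first by move=> G' GG; apply: h; rewrite inE GG orbT.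
have [G0 sG] := h G (mem_head _ _).
have [C2 C20 [X2 h2]] := holder_roots G0 sG.
exists (C1 + C2); first exact: addr_ge0.
exists (X1 ++ X2) => G' t X GG t01 XX Gt; have t0 : 0 <= t by case/andP: t01.
move: GG Gt; rewrite inE => /orP[/eqP->|GG] Gt.
  have [xi xX le] := h2 t X t01 XX Gt; exists xi; first by rewrite mem_cat xX orbT.
  by apply: le_trans le _; rewrite ler_wpM2r // lerDr.
have [xi xX le] := h1 _ t X GG t01 XX Gt; exists xi; first by rewrite mem_cat xX.
by apply: le_trans le _; rewrite ler_wpM2r // lerDl.
Qed.

Lemma nat_between (R : realType) (x : R) : 1 <= x -> exists2 m, (0 < m)%N & m%:R <= x <= 2 * m%:R.
Proof.
move=> x1; have x0 : 0 <= x by apply: le_trans x1.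
have [||l _ /andP[lx xl]] := @unit_cell R x (Num.bound x).+1 => //.
  by rewrite x0 ltW // (lt_trans (archi_boundP x0)) // ltr_nat.
case: l lx xl => [|l] lx xl.
  by exists 1%N; rewrite // x1 mulr1 (le_trans xl) // ler1n.
exists l.+1 => //; rewrite lx (le_trans xl) // -natrM ler_nat mul2n -addnn addSn.
by rewrite ltnS leq_addl.
Qed.

(** Multiplied by [m], the Taylor bound over a distance [2 * (s / m)] has a linear term of order
    [eta * s] and a quadratic term of order [s * (s / m)]; the latter is also [O(eta * s)] because
    [1 / m <= 2 * K6 * eta] and [s <= 1]. *)
Lemma numeric_bound (R : realFieldType) (t0 K2 K4 m sg nn eta s K K6 : R) :
  0 < m -> 0 <= K2 -> 0 <= K4 -> 0 <= nn -> 0 <= eta -> 0 <= s <= 1 -> 0 <= K -> 0 <= K6 ->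
  t0 <= K2 * m * (K4 * sg) -> 1 <= 2 * (K6 * eta * m) ->
  sg / 2 <= nn * eta * (2 * (s / m)) + K * (2 * (s / m)) ^+ 2 ->
  t0 <= K2 * K4 * (4 * nn + 16 * K * K6) * (eta * s).
Proof.
move=> m0 K20 K40 n0 eta0 /andP[s0 s1] K0 K60 ht hm hs.
apply: le_trans ht _.
have -> : K2 * m * (K4 * sg) = K2 * K4 * (m * sg) by ring.
rewrite -[X in _ <= X]mulrA ler_wpM2l ?mulr_ge0 //.
have h1 : m * sg <= m * (2 * (nn * eta * (2 * (s / m)) + K * (2 * (s / m)) ^+ 2)).
  by rewrite ler_pM2l //; clear -hs; lra.
apply: le_trans h1 _.
have -> : m * (2 * (nn * eta * (2 * (s / m)) + K * (2 * (s / m)) ^+ 2)) =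
   4 * nn * (eta * s) + 8 * K * (s * (s / m)) by field; rewrite gt_eqF.
rewrite [X in _ <= X]mulrDl lerD2l.
have -> : 16 * K * K6 * (eta * s) = 8 * K * (1 * (s * (2 * K6 * eta))) by ring.
rewrite ler_wpM2l ?mulr_ge0 //; apply: ler_pM => //; first by rewrite divr_ge0 // ltW.
rewrite ler_pdivrMr // -[X in _ <= X]mulrA -[X in X <= _]mulr1 ler_wpM2l //.
by apply: le_trans hm _; rewrite le_eqVlt; apply/orP; left; apply/eqP; ring.
Qed.

Lemma penalty_lipschitz (R : realFieldType) n (f h : ('I_n -> R) -> R) : lipB f -> lipB h ->
  exists2 K, 0 <= K & forall t t' x, inB x -> 0 <= t <= 1 -> 0 <= t' <= 1 ->
    penalty f h t x <= penalty f h t' x + K * `|t - t'|.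
Proof.
move=> /lipB_bounded [F F0 hF] /lipB_bounded [H H0 hH].
exists (2 * H + 2 * F + 2); first by rewrite !addr_ge0 ?mulr_ge0.
move=> t t' x xB /andP[t0 t1] /andP[t'0 t'1]; rewrite -lerBlDl.
have -> : penalty f h t x - penalty f h t' x = (t - t') * ((t + t') * h x - 2 * f x + (t + t')).
  by rewrite /penalty; ring.
apply: le_trans (ler_norm _) _; rewrite normrM mulrC ler_wpM2r //.
have tt : 0 <= t + t' <= 2 by clear -t0 t1 t'0 t'1; lra.
apply: le_trans (ler_normD _ _) _; apply: lerD.
  apply: le_trans (ler_normB _ _) _; rewrite !normrM; apply: lerD.
    by apply: ler_pM => //; [rewrite ger0_norm; case/andP: tt|exact: hH].
  by rewrite ger0_norm // ler_pM2l //; exact: hF.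
by rewrite ger0_norm; case/andP: tt.
Qed.

Lemma minimal_value (R : realType) n (f h : ('I_n -> R) -> R) : lipB f -> lipB h ->
  (forall t, lipB (penalty f h t)) ->
  exists V : R -> R, (forall t x, minimizer (penalty f h t) x -> V t = penalty f h t x) /\
    (forall t x, inB x -> V t <= penalty f h t x) /\
    exists2 K, 0 <= K & forall t t', 0 <= t <= 1 -> 0 <= t' <= 1 -> `|V t - V t'| <= K * `|t - t'|.
Proof.
move=> fl hl pl.
have ex t : exists x, minimizer (penalty f h t) x.
  by have [x xB xm] := min_attained (pl t); exists x.
have [z hz] := choice ex.
exists (fun t => penalty f h t (z t)); split.
  move=> t x [xB xm]; apply/eqP; rewrite eq_le; apply/andP; split; [exact: (hz t).2|].
  exact: xm (hz t).1.
split; first by move=> t x xB; exact: (hz t).2.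
have [K K0 hK] := penalty_lipschitz fl hl; exists K => // t t' ti ti'.
have one a b : 0 <= a <= 1 -> 0 <= b <= 1 ->
    penalty f h a (z a) - penalty f h b (z b) <= K * `|a - b|.
  move=> ai bi; rewrite lerBlDl; apply: le_trans (hK a b _ (hz b).1 ai bi).
  exact: (hz a).2 _ (hz b).1.
by rewrite ler_norml one // andbT lerNl opprB [`|t - t'|]distrC one.
Qed.

Lemma pigeonhole_labels (T : eqType) n k (La : seq T) (P : 'I_n -> 'I_(k ^ n).+1 -> T) :
  (size La <= k)%N -> (forall i j, P i j \in La) -> exists j j' : 'I_(k ^ n).+1, (j < j')%N /\ forall i, P i j = P i j'.
Proof.
move=> sL PL.
have idx i j : (index (P i j) La < k)%N by apply: leq_trans sL; rewrite index_mem.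
pose lab (j : 'I_(k ^ n).+1) : {ffun 'I_n -> 'I_k} := [ffun i => Ordinal (idx i j)].
have : ~~ injectiveb lab.
  by apply/negP => /injectiveP /leq_card; rewrite card_ffun !card_ord ltnn.
move=> /injectivePn [j [j' jj lj]].
have e i : P i j = P i j'.
  have := congr1 (fun F : {ffun _ -> _} => val (F i)) lj; rewrite !ffunE /= => h.
  by rewrite -(nth_index (P i j) (PL i j)) h nth_index.
by have := jj; rewrite neq_ltn => /orP[h|h]; [exists j, j'|exists j', j; split=> // i; rewrite e].
Qed.

(* [k ^ n] bounds the number of label vectors: two of the [k ^ n + 1] minimizers picked
   in the slab carry the same labels, hence are close although their values are not. *)
Lemma close_pair (R : realType) n k (f : ('I_n -> R) -> R) (La : seq R) (a b eta t0 r : R)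
    (x : R -> 'I_n -> R) :
  a < b -> 0 <= eta -> t0 * eta * (4 * (k ^ n + 2)%:R) <= b - a -> b <= t0 -> (size La <= k)%N ->
  (forall t, a <= t <= b -> `|f (x t) - t| <= eta * t0) ->
  (forall t i, a <= t <= b -> a <= f (x t) <= b -> exists2 la, la \in La & `|x t i - la| <= r) ->
  exists t t', [/\ a <= t <= b, a <= t' <= b, near_by (2 * r) (x t) (x t') &
    (b - a) / (k ^ n + 2)%:R / 2 <= `|f (x t') - f (x t)|].
Proof.
move=> ab eta0 hab bt sLa hf hx.
set K4 : R := (k ^ n + 2)%:R in hab *.
have K40 : 0 < K4 by rewrite ltr0n addn2.
pose sg := (b - a) / K4.
have sg0 : 0 < sg by rewrite divr_gt0 // subr_gt0.
have sgE : b - a = K4 * sg by rewrite /sg mulrC divfK // gt_eqF.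
have etasg : eta * t0 * 4 <= sg.
  by rewrite /sg ler_pdivlMr // mulrC; apply: le_trans hab; rewrite le_eqVlt; apply/orP; left; apply/eqP; ring.
(* The [k ^ n + 1] levels are interior points of a division into [k ^ n + 2] parts. They stay [sg]
   away from both ends, so the values of [f] at the minimizers remain in [[a, b]]. *)
pose T (j : nat) := a + j.+1%:R * sg.
have Tlow (j : 'I_(k ^ n).+1) : a + sg <= T j.
  by rewrite /T lerD2l; apply: ler_peMl; [exact: ltW|rewrite ler1n].
have Thigh (j : 'I_(k ^ n).+1) : T j <= b - sg.
  have : j.+2%:R * sg <= K4 * sg by rewrite ler_pM2r // ler_nat addn2 !ltnS -ltnS ltn_ord.
  rewrite -sgE /T -[j.+2%:R]natr1 mulrDl mul1r; clear; move: (_ * sg) => z; lra.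
have Ti (j : 'I_(k ^ n).+1) : a <= T j <= b.
  by have := Tlow j; have := Thigh j; clear -sg0; move: (T j) => z; lra.
have fT (j : 'I_(k ^ n).+1) : `|f (x (T j)) - T j| <= sg / 4.
  by apply: le_trans (hf _ (Ti j)) _; clear -etasg; lra.
have fi (j : 'I_(k ^ n).+1) : a <= f (x (T j)) <= b.
  have := fT j; rewrite ler_norml; have := Tlow j; have := Thigh j; clear -sg0.
  move: (T j) (f _) => z y; lra.
have [P hP] := choice (fun p : 'I_n * 'I_(k ^ n).+1 =>
   ex2_ind (fun la u v => ex_intro (fun la => _ /\ _) la (conj u v)) (hx (T p.2) p.1 (Ti p.2) (fi p.2))).
have [|j [j' [jj e]]] := @pigeonhole_labels _ n k La (fun i j => P (i, j)) sLa.
  by move=> i j; case: (hP (i, j)).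
exists (T j), (T j'); split=> //.
  move=> i; have [_ h1] := hP (i, j); have [_ h2] := hP (i, j'); rewrite -e in h2.
  have -> : x (T j') i - x (T j) i = (x (T j') i - P (i, j)) - (x (T j) i - P (i, j)) by ring.
  apply: le_trans (ler_normB _ _) _; rewrite mulr2n mulrDl mul1r; exact: lerD.
have : sg <= T j' - T j.
  have : j.+2%:R * sg <= j'.+1%:R * sg by rewrite ler_pM2r // ler_nat.
  rewrite /T -[j.+2%:R]natr1 mulrDl mul1r; clear; move: (j'.+1%:R * sg) (j.+1%:R * sg) => y z; lra.
rewrite -/sg; have := fT j; have := fT j'; rewrite !ler_norml => /andP[h1 h2] /andP[h3 h4] h5.
apply: le_trans (ler_norm _); move: h1 h2 h3 h4 h5; clear.
move: (f (x (T j))) (f (x (T j'))) => y z; move: (T j) (T j') => u v; lra.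
Qed.

(** Writing the value of [f] as an [N]-th power of [ta] turns the exponent [1 - 1 / N] into the
    integer [N - 1]. *)
Lemma lojasiewicz_pos (R : realType) n (i0 : 'I_n) d (f : ('I_n -> R) -> R) gf :
  pol d.+2 f -> (forall i, pol d.+1 (gf i)) -> taylor f gf -> f (fun=> 0) = 0 ->
  exists2 de, 0 < de <= 1 & exists2 c, 0 < c & forall x ta, (forall i, `|x i| <= de) -> 0 < ta ->
    f x = ta ^+ (d.+2 * (3 * d + 3) ^ n.-1) ->
    exists i, c * ta ^+ (d.+2 * (3 * d + 3) ^ n.-1).-1 <= `|gf i x|.
Proof.
move=> fp gfp fT f0.
pose N := (d.+2 * (3 * d + 3) ^ n.-1)%N.
have N2 : (1 < N)%N.
  have : (0 < (3 * d + 3) ^ n.-1)%N by rewrite expn_gt0 addn3.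
  by rewrite /N; move: ((3 * d + 3) ^ n.-1)%N => z; clear; nia.
rewrite -/N.
pose h (x : 'I_n -> R) := \sum_i gf i x ^+ 2.
have hp : pol (2 * d).+2 h.
  apply: pfun_sum => i; have -> : (2 * d).+2 = (d.+1 + d.+1)%N by lia.
  by apply: eq_pfun (pfunM (gfp i) (gfp i)) => v x; rewrite expr2.
have [gh ghp hT] := pol_grad hp.
have h0 x : 0 <= h x by apply: sumr_ge0 => i _; exact: sqr_ge0.
have [Qs hQ1 hQ2] := talweg fp gfp fT hp ghp hT.
have [S S0 hS] : exists2 S : {poly {poly R}}, S != 0 &
  forall t, exists2 x, minimizer (penalty f h t) x & (map_poly (horner_eval t) S).[penalty f h t x] = 0.
  apply: (@value_relation R n i0 _ _ (d.+1 + (2 * d).+1) f h gf gh fp _ fT hp _ hT) => i.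
    by apply: pfunW (gfp i); exact: leq_addr.
  by apply: pfunW (ghp i); exact: leq_addl.
have fl := pol_lipB fp; have hl := pol_lipB hp.
have [V [V1 [V2 [K K0 Vl]]]] := minimal_value fl hl (fun t => pol_lipB (pol_penalty t fp hp)).
have V0 t : 0 <= V t.
  have [x xm _] := hS t; rewrite (V1 _ _ xm) /penalty addr_ge0 ?sqr_ge0 // mulr_ge0 ?sqr_ge0 //.
have VS t : ev S t (V t) = 0.
  by have [x xm e] := hS t; rewrite (V1 _ _ xm).
have [CV CV0 [e2 /andP[e20 e21] hCV]] := algebraic_doubling S0 K0 (fun t _ => V0 t) Vl (fun t _ => VS t).
have [e1 /andP[e10 e11] [Gs hGs hcov]] := regular_factors_seq hQ1.
have [CH CH0 [Xi hXi]] := @holder_roots_seq R N Gs (fun G GG => let: And3 a b _ := hGs G GG in conj b a).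
have [K2 K20 [k hslab]] := @crossing_free_slab R e1 Gs Xi e11 (fun G GG => let: And3 _ _ r := hGs G GG in r).
have [Kf Kf0 hKf] := fT.
have [Lf Lf0 hLf] := fl.
pose K4 : R := (k ^ n + 2)%:R.
have K40 : 0 < K4 by rewrite ltr0n addn2.
pose K6 := 4 * K2 * K4.
have K60 : 0 < K6 by rewrite !mulr_gt0.
pose K7 := K2 * K4 * (4 * n%:R + 16 * Kf * K6).
have K70 : 0 <= K7.
  by apply: mulr_ge0; [rewrite mulr_ge0 // ltW|rewrite addr_ge0 ?mulr_ge0 // ltW].
(* The factor 4 pays for [t >= t0 / 2], [n] for the sum of squares, and [B <= B ^+ 2] replaces a
   square root. *)
pose B := 4 * CV * n%:R + 1.
have B1 : 1 <= B by rewrite lerDr !mulr_ge0.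
have B0 : 0 < B by apply: lt_le_trans B1.
have BB : 4 * CV * n%:R <= B ^+ 2.
  by apply: (@le_trans _ _ B); [rewrite lerDl|rewrite expr2 ler_peMr // ltW].
pose CS := CH + 1.
have CS0 : 0 < CS by rewrite ltr_wpDl.
(* The first bound gives [K6 * eta <= 1], which allows a positive [m]; the second makes the final
   quantity [K7 * (eta * s)] smaller than [t0]. *)
pose c := Num.min (B * K6)^-1 (2 * (K7 * B * CS + 1))^-1.
have K7BC : 0 <= K7 * B * CS := mulr_ge0 (mulr_ge0 K70 (ltW B0)) (ltW CS0).
have c0 : 0 < c by rewrite lt_min !invr_gt0 mulr_gt0 //= mulr_gt0 // ltr_wpDl.
have cK6 : c * B * K6 <= 1.
  by rewrite -mulrA -ler_pdivlMr ?mulr_gt0 // mul1r ge_min lexx.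
have cK7 : K7 * B * CS * c < 1.
  have : c * (2 * (K7 * B * CS + 1)) <= 1.
    by rewrite -ler_pdivlMr ?mulr_gt0 ?ltr_wpDl // mul1r ge_min lexx orbT.
  by move: c0; clear -K7BC; move: (K7 * B * CS) K7BC => z z0; nra.
pose t1 := Num.min 1 (Num.min (CS^-1) (Num.min e1 e2)).
have t10 : 0 < t1 by rewrite !lt_min ltr01 invr_gt0 CS0 e10.
pose de := Num.min 1 (t1 ^+ N / (2 * (Lf + 1))).
have Lf1 : 0 < 2 * (Lf + 1) by clear -Lf0; lra.
exists de; first by rewrite lt_min ltr01 divr_gt0 ?exprn_gt0 //= ge_min lexx.
exists c => // x ta xde ta0 fx.
apply: contrapT => bad.
have {}bad i : `|gf i x| < c * ta ^+ N.-1.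
  by rewrite ltNge; apply/negP => hi; apply: bad; exists i.
have xB : inB x by move=> i; apply: le_trans (xde i) _; rewrite ge_min lexx.
have B00 : inB (fun _ : 'I_n => 0 : R) by move=> i; rewrite normr0.
have tat1 : ta < t1.
  have : ta ^+ N < t1 ^+ N.
    have de0 : 0 <= de by rewrite le_min ler01 divr_ge0 ?exprn_ge0 ?ltW.
    have := hLf (fun=> 0) x de B00 xB de0; rewrite f0 subr0 fx => hh.
    have {}hh : `|ta ^+ N| <= Lf * de by apply: hh => i; rewrite subr0.
    apply: le_lt_trans (ler_norm _) _; apply: le_lt_trans hh _.
    have : de * (2 * (Lf + 1)) <= t1 ^+ N by rewrite -ler_pdivlMr // ge_min lexx orbT.
    have := exprn_gt0 N t10; move: de0; clear -Lf0; move: de (t1 ^+ N) => y z; nra.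
  by rewrite ltr_pXn2r // ?nnegrE ?ltW // (leq_trans _ N2).
have ta1 : ta <= 1 by apply: ltW; apply: lt_le_trans tat1 _; rewrite ge_min lexx.
set t0 := ta ^+ N in fx.
have NE : N = N.-1.+1 by rewrite prednK // ltnW.
have t00 : 0 < t0 by rewrite exprn_gt0.
have pow1 k' : ta ^+ k' <= 1 by apply: exprn_ile1 => //; exact: ltW.
have t0ta : t0 <= ta by rewrite /t0 NE exprS; apply: ler_piMr; [exact: ltW|exact: pow1].
have t0e1 : t0 < e1.
  by apply: le_lt_trans t0ta _; apply: lt_le_trans tat1 _; rewrite !ge_min lexx !orbT.
have t0e2 : t0 < e2.
  by apply: le_lt_trans t0ta _; apply: lt_le_trans tat1 _; rewrite !ge_min lexx !orbT.
(* As [CS] is at least [CH] and at least 1, [s ^+ N >= CH * t0]: coordinates at levels up to [t0]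
   are within [s] of the limit values. *)
pose s := CS * ta.
have s0 : 0 < s by rewrite mulr_gt0.
have s1 : s <= 1.
  have : ta <= CS^-1 by apply: ltW; apply: lt_le_trans tat1 _; rewrite !ge_min lexx !orbT.
  by rewrite /s mulrC -ler_pdivlMr // mul1r.
pose q := c * ta ^+ N.-1.
have q0 : 0 < q by rewrite mulr_gt0 // exprn_gt0.
pose eta := B * q.
have eta0 : 0 < eta by rewrite mulr_gt0.
have etaE : eta ^+ 2 = B ^+ 2 * q ^+ 2 by rewrite /eta exprMn.
have etaK6 : K6 * eta <= 1.
  apply: le_trans cK6; rewrite /eta /q.
  have -> : K6 * (B * (c * ta ^+ N.-1)) = c * B * K6 * ta ^+ N.-1 by ring.
  by apply: ler_piMr; [rewrite !mulr_ge0 // ltW|exact: pow1].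
have Vt0 : V t0 <= t0 ^+ 2 * (n%:R * q ^+ 2).
  apply: le_trans (V2 t0 x xB) _; rewrite /penalty fx subrr expr0n addr0 ler_wpM2l ?sqr_ge0 //.
  rewrite /h; apply: (@le_trans _ _ (\sum_(i < n) q ^+ 2)).
    apply: ler_sum => i _; rewrite -[X in X <= _]real_normK ?num_real //.
    by rewrite lerXn2r ?nnegrE ?(ltW q0) ?(ltW (bad i)).
  by rewrite sumr_const card_ord -[_ *+ n]mulr_natl.
have [z hz] : exists z : R -> 'I_n -> R, forall t, 0 < t ->
    [/\ minimizer (penalty f h t) (z t) &
    forall j, exists2 Q, Q \in Qs & ev Q (f (z t)) (z t j) = 0].
  have ex t : exists z, 0 < t -> [/\ minimizer (penalty f h t) z &
    forall j, exists2 Q, Q \in Qs & ev Q (f z) (z j) = 0].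
    have [t_gt0|] := ltP 0 t; last by move=> _; exists (fun=> 0).
    by have [y ym yQ] := hQ2 t t_gt0; exists y.
  by have [z hz] := choice ex; exists z.
have zprop t : t0 / 2 <= t <= t0 -> [/\ inB (z t), (forall i, `|gf i (z t)| <= eta) & `|f (z t) - t| <= eta * t0].
  move=> /andP[tl tu].
  have tp : 0 < t by clear -tl t00; lra.
  have [zm _] := hz t tp; have [zB _] := zm.
  have Vt : V t <= CV * (t0 ^+ 2 * (n%:R * q ^+ 2)).
    apply: le_trans (hCV t0 t _ _) _; rewrite ?t00 ?tl //.
    by rewrite ler_wpM2l.
  have Vz := V1 t _ zm; rewrite /penalty in Vz.
  have q20 : 0 <= n%:R * q ^+ 2 by rewrite mulr_ge0 ?sqr_ge0.
  have hz2 : h (z t) <= eta ^+ 2.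
    have le1 : t ^+ 2 * h (z t) <= V t by rewrite Vz lerDl sqr_ge0.
    have le2 : CV * (t0 ^+ 2 * (n%:R * q ^+ 2)) <= t ^+ 2 * eta ^+ 2.
      apply: (@le_trans _ _ (t ^+ 2 * (4 * CV * n%:R * q ^+ 2))).
        have -> : CV * (t0 ^+ 2 * (n%:R * q ^+ 2)) = t0 ^+ 2 * (CV * n%:R * q ^+ 2) by ring.
        have -> : t ^+ 2 * (4 * CV * n%:R * q ^+ 2) = (2 * t) ^+ 2 * (CV * n%:R * q ^+ 2) by ring.
        have X0 : 0 <= CV * n%:R * q ^+ 2 by apply: mulr_ge0; [exact: mulr_ge0|exact: sqr_ge0].
        have t2 : t0 <= 2 * t by clear -tl; lra.
        have sq2 : t0 ^+ 2 <= (2 * t) ^+ 2.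
          by rewrite lerXn2r ?nnegrE ?(ltW t00) ?mulr_ge0 ?(ltW tp).
        exact: ler_wpM2r X0 _ _ sq2.
      rewrite etaE; apply: ler_wpM2l; [exact: sqr_ge0|exact: ler_wpM2r (sqr_ge0 q) _ _ BB].
    have := le_trans le1 (le_trans Vt le2).
    by rewrite ler_pM2l // exprn_gt0.
  split=> //.
    move=> i; rewrite -[eta]gtr0_norm // -ler_sqr ?nnegrE //.
    rewrite !real_normK ?num_real //; apply: le_trans hz2.
    by rewrite /h (bigD1 i) //= lerDl; apply: sumr_ge0 => j _; exact: sqr_ge0.
  have ep : 0 <= eta * t0 by rewrite mulr_ge0 // ltW.
  rewrite -[eta * t0]ger0_norm // -ler_sqr ?nnegrE // !real_normK ?num_real //.
  have le1 : (f (z t) - t) ^+ 2 <= V t by rewrite Vz lerDr mulr_ge0 ?sqr_ge0.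
  apply: le_trans le1 _; apply: le_trans Vt _.
  have -> : (eta * t0) ^+ 2 = (eta ^+ 2) * t0 ^+ 2 by rewrite [LHS]exprMn.
  have -> : CV * (t0 ^+ 2 * (n%:R * q ^+ 2)) = (CV * n%:R * q ^+ 2) * t0 ^+ 2 by ring.
  apply: ler_wpM2r (sqr_ge0 _) _ _ _; rewrite etaE; apply: ler_wpM2r (sqr_ge0 q) _ _ _.
  apply: le_trans BB; rewrite -mulrA; apply: ler_peMl; [exact: mulr_ge0|by rewrite ler1n].
(* The upper bound on [m] keeps the level error [eta * t0] within a quarter of the spacing of the
   levels; the lower bound makes the quadratic Taylor term comparable with the linear one. *)
have [m m0 /andP[mle mge]] : exists2 m, (0 < m)%N & m%:R <= (K6 * eta)^-1 <= 2 * m%:R.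
  by apply: nat_between; rewrite invf_ge1 // mulr_gt0.
have [a [b [La [ta2 ab bt0 slab sLa] hLa]]] := hslab t0 s m (introT andP (conj t00 t0e1)) s0 m0.
have mR : 0 < m%:R :> R by rewrite ltr0n.
have tab t : a <= t <= b -> t0 / 2 <= t <= t0.
  by move=> /andP[t_a t_b]; rewrite (le_trans ta2 t_a) (le_trans t_b bt0).
have a0 : 0 < a by clear -ta2 t00; lra.
have [|||t [t' [ti ti' near far]]] := @close_pair R n k f La a b eta t0 (s / m%:R) z ab (ltW eta0) _ bt0 sLa.
- have : K6 * eta * m%:R <= 1 by rewrite mulrC -(ler_pdivlMr _ _ (mulr_gt0 K60 eta0)) div1r.
  move=> hm; rewrite -/K4.
  have : t0 * (K6 * eta * m%:R) <= K2 * m%:R * (b - a) by apply: le_trans slab; rewrite ler_piMr // ltW.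
  have -> : t0 * (K6 * eta * m%:R) = K2 * m%:R * (t0 * eta * (4 * K4)) by rewrite /K6; ring.
  by rewrite ler_pM2l // mulr_gt0.
- by move=> t ti; case: (zprop t (tab t ti)).
- move=> t i ti /andP[fa fb]; have [zB _ _] := zprop t (tab t ti).
  have tp : 0 < t by apply: lt_le_trans a0 _; case/andP: ti.
  have [_ /(_ i) [Q QQ Qz]] := hz t tp.
  have fp0 : 0 < f (z t) by apply: lt_le_trans fa.
  have fe1 : 0 < f (z t) < e1 by rewrite fp0 (le_lt_trans fb) // (le_lt_trans bt0).
  have [G GG Gz] := hcov Q _ _ QQ fe1 Qz.
  have [|xi xiX le] := hXi G _ _ GG _ (zB i) Gz.
    by rewrite ltW //= (le_trans fb) // (le_trans bt0) // (le_trans t0ta).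
  apply: (hLa G _ _ xi GG _ Gz xiX); first by rewrite fa.
  have : `|z t i - xi| ^+ N <= s ^+ N.
    apply: le_trans le _; apply: (@le_trans _ _ (CH * t0)).
      by rewrite ler_wpM2l // (le_trans fb).
    rewrite /s exprMn ler_wpM2r ?(ltW t00) //.
    apply: (@le_trans _ _ CS); first by rewrite lerDl.
    by rewrite NE exprS; apply: ler_peMr; [exact: ltW|apply: exprn_ege1; rewrite lerDr].
  by rewrite ler_pXn2r // ?nnegrE ?(ltW s0) // ltnW.
have [zB zg _] := zprop t (tab t ti); have [zB' _ _] := zprop t' (tab t' ti').
have sm0 : 0 < s / m%:R by rewrite divr_gt0.
have sm1 : 2 * (s / m%:R) <= 2.
  rewrite -[X in _ <= X]mulr1 ler_pM2l // ler_pdivrMr // mul1r (le_trans s1) // ler1n //.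
have dif : `|f (z t') - f (z t)| <= n%:R * eta * (2 * (s / m%:R)) + Kf * (2 * (s / m%:R)) ^+ 2.
  have sm2 : 0 <= 2 * (s / m%:R) <= 2 by rewrite sm1 mulr_ge0 // ltW.
  have hh := hKf (z t) (z t') _ zB zB' sm2 near.
  have := sum_near zg near.
  move: hh; set Sg := \sum_i _ => hh hS'.
  have -> : f (z t') - f (z t) = Sg + (f (z t') - f (z t) - Sg) by ring.
  by apply: le_trans (ler_normD _ _) _; apply: lerD.
have slab' : t0 <= K2 * m%:R * (K4 * ((b - a) / K4)) by rewrite [K4 * _]mulrC divfK ?gt_eqF.
have mge' : 1 <= 2 * (K6 * eta * m%:R).
  have k6e := mulr_gt0 K60 eta0.
  have : (K6 * eta) * (K6 * eta)^-1 <= (K6 * eta) * (2 * m%:R) by apply: ler_wpM2l mge; exact: ltW.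
  by rewrite divff ?gt_eqF // mulrCA.
have := @numeric_bound R t0 K2 K4 m%:R ((b - a) / K4) n%:R eta s Kf K6 mR (ltW K20) (ltW K40)
   (ler0n _ _) (ltW eta0) (introT andP (conj (ltW s0) s1)) Kf0 (ltW K60) slab' mge' (le_trans far dif).
rewrite -/K7 => /le_lt_trans lt_end.
have : K7 * (eta * s) < t0.
  have -> : K7 * (eta * s) = (K7 * B * CS * c) * t0.
    by rewrite /eta /s /q /t0 [in RHS]NE exprS; ring.
  by rewrite gtr_pMl.
by move=> /lt_end; rewrite ltxx.
Qed.

(** * Polyhedral constraints *)

(** This is [D * (3 * D - 3) ^ (n - 1)] for the degree [D = d + 2]. *)
Definition loj_degree (d n : nat) : nat := (d.+2 * (3 * d + 3) ^ n.-1)%N.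

Lemma loj_degree_gt1 d n : (1 < loj_degree d n)%N.
Proof.
have : (0 < (3 * d + 3) ^ n.-1)%N by rewrite expn_gt0 addn3.
by rewrite /loj_degree; move: ((3 * d + 3) ^ n.-1)%N => z; clear; nia.
Qed.

Lemma lojasiewicz (R : realType) n (i0 : 'I_n) d (f : ('I_n -> R) -> R) gf :
  pol d.+2 f -> (forall i, pol d.+1 (gf i)) -> taylor f gf ->
  exists2 de, 0 < de <= 1 & exists2 c, 0 < c & forall x ta, (forall i, `|x i| <= de) -> 0 <= ta ->
    `|f x - f (fun=> 0)| = ta ^+ loj_degree d n ->
    exists i, c * ta ^+ (loj_degree d n).-1 <= `|gf i x|.
Proof.
move=> fp gfp fT; set f0 := f (fun=> 0); have fl := pol_lipB fp.
have pole a : pol d.+2 (fun x => a * (f x + - f0)).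
  by apply: polZ; apply: pfunD => //; apply: pfunW (pol_const n (- f0)).
have tayl a : taylor (fun x => a * (f x + - f0)) (fun i x => a * gf i x).
  apply: eq_taylor (taylor_Z a _ (taylor_D fT (taylor_const n (- f0)))) => // [i x|].
    by rewrite addr0.
  by apply: lipB_D => //; exact: lipB_const.
have main a := lojasiewicz_pos i0 (pole a) (fun i => polZ a (gfp i)) (tayl a) (etrans (congr1 _ (subrr f0)) (mulr0 a)).
have [d1 /andP[d10 d11] [c1 c10 h1]] := main 1.
have [d2 /andP[d20 d21] [c2 c20 h2]] := main (-1).
exists (Num.min d1 d2); first by rewrite lt_min d10 d20 ge_min d11.
exists (Num.min c1 c2); first by rewrite lt_min c10.
move=> x ta xd; rewrite le_eqVlt => /orP[/eqP <- _|ta0 e].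
  exists i0; rewrite expr0n; have := loj_degree_gt1 d n.
  by case: (loj_degree d n) => [//|[//|k]] _ /=; rewrite mulr0.
have pw : 0 <= ta ^+ (loj_degree d n).-1 by rewrite exprn_ge0 // ltW.
have [ge|lt] := leP 0 (f x - f0).
  have [||i hi] := h1 x ta _ ta0.
  - by move=> i; apply: le_trans (xd i) _; rewrite ge_min lexx.
  - by rewrite mul1r -[RHS]e ger0_norm.
  exists i; rewrite mul1r in hi; apply: le_trans hi.
  by rewrite ler_wpM2r // ge_min lexx.
have [||i hi] := h2 x ta _ ta0.
- by move=> i; apply: le_trans (xd i) _; rewrite ge_min lexx orbT.
- by rewrite mulN1r -[RHS]e ltr0_norm.
exists i; rewrite mulN1r normrN in hi; apply: le_trans hi.
by rewrite ler_wpM2r // ge_min lexx orbT.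
Qed.

Lemma polX (R : idomainType) n D (a : ('I_n -> R) -> R) k :
  pol D a -> pol (D * k) (fun x => a x ^+ k).
Proof.
move=> ap; elim: k => [|k IH]; first by rewrite muln0; apply: eq_pol (pol_const n 1) => x; rewrite expr0.
by rewrite mulnS; apply: eq_pol (pfunM ap IH) => x; rewrite exprS.
Qed.

Lemma pol_prod (R : idomainType) n (I : Type) (s : seq I) (D : I -> nat) (a : I -> ('I_n -> R) -> R) :
  (forall i, pol (D i) (a i)) -> pol (\sum_(i <- s) D i) (fun x => \prod_(i <- s) a i x).
Proof.
move=> ap; elim: s => [|i s IH].
  by rewrite big_nil; apply: eq_pol (pol_const n 1) => x; rewrite big_nil.
by rewrite big_cons; apply: eq_pol (pfunM (ap i) IH) => x; rewrite big_cons.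
Qed.

Lemma pol_affine (R : idomainType) n n' D (f : ('I_n -> R) -> R) (a : 'I_n -> ('I_n' -> R) -> R) :
  (forall i, pol 1 (a i)) -> pol D f -> pol D (fun x => f (fun i => a i x)).
Proof.
move=> ap [ms msD /(_ (fun=> 0)) fE].
apply: (eq_pol (f1 := fun x => \sum_(m <- ms) m.1 * mono (fun i => a i x) m.2)).
  by move=> x; rewrite fE.
elim: ms msD {fE} => [_|m ms IH /= /andP[mD msD]].
  by apply: eq_pol (pfunW (leq0n _) (pol_const _ 0)) => x; rewrite big_nil.
apply: eq_pol (pfunD (polZ m.1 (pfunW mD _)) (IH msD)) => [x|]; first by rewrite big_cons.
rewrite /mdeg; apply: pol_prod => i; have := polX (m.2 i) (ap i); by rewrite mul1n.
Qed.

(** A projection, unlike a basis of the kernel, keeps [n] variables for every [J], so one exponent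
    serves all faces. *)
Lemma kernel_projection (R : fieldType) n m (A : 'I_m -> 'I_n -> R) (J : {set 'I_m}) :
  exists Z : 'I_n -> 'I_n -> R,
    (forall j i, j \in J -> \sum_k A j k * Z k i = 0) /\
    (forall u, (forall j, j \in J -> \sum_k A j k * u k = 0) -> forall k, \sum_i Z k i * u i = u k).
Proof.
pose B : 'M[R]_(n, m) := \matrix_(k, j) if j \in J then A j k else 0.
pose P := proj_mx (kermx B) (kermx B)^C%MS.
exists (fun k i => P i k); split.
  move=> j i jJ.
  have : (row i P <= kermx B)%MS by rewrite rowE; exact: proj_mx_sub.
  move=> /sub_kermxP /rowP /(_ j); rewrite !mxE => hk; rewrite -[RHS]hk.
  by apply: eq_bigr => k _; rewrite !mxE jJ mulrC.
move=> u uJ k.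
have uk : ((\row_i u i : 'rV_n) <= kermx B)%MS.
  apply/sub_kermxP/rowP => j; rewrite !mxE.
  case jJ : (j \in J); last by rewrite big1 // => i _; rewrite !mxE jJ mulr0.
  by rewrite -[RHS](uJ j jJ); apply: eq_bigr => i _; rewrite !mxE jJ mulrC.
have := proj_mx_id (capmx_compl (kermx B)) uk.
move=> /rowP /(_ k); rewrite !mxE => hk; rewrite -[RHS]hk.
by apply: eq_bigr => i _; rewrite !mxE mulrC.
Qed.

Definition dot (R : pzRingType) n (a x : 'I_n -> R) : R := \sum_i a i * x i.

Lemma dot_bound (R : realFieldType) n (a x : 'I_n -> R) e : (forall i, `|x i| <= e) ->
  `|dot a x| <= (\sum_i `|a i|) * e.
Proof.
move=> xe; apply: le_trans (ler_norm_sum _ _ _) _; rewrite mulr_suml.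
by apply: ler_sum => i _; rewrite normrM ler_wpM2l.
Qed.

Lemma taylor_linear (R : realFieldType) n (f : ('I_n -> R) -> R) gf (Z : 'I_n -> 'I_n -> R) :
  (forall k, \sum_i `|Z k i| <= 1) -> taylor f gf ->
  taylor (fun p => f (fun k => dot (Z k) p)) (fun i p => \sum_k gf k (fun k => dot (Z k) p) * Z k i).
Proof.
move=> Z1 [M M0 hM]; exists M => // x y e xB yB e2 xy.
have e0 : 0 <= e by case/andP: e2.
have ZB p : inB p -> inB (fun k => dot (Z k) p).
  by move=> pB k; apply: le_trans (dot_bound _ pB) _; rewrite mulr1.
have dotB k : dot (Z k) y - dot (Z k) x = dot (Z k) (fun i => y i - x i).
  by rewrite /dot -sumrB; apply: eq_bigr => i _; rewrite mulrBr.
have near : near_by e (fun k => dot (Z k) x) (fun k => dot (Z k) y).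
  by move=> k; rewrite dotB; apply: le_trans (dot_bound _ xy) _; rewrite ler_piMl.
have := hM _ _ e (ZB _ xB) (ZB _ yB) e2 near.
suff -> : \sum_i (\sum_k gf k (fun k => dot (Z k) x) * Z k i) * (y i - x i) =
   \sum_i gf i (fun k => dot (Z k) x) * (dot (Z i) y - dot (Z i) x) by [].
under eq_bigr do rewrite mulr_suml.
rewrite exchange_big /=; apply: eq_bigr => k _; rewrite dotB /dot mulr_sumr.
by apply: eq_bigr => i _; rewrite mulrA.
Qed.

(* On the affine hull of a face every normal vector vanishes, so only the gradient of the
   restriction matters; restrictions are parametrised by a projection of the whole space. *)
Lemma lojasiewicz_polyhedral (R : realType) n (i0 : 'I_n) d (f : ('I_n -> R) -> R) gf m
    (A : 'I_m -> 'I_n -> R) (be : 'I_m -> R) :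
  pol d.+2 f -> (forall i, pol d.+1 (gf i)) -> taylor f gf -> (forall j, 0 <= be j) ->
  exists2 de, 0 < de <= 1 & exists2 c, 0 < c & forall y v ta M,
    (forall j, dot (A j) y <= be j) -> (forall i, `|y i| <= de) ->
    (forall z, (forall j, dot (A j) z <= be j) -> dot v (fun i => z i - y i) <= 0) ->
    0 <= ta -> `|f y - f (fun=> 0)| = ta ^+ loj_degree d n ->
    (forall i, `|gf i y + v i| <= M) -> c * ta ^+ (loj_degree d n).-1 <= M.
Proof.
move=> fp gfp fT be0.
have /fin_all_exists [Z hZ] := kernel_projection A.
(* Dividing by [W J] makes the parametrisation map the unit box into itself. *)
pose W J : R := 1 + \sum_k \sum_i `|Z J k i|.
have W1 J : 1 <= W J by rewrite lerDl sumr_ge0 // => k _; rewrite sumr_ge0.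
have W0 J : 0 < W J by apply: lt_le_trans (W1 J).
pose ZW J k i := Z J k i / W J.
have ZW1 J k : \sum_i `|ZW J k i| <= 1.
  rewrite (eq_bigr (fun i => `|Z J k i| / W J)) => [|i _]; last by rewrite normrM normfV (gtr0_norm (W0 J)).
  rewrite -mulr_suml ler_pdivrMr // mul1r /W [X in _ <= _ + X](bigD1 k) //= addrCA lerDl addr_ge0 // sumr_ge0 // => k' _.
  by rewrite sumr_ge0.
have core J : exists dc : R * R, [/\ 0 < dc.1, 0 < dc.2 & forall x ta, (forall i, `|x i| <= dc.1) -> 0 <= ta ->
    `|f (fun k => dot (ZW J k) x) - f (fun=> 0)| = ta ^+ loj_degree d n ->
    exists i, dc.2 * ta ^+ (loj_degree d n).-1 <= `|\sum_k gf k (fun k => dot (ZW J k) x) * ZW J k i|].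
  have lin k : pol 1 (fun x : 'I_n -> R => dot (ZW J k) x).
    apply: pfun_sum => i; apply: polZ; exact: pfun_coord.
  have gpol i : pol d.+1 (fun p => \sum_k gf k (fun k => dot (ZW J k) p) * ZW J k i).
    apply: pfun_sum => k; apply: (eq_pol (f1 := fun p => ZW J k i * gf k (fun k => dot (ZW J k) p))).
      by move=> p; rewrite mulrC.
    by apply: polZ; apply: pol_affine.
  have [e /andP[e0 _] [c c0 h]] := lojasiewicz i0 (pol_affine lin fp) gpol (taylor_linear (ZW1 J) fT).
  exists (e, c); split=> // x ta xe ta0 E; apply: h => //.
  rewrite -E; congr (`|_ - f _|); apply: funext => k.
  by rewrite /dot big1 // => i _; rewrite mulr0.
have /fin_all_exists [dc hdc] := core.
have dcW J : 0 < (dc J).1 / W J by case: (hdc J) => h _ _; rewrite divr_gt0.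
have [d1 d10 hd1] := exists_min_pos dcW.
have dc2 J : 0 < (dc J).2 by case: (hdc J).
have [c1 c10 hc1] := exists_min_pos dc2.
pose al j : R := 1 + \sum_i `|A j i|.
have al0 j : 0 < al j by rewrite ltr_pwDl // sumr_ge0.
(* Constraints slack at 0 stay slack within [d2], strictly because of the division by 2; the others
   get the default 1. So a constraint active at [y] is active at 0, and [y] lies in the kernel for
   its own active set. *)
have slk j : 0 < (if 0 < be j then be j / al j / 2 else 1).
  by case: ifP => // b; rewrite !divr_gt0.
have [d2 d20 hd2] := exists_min_pos slk.
exists (Num.min 1 (Num.min d1 d2)); first by rewrite !lt_min ltr01 d10 d20 ge_min lexx.
exists c1 => // y v ta M yOm yd vN ta0 E hM.
have {}yd1 i : `|y i| <= d1 by apply: le_trans (yd i) _; rewrite !ge_min lexx orbT.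
have {}yd2 i : `|y i| <= d2 by apply: le_trans (yd i) _; rewrite !ge_min lexx !orbT.
pose J := [set j | dot (A j) y == be j].
have yJ j : j \in J -> dot (A j) y = 0.
  rewrite inE => /eqP e; have := be0 j; rewrite le_eqVlt => /orP[/eqP->//|bp].
  have := hd2 j; rewrite bp => h.
  have := dot_bound (A j) yd2; rewrite e gtr0_norm // => h1.
  have : be j <= al j * (be j / al j / 2).
    apply: le_trans h1 _; apply: ler_pM => //; [exact: sumr_ge0|exact: ltW|by rewrite lerDr].
  have -> : al j * (be j / al j / 2) = be j / 2 by field; rewrite gt_eqF.
  by move: bp; clear; lra.
have [Z1 Z2] := hZ J; have [_ _ hJ] := hdc J.
pose p i := W J * y i.
have pE k : dot (ZW J k) p = y k.
  rewrite -[RHS](Z2 y yJ k); apply: eq_bigr => i _; rewrite /ZW /p.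
  by field; rewrite gt_eqF.
have pE' : (fun k => dot (ZW J k) p) = y by apply: funext.
have [||i hi] := hJ p ta _ ta0.
- move=> i; rewrite /p normrM gtr0_norm // mulrC -ler_pdivlMr //.
  by apply: le_trans (yd1 i) (hd1 J).
- by rewrite pE'.
rewrite pE' in hi.
pose w k := ZW J k i.
have wJ j : j \in J -> dot (A j) w = 0.
  move=> jJ; rewrite /dot /w /ZW (eq_bigr (fun k => A j k * Z J k i / W J)) => [|k _]; last by rewrite mulrA.
  by rewrite -mulr_suml Z1 // mul0r.
(* [w] preserves the active constraints and small multiples of it respect the slack ones. Moving
   from [y] by [s] times [w] in either direction is feasible, so the normal-cone inequality holds
   with both signs. *)
have vw : dot v w = 0.
  have sl j : 0 < (if j \in J then 1 else (be j - dot (A j) y) / (`|dot (A j) w| + 1)).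
    case: ifP => // jJ; apply: divr_gt0; last by rewrite ltr_wpDl.
    rewrite subr_gt0 lt_def yOm andbT.
    by move: jJ; rewrite inE eq_sym => ->.
  have [s s0 hs] := exists_min_pos sl.
  have move (th : R) : `|th| <= s -> th * dot v w <= 0.
    move=> ths.
    have : dot v (fun i => (y i + th * w i) - y i) <= 0.
      apply: vN => j.
      have -> : dot (A j) (fun i => y i + th * w i) = dot (A j) y + th * dot (A j) w.
        by rewrite /dot mulr_sumr -big_split; apply: eq_bigr => l _ /=; ring.
      case jJ : (j \in J); first by rewrite wJ // mulr0 addr0.
      have := hs j; rewrite jJ ler_pdivlMr ?ltr_wpDl // => h.
      rewrite addrC -lerBrDr; apply: le_trans (ler_norm _) _; rewrite normrM.
      apply: le_trans h; apply: ler_pM => //.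
      by rewrite lerDl.
    suff -> : dot v (fun i => y i + th * w i - y i) = th * dot v w by [].
    by rewrite /dot mulr_sumr; apply: eq_bigr => l _; ring.
  have h1 := move s; have h2 := move (- s); rewrite normrN in h2.
  rewrite (gtr0_norm s0) lexx in h1 h2.
  apply/eqP; rewrite eq_le -(pmulr_rle0 _ s0) h1 //=.
  by rewrite -oppr_le0 -(pmulr_rle0 _ s0) mulrN -mulNr h2.
apply: (@le_trans _ _ ((dc J).2 * ta ^+ (loj_degree d n).-1)).
  by rewrite ler_wpM2r ?exprn_ge0.
apply: le_trans hi _.
have -> : \sum_k gf k y * ZW J k i = dot (fun k => ZW J k i) (fun k => gf k y + v k).
  transitivity (\sum_k gf k y * ZW J k i + dot v w); first by rewrite vw addr0.
  rewrite /dot -big_split; apply: eq_bigr => k _ /=; rewrite /w; ring.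
apply: le_trans (dot_bound _ hM) _.
have M0 : 0 <= M by apply: le_trans (hM i0).
rewrite ler_piMl //.
rewrite (eq_bigr (fun k => `|Z J k i| / W J)) => [|k _]; last by rewrite normrM normfV (gtr0_norm (W0 J)).
rewrite -mulr_suml ler_pdivrMr // mul1r /W; apply: ler_wpDl => //.
by apply: ler_sum => k _; rewrite (bigD1 i) //= lerDl sumr_ge0.
Qed.

(** * Translation to Stdlib reals *)

Delimit Scope R_scope with coqR.
Local Notation R := Rdefinitions.R.

Lemma vsumE n (f : nat -> R) : vsum n f = \sum_(i < n) f i.
Proof. by elim: n => [|n IH]; rewrite ?big_ord0 // big_ord_recr /= IH. Qed.

Lemma vprodE n (f : nat -> R) : vprod n f = \prod_(i < n) f i.
Proof. by elim: n => [|n IH]; rewrite ?big_ord0 // big_ord_recr /= IH. Qed.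

Lemma nsumE n (f : nat -> nat) : nsum n f = (\sum_(i < n) f i)%N.
Proof. by elim: n => [|n IH]; rewrite ?big_ord0 // big_ord_recr /= IH. Qed.

Lemma fold_rightE (T : Type) (g : T -> R) (s : list T) :
  List.fold_right Rplus 0%coqR (List.map g s) = \sum_(m <- s) g m.
Proof. by elim: s => [|m s IH]; rewrite ?big_nil // big_cons /= IH. Qed.

Lemma mono_evalE n (m : R * (nat -> nat)) (x : nat -> R) :
  mono_eval n m x = m.1 * \prod_(i < n) x i ^+ m.2 i.
Proof.
rewrite /mono_eval vprodE RmultE; congr (_ * _).
by apply: eq_bigr => i _; rewrite RpowE.
Qed.

Lemma poly_le_ext n d f (x y : nat -> R) : poly_le n d f -> (forall i : 'I_n, x i = y i) -> f x = f y.
Proof.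
move=> [ms [_ fE]] xy; rewrite !fE !fold_rightE; apply: eq_bigr => m _.
by rewrite !mono_evalE; congr (_ * _); apply: eq_bigr => i _; rewrite xy.
Qed.

Lemma poly_le_pol n d f : poly_le n d f -> pol d (fun x : 'I_n -> R => f (ext x)).
Proof.
move=> [ms [msd fE]].
exists [seq ((m.1 : tower R 0), [ffun i : 'I_n => m.2 i]) | m : R * (nat -> nat) <- ms].
  elim: ms msd {fE} => [//|m ms IH] h /=; rewrite IH ?andbT; last by move=> m' mm; apply: h; right.
  rewrite (eq_mdeg (m2 := fun i => m.2 i)) => [|i]; last by rewrite ffunE.
  by rewrite /mdeg -nsumE; apply/ssrnat.leP/h; left.
move=> v x; rewrite fE fold_rightE big_map; apply: eq_bigr => m _ /=.
rewrite mono_evalE; congr (_ * _); apply: eq_bigr => i _.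
by rewrite extE ffunE.
Qed.

Lemma coord_le_vnorm n (x : nat -> R) (i : 'I_n) : `|x i| <= vnorm n x.
Proof.
rewrite /vnorm RsqrtE -sqrtr_sqr; apply: ler_wsqrtr.
rewrite /vdot vsumE (bigD1 i) //= RmultE -expr2 lerDl sumr_ge0 // => j _.
by rewrite RmultE -expr2 sqr_ge0.
Qed.

Lemma vdotE n (a x : nat -> R) : vdot n a x = dot (fun i : 'I_n => a i) (fun i => x i).
Proof. by rewrite /vdot vsumE. Qed.

Lemma taylor_partial n (f : ('I_n -> R) -> R) gf (y : 'I_n -> R) (i : 'I_n) (F : R -> R) (a l : R) :
  taylor f gf -> (forall k, `|y k| < 1) ->
  (forall h : R, F (a + h) = f (fun k => y k + (if k == i then h else 0))) ->
  derivable_pt_lim F a l -> l = gf i y.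
Proof.
move=> [M M0 hM] y1 FE Fl; apply: (uniqueness_limite F a) => // e /RltP e0.
have d0 : 0 < Num.min (1 - `|y i|) (e / (M + 1)) by rewrite lt_min subr_gt0 y1 divr_gt0 // ltr_wpDl.
exists (mkposreal _ (elimT RltP d0)) => h hn0 /RltP /=.
rewrite RabsE lt_min => /andP[h1 h2]; apply/RltP.
rewrite RabsE RdivE !RminusE RplusE.
have h0 : h != 0 by apply/eqP.
have yB : inB y by move=> k; exact: ltW.
have yB' : inB (fun k => y k + (if k == i then h else 0)).
  move=> k; case: eqP => [->|_]; last by rewrite addr0.
  apply: le_trans (ler_normD _ _) _; rewrite -lerBrDl; exact: ltW.
have nb : near_by `|h| y (fun k => y k + (if k == i then h else 0)).
  by move=> k; rewrite addrC addKr; case: eqP => _; rewrite ?normr0.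
have h2' : 0 <= `|h| <= 2.
  rewrite normr_ge0 /=; apply: le_trans (ltW h1) _; apply: (@le_trans _ _ 1); last by rewrite ler1n.
  by rewrite gerBl.
have := hM _ _ _ yB yB' h2' nb.
rewrite (bigD1 i) //= big1 ?addr0; last by move=> j /negPf ji; rewrite ji addr0 subrr mulr0.
rewrite eqxx [y i + h]addrC addrK -FE.
have -> : f y = F a.
  have := FE 0; rewrite addr0 => ->; congr f; apply: funext => k.
  by case: eqP => _; rewrite addr0.
move=> H.
have -> : (F (a + h) - F a) / h - gf i y = (F (a + h) - F a - gf i y * h) / h by field.
rewrite normrM normfV ltr_pdivrMr ?normr_gt0 //; apply: le_lt_trans H _.
rewrite expr2 mulrA ltr_pM2r ?normr_gt0 //.
have : `|h| * (M + 1) < e by rewrite -ltr_pdivlMr // ltr_wpDl.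
by apply: le_lt_trans; rewrite mulrDr mulr1 mulrC lerDl.
Qed.

Lemma loj_degreeE d n : INR (loj_degree d n) = (INR d.+2 * INR (3 * d.+2 - 3)%coq_nat ^ (n - 1)%coq_nat)%coqR.
Proof.
have -> : (3 * d.+2 - 3)%coq_nat = (3 * d + 3)%N by lia.
have -> : (n - 1)%coq_nat = n.-1 by lia.
by rewrite RmultE RpowE !INRE /loj_degree natrM natrX.
Qed.

(** [ta] is the [N]-th root of [a]. At [a = 0] both powers vanish because [N - 1] is positive, in
    accordance with the value 0 of [rpow] there. *)
Lemma rpow_theta d n (a : R) : 0 <= a -> exists ta : R, [/\ 0 <= ta, a = ta ^+ loj_degree d n &
  rpow a (theta d.+2 n) = ta ^+ (loj_degree d n).-1].
Proof.
have N1 := loj_degree_gt1 d n.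
rewrite le_eqVlt => /orP[/eqP <-|a0].
  exists 0; split=> //; first by rewrite expr0n; case: (loj_degree d n) N1.
  rewrite /rpow; case: Rlt_dec => [/RltP|_]; first by rewrite ltxx.
  by rewrite expr0n; case: (loj_degree d n) N1 => [//|[//|k]].
set N := loj_degree d n in N1 *.
have NR : INR N <> 0%coqR by apply: not_0_INR => e; rewrite e in N1.
have tap : (0 < Rpower a (/ INR N))%coqR by apply: exp_pos.
have taN k : Rpower a (/ INR N) ^+ k = Rpower a (/ INR N * INR k).
  by rewrite -RpowE -Rpower_pow // Rpower_mult.
exists (Rpower a (/ INR N)); split; first by apply/ltW/RltP.
  rewrite taN Rinv_l // Rpower_1 //; exact/RltP.
rewrite taN /rpow; case: Rlt_dec => [_|[]]; last exact/RltP.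
congr Rpower; rewrite /theta -loj_degreeE -/N.
have -> : INR N.-1 = (INR N - 1)%coqR.
  have {2}-> : N = N.-1.+1 by rewrite prednK // ltnW.
  by rewrite S_INR RminusE RplusE addrK.
by rewrite RmultE !RminusE RinvE mulrBr mulr1 mulVf //; apply/eqP.
Qed.

Lemma lojasiewicz_stdlib (n : nat) (L : (nat -> R) -> R) (d : nat) (gradL : (nat -> R) -> nat -> R)
    (Om : (nat -> R) -> Prop) (xs : nat -> R) :
  (1 <= n)%coq_nat -> poly_le n d L -> (2 <= d)%coq_nat -> is_gradient n L gradL ->
  polyhedral n Om -> Om xs ->
  exists delta c : R, (0 < delta)%coqR /\ (0 < c)%coqR /\
    forall x, Om x -> (vnorm n (vsub x xs) < delta)%coqR ->
    forall v, normal_cone n Om x v ->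
      (vnorm n (vadd (gradL x) v) >= c * rpow (Rabs (L x - L xs)) (theta d n))%coqR.
Proof.
move=> /ssrnat.leP hn hL /ssrnat.leP hd hgrad [m [A [b OmE]]] hxs.
case: d hL hd => [//|[//|d]] hL _.
pose i0 : 'I_n := Ordinal hn.
pose shift (y : 'I_n -> R) : nat -> R := fun k => xs k + ext y k.
pose f (y : 'I_n -> R) := L (shift y).
have fp : pol d.+2 f.
  apply: (eq_pol (f1 := fun y => L (ext (fun i : 'I_n => xs i + y i)))).
    by move=> y; apply: (poly_le_ext hL) => i; rewrite /shift !extE.
  apply: (pol_affine _ (poly_le_pol hL)) => i; apply: pfunD; last exact: pfun_coord.
  by apply: pfunW (pol_const _ (xs i)).
have [gf gfp fT] := pol_grad fp.
pose AI (j : 'I_m) (i : 'I_n) := A j i.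
pose be (j : 'I_m) := b j - dot (AI j) (fun i => xs i).
have dotB (a x : 'I_n -> R) : dot a (fun i => x i - xs i) = dot a x - dot a (fun i => xs i).
  by rewrite /dot -sumrB; apply: eq_bigr => i _; rewrite mulrBr.
have OmP x : Om x <-> forall j : 'I_m, dot (AI j) (fun i => x i - xs i) <= be j.
  rewrite OmE; split=> h j.
    by rewrite dotB lerD2r; have /RleP := h j (elimT ssrnat.ltP (ltn_ord j)); rewrite vdotE.
  move=> /ssrnat.ltP jm; have := h (Ordinal jm); rewrite dotB lerD2r => h1.
  by apply/RleP; rewrite vdotE.
have be0 j : 0 <= be j.
  have /OmP /(_ j) := hxs; apply: le_trans; rewrite /dot big1 // => i _.
  by rewrite subrr mulr0.
have [de /andP[de0 de1] [c c0 H]] := @lojasiewicz_polyhedral R n i0 d f gf m AI be fp gfp fT be0.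
exists de, c; split; [exact/RltP|split; [exact/RltP|]].
move=> x xOm /RltP xde v vN; apply/Rle_ge/RleP.
pose y (i : 'I_n) := x i - xs i.
have yde i : `|y i| < de by apply: le_lt_trans xde; exact: (coord_le_vnorm (vsub x xs) i).
have fy : f y = L x by apply: (poly_le_ext hL) => i; rewrite /shift extE /y addrC subrK.
have f0 : f (fun=> 0) = L xs by apply: (poly_le_ext hL) => i; rewrite /shift extE addr0.
have [ta [ta0 aE ->]] := @rpow_theta d n (Rabs (L x - L xs)) (introT RleP (Rabs_pos _)).
rewrite RmultE; apply: (H y (fun i => v i)) => //.
- by have /OmP := xOm.
- by move=> i; exact: ltW.
- move=> z zOm.
  have /vN /RleP : Om (shift z).
    by apply/OmP => j; have -> : (fun i : 'I_n => shift z i - xs i) = z; [apply: funext => i; rewrite /shift extE addrC addKr|].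
  rewrite vdotE; congr (_ <= _); apply: eq_bigr => i _; congr (_ * _).
  by rewrite /vsub RminusE /shift extE /y; ring.
- by rewrite fy f0 -aE RabsE.
(* Uniqueness of limits identifies the two gradients inside the open box, where [y] lies because
   [de <= 1]. *)
move=> i; have -> : gf i y = gradL x i.
  apply/esym/(taylor_partial fT (a := x i) (F := fun t => L (fun j => if Nat.eqb j i then t else x j))).
  - by move=> k; apply: lt_le_trans (yde k) de1.
  - move=> h; apply: (poly_le_ext hL) => k; rewrite /shift extE /y.
    have [->|ne] := eqVneq k i; first by rewrite PeanoNat.Nat.eqb_refl; ring.
    case: (PeanoNat.Nat.eqb_spec k i) => [e|_]; last by ring.
    by case/eqP: ne; apply: val_inj.
  exact: (hgrad x i (elimT ssrnat.ltP (ltn_ord i))).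
exact: (coord_le_vnorm (vadd (gradL x) v) i).
Qed.

End LojasiewiczPolyhedral.

Theorem mainTheorem1
  (n : nat) (hn : (1 <= n)%nat)
  (L : (nat -> R) -> R) (d : nat)
  (hL : poly_deg n L d) (hd : (2 <= d)%nat)
  (gradL : (nat -> R) -> nat -> R) (hgrad : is_gradient n L gradL)
  (Om : (nat -> R) -> Prop) (hOm : polyhedral n Om) (hne : exists y, Om y)
  (hfaces : forall F, is_face n Om F -> ~ is_vertex n F -> restr_deg_ge2 n L F)
  (xs : nat -> R) (hxs : Om xs)
  (hcrit : exists v, normal_cone n Om xs v /\
                     forall i, (i < n)%nat -> gradL xs i + v i = 0) :
  exists delta c : R, 0 < delta /\ 0 < c /\
    forall x, Om x -> vnorm n (vsub x xs) < delta ->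
    forall v, normal_cone n Om x v ->
      vnorm n (vadd (gradL x) v) >= c * rpow (Rabs (L x - L xs)) (theta d n).
Proof.
exact (LojasiewiczPolyhedral.lojasiewicz_stdlib hn (proj1 hL) hd hgrad hOm hxs).
Qed.
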